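(* Let $\mathcal G$ be a metric graph, let $\mathbf H_0$ be its minimal Kirchhoff Laplacian, let $\widetilde{\mathbf H}$ be a self-adjoint lower semi-bounded extension of $\mathbf H_0$ in $L^2(\mathcal G)$, and let $z\in\mathbb C$ with $\mathrm{Re}\,z>0$. Then the following assertions hold. (i) If the domain of $\widetilde{\mathbf H}$ is contained in $H^1(\mathcal G)$, then the semigroup operator $\mathrm e^{-z\widetilde{\mathbf H}}$ generated by $\widetilde{\mathbf H}$ is an integral operator whose kernel is both of class $L^\infty(\mathcal G\times\mathcal G)$ and jointly Hölder continuous of exponent $\beta=1/2$ (with respect to the natural path metric). (ii) If additionally $\mathcal G$ has finite total volume, then $\mathrm e^{-z\widetilde{\mathbf H}}$ is of trace class.
   Context: Metric graphs. Let $\mathcal G_d=(\mathcal V,\mathcal E)$ be an unoriented graph with countably infinite vertex and edge sets which is locally finite (each vertex $v$ has finite degree), connected and simple (no loops or multiple edges). Given edge lengths $|e|\in(0,\infty)$, $e\in\mathcal E$, the metric graph $\mathcal G=(\mathcal G_d,|\cdot|)$ is the topological space obtained by identifying each edge $e$ with the interval $[0,|e|]$ and gluing together endpoints corresponding to the same vertex. It carries the natural path metric $\varrho$ (the infimum of lengths of paths connecting two points) and the Lebesgue measure on its edges; its total volume is $\mathrm{vol}(\mathcal G)=\sum_{e\in\mathcal E}|e|$. $\mathcal E_v$ is the set of edges incident to $v$; a function $f$ on $\mathcal G$ has edge components $f_e=f|_e$; $f_e'(v)$ denotes the derivative of $f_e$ at the vertex $v$ of $e$ taken in the direction pointing from $v$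 into $e$. $L^2(\mathcal G)=\bigoplus_{e}L^2(e)$. Operators. The maximal Kirchhoff Laplacian $\mathbf H$ in $L^2(\mathcal G)$ acts by $f\mapsto -f''$ edgewise on the domain of all $f\in L^2(\mathcal G)$ with $f_e\in H^2(e)$ for all $e$, $f''\in L^2(\mathcal G)$, and satisfying at every vertex $v$ the Kirchhoff conditions: $f$ is continuous at $v$ and $\sum_{e\in\mathcal E_v}f_e'(v)=0$. $\mathbf H_0^0$ is its restriction to functions that are non-zero only on finitely many edges, and the minimal Kirchhoff Laplacian $\mathbf H_0$ is the closure of $\mathbf H_0^0$; it is symmetric and non-negative, and $\mathbf H_0^*=\mathbf H$. $H^1(\mathcal G)$ is the space of continuous $f\in L^2(\mathcal G)$ with $f_e\in H^1(e)$ for all $e$ and $\|f'\|_{L^2(\mathcal G)}^2=\sum_e\|f_e'\|^2_{L^2(e)}<\infty$. Joint Hölder continuity of exponent $1/2$ of a kernel $\mathcal K$ on $\mathcal G\times\mathcal G$ means that there is $C>0$ with $|\mathcal K(x,y)-\mathcal K(x',y')|\le C\big(\varrho(x,x')^{1/2}+\varrho(y,y')^{1/2}\big)$ for all $x,x',y,y'\in\mathcal G$. *)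

(* Defs.v *)
From HB Require Import structures.
From mathcomp Require Import all_boot all_order all_algebra.
From mathcomp Require Import complex.
From mathcomp Require Import all_classical all_reals all_analysis.

Set Implicit Arguments.
Unset Strict Implicit.
Unset Printing Implicit Defensive.

Import Order.TTheory GRing.Theory Num.Theory.
Import numFieldNormedType.Exports.
Import Normc.

Local Open Scope classical_set_scope.
Local Open Scope ring_scope.
Local Open Scope complex_scope.

Local Notation Re := complex.Re.
Local Notation Im := complex.Im.

(* Complex L^2 spaces.  The Hilbert space L^2(mu) is handled through
   representatives: its elements are the functions satisfying [L2], two of them
   being identified when they agree mu-almost everywhere ([eqL2]).           *)
Section complex_L2.
Context {d : measure_display} {T : measurableType d} {R : realType}.
Variable mu : {measure set T -> \bar R}.

Definition cmeasurable (f : T -> R[i]) : Prop :=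
  measurable_fun [set: T] (fun x => Re (f x)) /\
  measurable_fun [set: T] (fun x => Im (f x)).

Definition cintegrable (f : T -> R[i]) : Prop :=
  mu.-integrable [set: T] (fun x => (Re (f x))%:E) /\
  mu.-integrable [set: T] (fun x => (Im (f x))%:E).

Definition cintegral (f : T -> R[i]) : R[i] :=
  (\int[mu]_x Re (f x)) +i* (\int[mu]_x Im (f x)).

Definition L2 (f : T -> R[i]) : Prop :=
  cmeasurable f /\ (Lnorm mu 2%:E (fun x => (normc (f x))%:E) < +oo)%E.

Definition L2norm (f : T -> R[i]) : R :=
  fine (Lnorm mu 2%:E (fun x => (normc (f x))%:E)).

Definition inner (f g : T -> R[i]) : R[i] :=
  cintegral (fun x => f x * (g x)^*).

Definition eqL2 (f g : T -> R[i]) : Prop := ae_eq mu [set: T] f g.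

(* An unbounded operator is represented by its graph: [A f g] means that f lies
   in the domain of A and that A f = g.                                      *)
Record linear_operator (A : (T -> R[i]) -> (T -> R[i]) -> Prop) : Prop := {
  linop_L2 : forall f g, A f g -> L2 f /\ L2 g ;
  linop_eqL2 : forall f g f' g', A f g -> L2 f' -> L2 g' ->
    eqL2 f f' -> eqL2 g g' -> A f' g' ;
  linop0 : A (fun=> 0) (fun=> 0) ;
  linopP : forall (a : R[i]) f g f' g', A f g -> A f' g' ->
    A (fun x => a * f x + f' x) (fun x => a * g x + g' x) ;
  linop_functional : forall f g g', A f g -> A f g' -> eqL2 g g' }.

Definition densely_defined (A : (T -> R[i]) -> (T -> R[i]) -> Prop) : Prop :=
  forall f, L2 f -> forall eps : R, 0 < eps ->
    exists u w, A u w /\ L2norm (fun x => f x - u x) < eps.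

Definition adjoint (A : (T -> R[i]) -> (T -> R[i]) -> Prop)
    (u w : T -> R[i]) : Prop :=
  [/\ L2 u, L2 w & forall f g, A f g -> inner g u = inner f w].

Definition self_adjoint (A : (T -> R[i]) -> (T -> R[i]) -> Prop) : Prop :=
  [/\ linear_operator A, densely_defined A &
      forall f g, A f g <-> adjoint A f g].

Definition lower_semibounded (A : (T -> R[i]) -> (T -> R[i]) -> Prop) : Prop :=
  exists gamma : R, forall f g, A f g -> gamma * L2norm f ^+ 2 <= Re (inner g f).

Definition closure_op (A : (T -> R[i]) -> (T -> R[i]) -> Prop)
    (f g : T -> R[i]) : Prop :=
  [/\ L2 f, L2 g & forall eps : R, 0 < eps -> exists u w,
    [/\ A u w, L2norm (fun x => f x - u x) < eps
             & L2norm (fun x => g x - w x) < eps]].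

Definition extends (A B : (T -> R[i]) -> (T -> R[i]) -> Prop) : Prop :=
  forall f g, B f g -> A f g.

Record bounded_operator (B : (T -> R[i]) -> T -> R[i]) : Prop := {
  bop_L2 : forall f, L2 f -> L2 (B f) ;
  bop_linear : forall (a : R[i]) f g, L2 f -> L2 g ->
    eqL2 (B (fun x => a * f x + g x)) (fun x => a * B f x + B g x) ;
  bop_bounded : exists M : R, forall f, L2 f -> L2norm (B f) <= M * L2norm f }.

(* The semigroup S z = exp (- z A), Re z > 0, generated by a self-adjoint lower
   semi-bounded operator A.  It is the unique holomorphic family on the open
   right half-plane with the semigroup property whose restriction to the
   positive half-line is a strongly continuous semigroup with infinitesimal
   generator - A.  The values of S outside the half-plane play no role.      *)
Record generates_semigroup (A : (T -> R[i]) -> (T -> R[i]) -> Prop)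
    (S : R[i] -> (T -> R[i]) -> T -> R[i]) : Prop := {
  sg_bounded : forall z : R[i], 0 < Re z -> bounded_operator (S z) ;
  sg_semigroup : forall z w : R[i], 0 < Re z -> 0 < Re w -> forall f, L2 f ->
    eqL2 (S (z + w) f) (S z (S w f)) ;
  sg_holomorphic : forall z : R[i], 0 < Re z -> forall f, L2 f ->
    exists2 g, L2 g & forall eps : R, 0 < eps ->
      exists2 delta : R, 0 < delta & forall h : R[i], h != 0 ->
        normc h < delta ->
        L2norm (fun x => h^-1 * (S (z + h) f x - S z f x) - g x) < eps ;
  sg_continuous : forall f, L2 f ->
    L2norm (fun x => S t%:C f x - f x) @[t --> (0 : R)^'+] --> (0 : R) ;
  sg_generator : forall f g, L2 f -> L2 g ->
    (A f g <->
     L2norm (fun x => t^-1%:C * (S t%:C f x - f x) - (- g x))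
       @[t --> (0 : R)^'+] --> (0 : R)) }.

(* P is the absolute value |B|, the positive square root of B^* B.  Positivity
   uses the partial order of R[i], for which 0 <= z forces z to be real.     *)
Definition abs_operator (B P : (T -> R[i]) -> T -> R[i]) : Prop :=
  [/\ bounded_operator P,
      forall f, L2 f -> 0 <= inner (P f) f
    & forall f g, L2 f -> L2 g -> inner (P (P f)) g = inner (B f) (B g)].

Definition orthonormal_basis (I : choiceType) (b : I -> T -> R[i]) : Prop :=
  [/\ forall n, L2 (b n),
      forall m n, inner (b m) (b n) = (m == n)%:R
    & forall f, L2 f -> (forall n, inner f (b n) = 0) -> eqL2 f (fun=> 0)].

(* The trace of |B| is finite; for a positive operator the trace does not depend
   on the orthonormal basis in which it is computed.                         *)
Definition trace_class (B : (T -> R[i]) -> T -> R[i]) : Prop :=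
  bounded_operator B /\
  exists2 P, abs_operator B P &
    forall (I : choiceType) (b : I -> T -> R[i]), orthonormal_basis b ->
      (\esum_(n in [set: I]) (Re (inner (P (b n)) (b n)))%:E < +oo)%E.

End complex_L2.

Section integral_operators.
Context {d : measure_display} {T : measurableType d} {R : realType}.
Variable mu : {sigma_finite_measure set T -> \bar R}.

Definition integral_operator (B : (T -> R[i]) -> T -> R[i])
    (K : T -> T -> R[i]) : Prop :=
  cmeasurable (fun p : T * T => K p.1 p.2) /\
  forall f, L2 mu f ->
    {ae mu, forall x, cintegrable mu (fun y => K x y * f y) /\
                      B f x = cintegral mu (fun y => K x y * f y)}.

Definition Linfty_kernel (K : T -> T -> R[i]) : Prop :=
  cmeasurable (fun p : T * T => K p.1 p.2) /\
  (Lnorm (mu \x mu)%E +oo%E (fun p => (normc (K p.1 p.2))%:E) < +oo)%E.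

End integral_operators.

(* Sobolev spaces of the interval (0, l), via weak derivatives tested against
   C^1_c(0, l).                                                              *)
Section sobolev.
Context {R : realType}.
Implicit Types (l : R) (phi : R -> R) (u v : R -> R[i]).

Definition interval_measure l :=
  mrestr (@lebesgue_measure R) (measurable_itv `[0, l]).

HB.instance Definition _ l := Measure.on (interval_measure l).

Definition test_function l phi : Prop :=
  [/\ forall x, derivable phi x 1, continuous (derive1 phi)
    & exists a b : R, [/\ 0 < a, b < l & forall x, phi x != 0 -> a <= x <= b]].

Definition weak_derivative l u v : Prop :=
  forall phi, test_function l phi ->
    cintegral (interval_measure l) (fun x => u x * (derive1 phi x)%:C) =
    - cintegral (interval_measure l) (fun x => v x * (phi x)%:C).

(* u is in H^1(0, l) and v is its weak derivative. *)
Definition sobolev1 l u v : Prop :=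
  [/\ L2 (interval_measure l) u, L2 (interval_measure l) v
    & weak_derivative l u v].

(* u is in H^2(0, l) and w is its second weak derivative. *)
Definition sobolev2 l u (w : R -> R[i]) : Prop :=
  exists2 v, sobolev1 l u v & sobolev1 l v w.

End sobolev.

(* The functions src and tgt record an arbitrary orientation of the edges, which
   is needed to identify the edge e with [0, elen e] (src e at 0 and tgt e at
   elen e); the underlying graph is unoriented.                              *)
Record metric_graph (R : realType) := MetricGraph {
  vertex : countType ;
  edge : countType ;
  src : edge -> vertex ;
  tgt : edge -> vertex ;
  elen : edge -> R ;
  vertex_infinite : infinite_set [set: vertex] ;
  edge_infinite : infinite_set [set: edge] ;
  elen_gt0 : forall e, 0 < elen e ;
  loopless : forall e, src e != tgt e ;
  no_multi_edge : forall e e',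
    [set src e; tgt e] = [set src e'; tgt e'] -> e = e' ;
  locally_finite : forall v, finite_set [set e | src e = v \/ tgt e = v] ;
  connected_graph : forall v w, exists2 p : seq vertex,
    path (fun a b => `[< exists e, [set src e; tgt e] = [set a; b] >]) v p &
    last v p = w }.

Section metric_graph_space.
Context {R : realType}.
Variable G : metric_graph R.

Definition edge_space : Type := edge G.

HB.instance Definition _ := Countable.on edge_space.

Lemma edge_inhabited : exists e : edge_space, True.
Proof.
have /infinite_setN0 [e _] := @edge_infinite R G.
by exists e.
Qed.

HB.instance Definition _ :=
  isPointed.Build edge_space (projT1 (cid edge_inhabited)).

HB.instance Definition _ := @isMeasurable.Build default_measure_display
  edge_space (@discrete_measurable edge_space)
  (@discrete_measurable0 edge_space) (@discrete_measurableC edge_space)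
  (@discrete_measurableU edge_space).

Lemma edge_space_sigma_finite :
  sigma_finite [set: edge_space] (@counting edge_space R).
Proof.
exists (fun n => [set e : edge_space | pickle e = n]).
  by apply/seteqP; split => // e _; exists (pickle e).
move=> n; split => //.
have fin : finite_set [set e : edge_space | pickle e = n].
  apply: (@sub_finite_set _ _
    [set x | unpickle n = Some x]) => [e /= <-|]; first by rewrite pickleK.
  case: (unpickle n) => [x|].
    by apply: (sub_finite_set _ (finite_set1 x)) => y [->].
  by apply: (sub_finite_set _ (@finite_set0 edge_space)).
by rewrite /counting /= asboolT// ltry.
Qed.

HB.instance Definition _ := @Measure_isSigmaFinite.Build _ _ _
  (@counting edge_space R) edge_space_sigma_finite.

(* A pair (e, x) with 0 <= x <= elen e stands for the point of the edge e with
   coordinate x; the pairs violating this condition form a null set of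
   [graph_measure].  A vertex is represented by several pairs, which are
   identified by [same_point].                                               *)
Definition graph_point : Type := (edge_space * R)%type.

Definition points : set (edge_space * R) := [set p | 0 <= p.2 <= elen p.1].

Lemma measurable_points : measurable points.
Proof.
have -> : points = \bigcup_n
    (\bigcup_(e in [set e : edge_space | pickle e = n])
       ([set e] `*` `[0, elen e]%classic)).
  apply/seteqP; split => [[e x] /= ex|[e x] [_ _ [e' _ [/= -> /=]]]].
    by exists (pickle e) => //; exists e => //=; rewrite in_itv.
  by rewrite in_itv.
apply: bigcup_measurable => n _.
apply: fin_bigcup_measurable => [|e _].
  apply: (@sub_finite_set _ _
    [set x | unpickle n = Some x]) => [e /= <-|]; first by rewrite pickleK.
  case: (unpickle n) => [x|].
    by apply: (sub_finite_set _ (finite_set1 x)) => y [->].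
  by apply: (sub_finite_set _ (@finite_set0 edge_space)).
exact: measurableX.
Qed.

Definition graph_measure :=
  mrestr (@counting edge_space R \x @lebesgue_measure R)%E measurable_points.

HB.instance Definition _ := Measure.on graph_measure.

Lemma graph_measure_sigma_finite :
  sigma_finite [set: edge_space * R] graph_measure.
Proof.
exists (fun n => [set e : edge_space | pickle e = n] `*` [set: R]).
  by apply/seteqP; split => // -[e x] _; exists (pickle e).
move=> n; split; first exact: measurableX.
have [[e en]|noe] := pselect (exists e : edge_space, pickle e = n); last first.
  rewrite /graph_measure /mrestr (_ : _ `&` _ = set0) ?measure0//.
  by rewrite -subset0 => -[e x] [[/= en _] _]; apply: noe; exists e.
apply: (@le_lt_trans _ _ ((@counting edge_space R \x @lebesgue_measure R)%E
    ([set e] `*` `[0, elen e]%classic))).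
  rewrite /graph_measure /mrestr; apply: le_measure; rewrite ?inE.
  - by apply: measurableI; [exact: measurableX|exact: measurable_points].
  - exact: measurableX.
  - move=> [e' x] [[/= e'n _]]; rewrite /points /= => xe'.
    have ee' : e' = e by apply: (pcan_inj pickleK); rewrite e'n en.
    by split => //=; rewrite in_itv -ee'.
rewrite product_measure1E//; apply: lte_mul_pinfty => //.
  rewrite ge0_fin_numE//.
  change (@counting edge_space R [set e] < +oo)%E.
  by rewrite /counting asboolT// ltry.
have := @lebesgue_measure_itv R `[0, elen e] => /= ->.
by rewrite lte_fin elen_gt0 sube0 ltry.
Qed.

HB.instance Definition _ := @Measure_isSigmaFinite.Build _ _ _
  graph_measure graph_measure_sigma_finite.

End metric_graph_space.

Section path_metric.
Context {R : realType}.
Variable G : metric_graph R.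
Implicit Types (p q : graph_point G) (v : vertex G).

Definition at_vertex p v : Prop :=
  p.2 = 0 /\ src p.1 = v \/ p.2 = elen p.1 /\ tgt p.1 = v.

Definition same_point p q : Prop :=
  p = q \/ exists v, at_vertex p v /\ at_vertex q v.

(* [path_length p q l]: there is a path of length l from p to q made of finitely
   many straight pieces, each contained in one edge.                         *)
Inductive path_length : graph_point G -> graph_point G -> R -> Prop :=
| path_nil p q : same_point p q -> path_length p q 0
| path_cons p (e : edge_space G) (x y : R) q l :
    same_point p (e, x) -> 0 <= x <= elen e -> 0 <= y <= elen e ->
    path_length (e, y) q l -> path_length p q (`|x - y| + l).

Definition path_metric p q : R := inf [set l | path_length p q l].

Definition finite_total_volume : Prop :=
  (\esum_(e in [set: edge_space G]) (elen e)%:E < +oo)%E.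

Definition jointly_hoelder_half (K : graph_point G -> graph_point G -> R[i]) :
    Prop :=
  exists2 C : R, 0 < C & forall x x' y y',
    points x -> points x' -> points y -> points y' ->
    normc (K x y - K x' y') <=
      C * (Num.sqrt (path_metric x x') + Num.sqrt (path_metric y y')).

End path_metric.

Section kirchhoff_laplacian.
Context {R : realType}.
Variable G : metric_graph R.
Implicit Types (f g u : graph_point G -> R[i]).

Local Notation L2G := (L2 (@graph_measure R G)).
Local Notation component f e := (fun x : R => f (e, x)).

Definition graph_continuous u : Prop :=
  (forall e : edge_space G,
    {within `[0, elen e], continuous (fun x => Re (u (e, x)))} /\
    {within `[0, elen e], continuous (fun x => Im (u (e, x)))}) /\
  (forall p q, same_point p q -> u p = u q).

(* The space H^1(G) (u is the continuous representative). *)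
Definition H1 u : Prop :=
  [/\ L2G u, graph_continuous u & exists2 u', L2G u' &
    forall e : edge_space G, sobolev1 (elen e) (component u e) (component u' e)].

(* Derivatives at the two endpoints of e, directed from the endpoint into e. *)
Definition derivative_at_src u (e : edge_space G) (c : R[i]) : Prop :=
  normc ((u (e, x) - u (e, 0)) / x%:C - c) @[x --> (0 : R)^'+] --> (0 : R).

Definition derivative_at_tgt u (e : edge_space G) (c : R[i]) : Prop :=
  normc ((u (e, elen e - x) - u (e, elen e)) / x%:C - c)
    @[x --> (0 : R)^'+] --> (0 : R).

(* Continuity at the vertices is part of [graph_continuous]. *)
Definition kirchhoff_derivatives u : Prop :=
  exists ds dt : edge_space G -> R[i],
    (forall e, derivative_at_src u e (ds e) /\ derivative_at_tgt u e (dt e)) /\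
    (forall v : vertex G, \sum_(e \in [set e | src e = v]) ds e +
                          \sum_(e \in [set e | tgt e = v]) dt e = 0).

(* u is in the domain of the maximal Kirchhoff Laplacian, being continuous, and
   g = - u''.                                                                *)
Definition kirchhoff_pair u g : Prop :=
  [/\ L2G u, L2G g, graph_continuous u, kirchhoff_derivatives u
    & forall e : edge_space G,
        sobolev2 (elen e) (component u e) (component (fun p => - g p) e)].

Definition maximal_laplacian f g : Prop :=
  L2G f /\ exists2 u, eqL2 (@graph_measure R G) f u & kirchhoff_pair u g.

Definition finitely_many_edges u : Prop :=
  finite_set [set e : edge_space G |
    exists2 x, 0 <= x <= elen e & u (e, x) != 0].

Definition preminimal_laplacian f g : Prop :=
  maximal_laplacian f g /\
  exists2 u, eqL2 (@graph_measure R G) f u & finitely_many_edges u.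

Definition minimal_laplacian f g : Prop :=
  closure_op (@graph_measure R G) preminimal_laplacian f g.

Definition domain_in_H1
    (A : (graph_point G -> R[i]) -> (graph_point G -> R[i]) -> Prop) : Prop :=
  forall f g, A f g -> exists2 u, eqL2 (@graph_measure R G) f u & H1 u.

End kirchhoff_laplacian.

(* Main.v *)
(** By hypothesis S(w) maps L^2 into dom H, hence into H^1(G), for every Re w > 0.
    Every u in H^1(G) is bounded and 1/2-Hoelder continuous for the path metric,
    so by uniform boundedness the functionals f |-> (S(w) f)(p) are represented
    by vectors k_p of L^2 with |k_p| <= M and |k_p - k_q| <= M rho(p, q)^(1/2).
    With w = z / 2 and k' the vectors of S(w)^* = S(conj w), the operator
    S(z) = S(w)^2 has the kernel K(p, q) = <k'_q, k_p>, which inherits the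
    bounds.  As |S(z)| = S(Re z) = S(Re z / 2)^2, Bessel's inequality for the
    vectors k_p of S(Re z / 2) bounds the trace of |S(z)| by the integral of
    |k_p|^2 over G, hence by M^2 vol(G). *)

Require Import Defs.
From mathcomp Require Import all_boot all_order all_algebra.
From mathcomp Require Import complex.
From mathcomp Require Import all_classical all_reals all_analysis.
From mathcomp Require Import measurable_realfun ess_sup_inf.
From mathcomp Require Import ring lra.

Set Implicit Arguments.
Unset Strict Implicit.
Unset Printing Implicit Defensive.

Import Order.TTheory GRing.Theory Num.Theory.
Import numFieldNormedType.Exports.
Import Normc.

Local Open Scope classical_set_scope.
Local Open Scope ring_scope.
Local Open Scope complex_scope.

Local Notation Re := complex.Re.
Local Notation Im := complex.Im.

(** An element of L^2 has no value at a point, so evaluation of S(w) f at p is approached by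
    averages over intervals of length dl at p; these are inner products of f with S(conj w) applied
    to a normalised indicator. Uniform boundedness is used twice: for these vectors, and for their
    differences divided by the expected Hoelder size. The second use makes the vectors Cauchy as dl
    tends to 0, and k_p is their limit; no representation theorem is invoked. The identity S(w)^* =
    S(conj w) is drawn from holomorphy and the generator alone, without spectral calculus. Edge
    lengths are arbitrary and may tend to 0, so a bound summed along a path must not lose a factor
    depending on the lengths or the number of edges. On each edge the variation of u is therefore
    split into lam * length + energy / lam, and the variation of |u|^2 is bounded by the energy
    alone. Energies are summable over distinct edges only, which is why paths have to be
    loop-erased. *)

(** * Real part, imaginary part and modulus of complex numbers *)

Section complex_modulus.
Context {R : realType}.
Implicit Types x y : R[i].

Lemma complex_ext x y : Re x = Re y -> Im x = Im y -> x = y.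
Proof. by case: x y => [a b] [c d] /= -> ->. Qed.

Lemma ReM x y : Re (x * y) = Re x * Re y - Im x * Im y.
Proof. by case: x y => [a b] [c d]. Qed.

Lemma ImM x y : Im (x * y) = Re x * Im y + Im x * Re y.
Proof. by case: x y => [a b] [c d]. Qed.

Lemma ReD x y : Re (x + y) = Re x + Re y.
Proof. by case: x y => [a b] [c d]. Qed.

Lemma ImD x y : Im (x + y) = Im x + Im y.
Proof. by case: x y => [a b] [c d]. Qed.

Lemma RRe (r : R) : Re r%:C = r. Proof. by []. Qed.

Lemma IRe (r : R) : Im r%:C = 0. Proof. by []. Qed.

Lemma ReN x : Re (- x) = - Re x.
Proof. by case: x. Qed.

Lemma ImN x : Im (- x) = - Im x.
Proof. by case: x. Qed.

Lemma ReJ x : Re x^*%C = Re x.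
Proof. by case: x. Qed.

Lemma ImJ x : Im x^*%C = - Im x.
Proof. by case: x. Qed.

Lemma conjcD x y : conjc (x + y) = conjc x + conjc y.
Proof. by apply: complex_ext; rewrite ?(ReJ, ImJ, ReD, ImD)// opprD. Qed.

Lemma conjcM x y : conjc (x * y) = conjc x * conjc y.
Proof. by apply: complex_ext; rewrite ?(ReJ, ImJ, ReM, ImM)// ?ReJ ?ImJ; ring. Qed.

Lemma conjcN x : conjc (- x) = - conjc x.
Proof. by apply: complex_ext; rewrite ?(ReJ, ImJ, ReN, ImN). Qed.

Lemma RtoCM (r s : R) : (r * s)%:C = r%:C * s%:C.
Proof. by apply: complex_ext; rewrite ?(ReM, ImM) /=; ring. Qed.

Lemma normc_ge0 x : 0 <= normc x.
Proof. by case: x => a b; rewrite /normc sqrtr_ge0. Qed.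

Lemma sqr_normcE x : normc x ^+ 2 = Re x ^+ 2 + Im x ^+ 2.
Proof. by case: x => a b; rewrite /normc sqr_sqrtr// addr_ge0// sqr_ge0. Qed.

Lemma normc_le_sqr x (r : R) : 0 <= r -> (normc x <= r) = (normc x ^+ 2 <= r ^+ 2).
Proof. by move=> r0; rewrite ler_pXn2r// nnegrE// normc_ge0. Qed.

Lemma normc_conj x : normc x^*%C = normc x.
Proof. by case: x => a b; rewrite /normc /= sqrrN. Qed.

Lemma ReMJ x : Re (x * x^*%C) = normc x ^+ 2.
Proof. by rewrite ReM ReJ ImJ sqr_normcE; ring. Qed.

Lemma ImMJ x : Im (x * x^*%C) = 0.
Proof. by rewrite ImM ReJ ImJ; ring. Qed.

Lemma mul_conjc x : x * x^*%C = (normc x ^+ 2)%:C.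
Proof. by apply: complex_ext; rewrite ?ReMJ ?ImMJ. Qed.

Lemma abs_Re_le x : `|Re x| <= normc x.
Proof.
rewrite -(@ler_pXn2r _ 2)// ?nnegrE ?normc_ge0// sqr_normcE.
by rewrite real_normK ?num_real// lerDl sqr_ge0.
Qed.

Lemma abs_Im_le x : `|Im x| <= normc x.
Proof.
rewrite -(@ler_pXn2r _ 2)// ?nnegrE ?normc_ge0// sqr_normcE.
by rewrite real_normK ?num_real// lerDr sqr_ge0.
Qed.

Lemma normc_le_abs x : normc x <= `|Re x| + `|Im x|.
Proof.
rewrite normc_le_sqr ?addr_ge0// sqr_normcE sqrrD !real_normK ?num_real//.
by have := mulr_ge0 (normr_ge0 (Re x)) (normr_ge0 (Im x)); lra.
Qed.

Lemma normc_RtoC (r : R) : normc r%:C = `|r|.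
Proof. by rewrite /normc /= expr0n addr0 sqrtr_sqr. Qed.

Lemma normcB_C x y : normc (x - y) = normc (y - x).
Proof. by rewrite -normcN opprB. Qed.

Lemma le_normcB x y : normc (x - y) <= normc x + normc y.
Proof. by rewrite (le_trans (le_normcD _ _))// normcN. Qed.

Lemma normc_eq0P x : normc x <= 0 -> x = 0.
Proof. by move=> x0; apply: eq0_normc; apply/eqP; rewrite eq_le x0 normc_ge0. Qed.

Lemma le_sqr_normcD x y : normc (x + y) ^+ 2 <= 2 * normc x ^+ 2 + 2 * normc y ^+ 2.
Proof.
have h : normc (x + y) ^+ 2 <= (normc x + normc y) ^+ 2.
  by rewrite ler_pXn2r ?nnegrE ?addr_ge0 ?normc_ge0// le_normcD.
apply: le_trans h _; have := sqr_ge0 (normc x - normc y); nra.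
Qed.

Lemma normc_mul_le x y : normc (x * y) <= normc x ^+ 2 + normc y ^+ 2.
Proof.
have := sqr_ge0 (normc x - normc y); have := sqr_ge0 (normc x).
have := sqr_ge0 (normc y); rewrite normcM; nra.
Qed.

End complex_modulus.

(** * Inner product and norm of L^2, on representatives *)

Section L2_theory.
Context {d : measure_display} {T : measurableType d} {R : realType}.
Variable mu : {measure set T -> \bar R}.
Implicit Types (f g h : T -> R[i]) (a : R[i]).

Local Notation L2 := (L2 mu).
Local Notation L2norm := (L2norm mu).
Local Notation inner := (inner mu).
Local Notation eqL2 := (eqL2 mu).

Lemma cmeasurable_comb a f g : cmeasurable f -> cmeasurable g ->
  cmeasurable (fun x => a * f x + g x).
Proof.
move=> [f1 f2] [g1 g2]; split.
  rewrite (_ : (fun x => _) =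
    (fun x => (Re a * Re (f x) - Im a * Im (f x)) + Re (g x))); last first.
    by apply/funext => x; rewrite ReD ReM.
  apply: measurable_funD => //; apply: measurable_funB; exact: measurable_funM.
rewrite (_ : (fun x => _) =
  (fun x => (Re a * Im (f x) + Im a * Re (f x)) + Im (g x))); last first.
  by apply/funext => x; rewrite ImD ImM.
apply: measurable_funD => //; apply: measurable_funD; exact: measurable_funM.
Qed.

Lemma cmeasurableM f g : cmeasurable f -> cmeasurable g ->
  cmeasurable (fun x => f x * g x).
Proof.
move=> [f1 f2] [g1 g2]; split.
  rewrite (_ : (fun x => _) =
    (fun x => (Re (f x) * Re (g x) - Im (f x) * Im (g x)))); last first.
    by apply/funext => x; rewrite ReM.
  apply: measurable_funB; exact: measurable_funM.
rewrite (_ : (fun x => _) =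
  (fun x => Re (f x) * Im (g x) + Im (f x) * Re (g x))); last first.
  by apply/funext => x; rewrite ImM.
apply: measurable_funD; exact: measurable_funM.
Qed.

Lemma cmeasurable_conj f : cmeasurable f -> cmeasurable (fun x => (f x)^*%C).
Proof.
move=> [f1 f2]; split; first by under eq_fun do rewrite ReJ.
by under eq_fun do rewrite ImJ; exact: measurableT_comp.
Qed.

Lemma measurable_sqr_normc f : cmeasurable f ->
  measurable_fun setT (fun x => normc (f x) ^+ 2).
Proof.
move=> [f1 f2]; under eq_fun do rewrite sqr_normcE.
by apply: measurable_funD; apply: measurable_funX.
Qed.

Lemma Lnorm2E f : (Lnorm mu 2%:E (fun x => (normc (f x))%:E) =
  (\int[mu]_x ((normc (f x)) ^+ 2)%:E) `^ 2^-1)%E.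
Proof.
rewrite unlock; congr (_ `^ _)%E; apply: eq_integral => x _.
by rewrite abse_EFin ger0_norm ?normc_ge0// poweR_EFin powR_mulrn// normc_ge0.
Qed.

(** Replaces the finiteness of a norm with a power 1/2 by integrability of the squared modulus, the
    form used by comparison arguments. *)
Lemma L2P f : L2 f <->
  cmeasurable f /\ mu.-integrable setT (fun x => (normc (f x) ^+ 2)%:E).
Proof.
rewrite /Defs.L2 Lnorm2E; split => -[mf h]; split => //.
  apply/integrableP; split.
    by apply/measurable_EFinP/measurable_sqr_normc.
  under eq_integral do rewrite abse_EFin ger0_norm ?exprn_ge0 ?normc_ge0//.
  by apply: lty_poweRy h; rewrite invr_eq0.
case/integrableP : h => _ h; apply: poweR_lty; move: h.
by under eq_integral do rewrite abse_EFin ger0_norm ?exprn_ge0 ?normc_ge0//.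
Qed.

(** No integrability is assumed: if the integral is infinite, [fine] sends both sides to 0. *)
Lemma L2norm_sqrt f : L2norm f = Num.sqrt (\int[mu]_x normc (f x) ^+ 2).
Proof.
rewrite /Defs.L2norm Lnorm2E poweR12_sqrt; last first.
  by apply: integral_ge0 => x _; rewrite lee_fin exprn_ge0// normc_ge0.
have : (0 <= \int[mu]_x ((normc (f x)) ^+ 2)%:E)%E.
  by apply: integral_ge0 => x _; rewrite lee_fin exprn_ge0// normc_ge0.
by rewrite /Rintegral; case: (\int[mu]_x _)%E => //= _; rewrite sqrtr0.
Qed.

Lemma L2norm_ge0 f : 0 <= L2norm f.
Proof. by rewrite L2norm_sqrt sqrtr_ge0. Qed.

Lemma sqr_L2norm f : L2norm f ^+ 2 = \int[mu]_x normc (f x) ^+ 2.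
Proof.
rewrite L2norm_sqrt sqr_sqrtr// Rintegral_ge0// => x _.
by rewrite exprn_ge0// normc_ge0.
Qed.

Lemma L2_comb a f g : L2 f -> L2 g -> L2 (fun x => a * f x + g x).
Proof.
move=> /L2P[mf intf] /L2P[mg intg]; apply/L2P; split.
  exact: cmeasurable_comb.
have : mu.-integrable setT (fun x => ((2 * normc a ^+ 2)%:E * (normc (f x) ^+ 2)%:E
    + 2%:E * (normc (g x) ^+ 2)%:E)%E).
  by apply: integrableD => //; apply: integrableZl.
apply: le_integrable => //.
  exact/measurable_EFinP/measurable_sqr_normc/cmeasurable_comb.
move=> x _; rewrite -!EFinM -EFinD !abse_EFin lee_fin ger0_norm ?sqr_ge0//.
rewrite ger0_norm ?addr_ge0 ?mulr_ge0 ?sqr_ge0 ?ler0n ?normc_ge0//.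
by rewrite (le_trans (le_sqr_normcD _ _))// normcM exprMn mulrA.
Qed.

Lemma L20 : L2 (fun=> 0).
Proof.
apply/L2P; split.
  by split; rewrite /=; exact: measurable_cst.
by under eq_fun do rewrite normc0 expr0n /=; exact: integrable0.
Qed.

Lemma L2Z a f : L2 f -> L2 (fun x => a * f x).
Proof.
move=> /(L2_comb a) /(_ L20).
by under eq_fun do rewrite addr0.
Qed.

Lemma L2D f g : L2 f -> L2 g -> L2 (fun x => f x + g x).
Proof. by move=> /(L2_comb 1) h /h; under eq_fun do rewrite mul1r. Qed.

Lemma L2N f : L2 f -> L2 (fun x => - f x).
Proof. by move=> /(L2Z (-1)); under eq_fun do rewrite mulN1r. Qed.

Lemma L2B f g : L2 f -> L2 g -> L2 (fun x => f x - g x).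
Proof. by move=> Lf /L2N; exact: L2D. Qed.

Lemma L2_conj f : L2 f -> L2 (fun x => (f x)^*%C).
Proof.
move=> /L2P[mf intf]; apply/L2P; split; first exact: cmeasurable_conj.
by under eq_fun do rewrite normc_conj.
Qed.

Lemma cintegrableM f g : L2 f -> L2 g -> cintegrable mu (fun x => f x * g x).
Proof.
move=> /L2P[mf intf] /L2P[mg intg].
have [mfg1 mfg2] := cmeasurableM mf mg.
have intfg : mu.-integrable setT (fun x => ((normc (f x) ^+ 2)%:E +
    (normc (g x) ^+ 2)%:E)%E) by exact: integrableD.
split; (apply: le_integrable intfg => //; first exact/measurable_EFinP);
  move=> x _; rewrite -EFinD !abse_EFin lee_fin [leRHS]ger0_norm ?addr_ge0 ?sqr_ge0//.
  by rewrite (le_trans (abs_Re_le _))// normc_mul_le.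
by rewrite (le_trans (abs_Im_le _))// normc_mul_le.
Qed.

Lemma cintegrable_inner f g : L2 f -> L2 g ->
  cintegrable mu (fun x => f x * (g x)^*%C).
Proof. by move=> Lf /L2_conj; exact: cintegrableM. Qed.

Lemma cintegral_comb a f g : cintegrable mu f -> cintegrable mu g ->
  cintegral mu (fun x => a * f x + g x) = a * cintegral mu f + cintegral mu g.
Proof.
move=> [f1 f2] [g1 g2]; apply: complex_ext.
  rewrite ReD ReM /=; under eq_Rintegral do rewrite ReD ReM.
  rewrite RintegralD//.
  - rewrite RintegralB// ?RintegralZl//; rewrite /comp; under eq_fun do rewrite EFinM;
      exact: integrableZl.
  - rewrite /comp; under eq_fun do rewrite EFinB !EFinM.
    by apply: integrableB => //; exact: integrableZl.
rewrite ImD ImM /=; under eq_Rintegral do rewrite ImD ImM.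
rewrite RintegralD//.
- rewrite RintegralD// ?RintegralZl//; rewrite /comp; under eq_fun do rewrite EFinM;
    exact: integrableZl.
- rewrite /comp; under eq_fun do rewrite EFinD !EFinM.
  by apply: integrableD => //; exact: integrableZl.
Qed.

Lemma inner_combl a f g h : L2 f -> L2 g -> L2 h ->
  inner (fun x => a * f x + g x) h = a * inner f h + inner g h.
Proof.
move=> Lf Lg Lh; rewrite /Defs.inner -cintegral_comb; try exact: cintegrable_inner.
by congr cintegral; apply/funext => x; rewrite mulrDl mulrA.
Qed.

Lemma inner_conj f g : L2 f -> L2 g -> inner g f = (inner f g)^*%C.
Proof.
move=> Lf Lg; have [_ i2] := cintegrable_inner Lf Lg.
apply: complex_ext; rewrite ?ReJ ?ImJ /=.
  by apply: eq_Rintegral => x _; rewrite !ReM !ReJ !ImJ; ring.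
rewrite -mulN1r -RintegralZl//; apply: eq_Rintegral => x _.
by rewrite !ImM !ReJ !ImJ; ring.
Qed.

Lemma inner_combr a f g h : L2 f -> L2 g -> L2 h ->
  inner h (fun x => a * f x + g x) = a^*%C * inner h f + inner h g.
Proof.
move=> Lf Lg Lh; rewrite (inner_conj (L2_comb a Lf Lg) Lh) inner_combl//.
by rewrite conjcD conjcM -(inner_conj Lf Lh) -(inner_conj Lg Lh).
Qed.

Lemma inner0l f : L2 f -> inner (fun=> 0) f = 0.
Proof.
move=> Lf; have := inner_combl (-1) L20 L20 Lf.
by under eq_fun do rewrite mulr0 addr0; rewrite mulN1r addNr.
Qed.

Lemma inner0r f : L2 f -> inner f (fun=> 0) = 0.
Proof. by move=> Lf; rewrite (inner_conj L20 Lf) inner0l// conjc0. Qed.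

Lemma innerZl a f g : L2 f -> L2 g -> inner (fun x => a * f x) g = a * inner f g.
Proof.
move=> Lf Lg; have := inner_combl a Lf L20 Lg.
by under eq_fun do rewrite addr0; rewrite inner0l// addr0.
Qed.

Lemma innerZr a f g : L2 f -> L2 g -> inner f (fun x => a * g x) = a^*%C * inner f g.
Proof.
move=> Lf Lg; have := inner_combr a Lg L20 Lf.
by under eq_fun do rewrite addr0; rewrite inner0r// addr0.
Qed.

Lemma innerDl f g h : L2 f -> L2 g -> L2 h ->
  inner (fun x => f x + g x) h = inner f h + inner g h.
Proof.
move=> Lf Lg Lh; have := inner_combl 1 Lf Lg Lh.
by under eq_fun do rewrite mul1r; rewrite mul1r.
Qed.

Lemma innerDr f g h : L2 f -> L2 g -> L2 h ->
  inner f (fun x => g x + h x) = inner f g + inner f h.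
Proof.
move=> Lf Lg Lh; have := inner_combr 1 Lg Lh Lf.
by under eq_fun do rewrite mul1r; rewrite (conjc1 R) mul1r.
Qed.

Lemma innerNl f g : L2 f -> L2 g -> inner (fun x => - f x) g = - inner f g.
Proof.
move=> Lf Lg; have := innerZl (-1) Lf Lg.
by under eq_fun do rewrite mulN1r; rewrite mulN1r.
Qed.

Lemma innerNr f g : L2 f -> L2 g -> inner f (fun x => - g x) = - inner f g.
Proof.
move=> Lf Lg; have := innerZr (-1) Lf Lg.
by under eq_fun do rewrite mulN1r; rewrite rmorphN1 mulN1r.
Qed.

Lemma innerBl f g h : L2 f -> L2 g -> L2 h ->
  inner (fun x => f x - g x) h = inner f h - inner g h.
Proof. by move=> Lf Lg Lh; rewrite innerDl ?innerNl//; exact: L2N. Qed.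

Lemma innerBr f g h : L2 f -> L2 g -> L2 h ->
  inner f (fun x => g x - h x) = inner f g - inner f h.
Proof. by move=> Lf Lg Lh; rewrite innerDr ?innerNr//; exact: L2N. Qed.

Lemma inner_L2norm f : inner f f = (L2norm f ^+ 2)%:C.
Proof.
apply: complex_ext; rewrite /= ?sqr_L2norm.
  by apply: eq_Rintegral => x _; rewrite ReMJ.
by under eq_Rintegral do rewrite ImMJ; rewrite Rintegral_cst// mul0r.
Qed.

(** The degenerate case of Cauchy-Schwarz. The squared norm of f - t c g is affine in t with slope
    -2 |c|^2, yet nonnegative for every t. *)
Lemma L2norm_eq0_inner f g : L2 f -> L2 g -> L2norm g = 0 -> inner f g = 0.
Proof.
move=> Lf Lg g0; set c := inner f g.
have key (t : R) : 0 <= L2norm f ^+ 2 - 2 * t * normc c ^+ 2.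
  have LZ := L2Z (- (t%:C * c)) Lg.
  have Lh := L2D LZ Lf.
  have := sqr_ge0 (L2norm (fun x => - (t%:C * c) * g x + f x)).
  rewrite -lecR -inner_L2norm inner_combl// !inner_combr//.
  rewrite !inner_L2norm g0 (inner_conj Lf Lg) -/c.
  move: c {Lh LZ} (L2norm f) => c A; rewrite conjcN conjcM lecE => /andP[_].
  rewrite !(ReD,ReM,ReN,ImN,ImM,ReJ,ImJ,ImD,RRe,IRe) sqr_normcE; lra.
suff : normc c ^+ 2 <= 0 by move=> /(@le_trans _ _ (normc c ^+ 2)) h; apply: normc_eq0P;
  rewrite normc_le_sqr// expr0n h.
(* This value of t would make the affine function equal to -1. *)
have := key ((L2norm f ^+ 2 + 1) / (2 * normc c ^+ 2)).
have [->//|c0] := eqVneq (normc c ^+ 2) 0.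
rewrite -mulrA (mulrC _ (normc c ^+ 2)) mulrA mulrC divfK//; first lra.
by rewrite mulf_neq0// pnatr_eq0.
Qed.

Lemma Cauchy_Schwarz f g : L2 f -> L2 g ->
  normc (inner f g) <= L2norm f * L2norm g.
Proof.
move=> Lf Lg; have [g0|g0] := eqVneq (L2norm g) 0.
  by rewrite L2norm_eq0_inner// normc0 g0 mulr0.
set c := inner f g; set N := L2norm g ^+ 2.
have N0 : 0 < N by rewrite exprn_gt0// lt_neqAle eq_sym g0 L2norm_ge0.
(* The right-hand side is the squared norm of N f - c g; keeping the factor N avoids dividing by the
   norm of g. *)
have : 0 <= N * (N * L2norm f ^+ 2 - normc c ^+ 2).
  have LZ := L2Z N%:C Lf; have LZg := L2Z (- c) Lg.
  have := sqr_ge0 (L2norm (fun x => N%:C * f x + - c * g x)).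
  rewrite -lecR -inner_L2norm inner_combl//; last exact: L2D.
  rewrite inner_combr// innerZl//; last exact: L2D.
  rewrite inner_combr// !innerZr//.
  rewrite !inner_L2norm (inner_conj Lf Lg) -/c -/N.
  move: c N {N0 LZ LZg} (L2norm f) => c N A; rewrite lecE => /andP[_].
  rewrite !(ReD,ReM,ReN,ImN,ImM,ReJ,ImJ,ImD,RRe,IRe) sqr_normcE => h.
  by rewrite (le_trans h)// le_eqVlt; apply/orP; left; apply/eqP; ring.
rewrite pmulr_rge0// subr_ge0 => h.
rewrite normc_le_sqr ?mulr_ge0 ?L2norm_ge0// exprMn (le_trans h)//.
by rewrite mulrC.
Qed.

Lemma L2normD f g : L2 f -> L2 g ->
  L2norm (fun x => f x + g x) <= L2norm f + L2norm g.
Proof.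
move=> Lf Lg; have Lfg := L2D Lf Lg.
rewrite -(@ler_pXn2r _ 2)// ?nnegrE ?addr_ge0 ?L2norm_ge0//.
have : (L2norm (fun x => f x + g x) ^+ 2)%:C =
  (L2norm f ^+ 2 + L2norm g ^+ 2)%:C + inner f g + (inner f g)^*%C :> R[i].
  rewrite -inner_L2norm innerDl// !innerDr// !inner_L2norm (inner_conj Lf Lg).
  by rewrite rmorphD /=; ring.
move: (inner f g) (Cauchy_Schwarz Lf Lg) => c cs /(congr1 (@complex.Re R)); rewrite !ReD ReJ !RRe => ->.
have := L2norm_ge0 f; have := L2norm_ge0 g.
have := le_trans (ler_norm _) (abs_Re_le c); nra.
Qed.

Lemma L2normZ a f : L2 f -> L2norm (fun x => a * f x) = normc a * L2norm f.
Proof.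
move=> Lf; apply/eqP; rewrite -(@eqrXn2 _ 2)// ?mulr_ge0 ?L2norm_ge0 ?normc_ge0//.
rewrite exprMn -(inj_eq (@complexI R)) -inner_L2norm innerZl ?innerZr//; last exact: L2Z.
by rewrite inner_L2norm mulrA (RtoCM (normc a ^+ 2)) mul_conjc.
Qed.

Lemma L2normN f : L2 f -> L2norm (fun x => - f x) = L2norm f.
Proof.
move=> /(L2normZ (-1)); under eq_fun do rewrite mulN1r.
by rewrite normcN normc1 mul1r.
Qed.

Lemma L2normB f g : L2 f -> L2 g ->
  L2norm (fun x => f x - g x) <= L2norm f + L2norm g.
Proof. by move=> Lf Lg; rewrite -(L2normN Lg); apply: L2normD => //; exact: L2N. Qed.

Lemma L2normBC f g : L2norm (fun x => f x - g x) = L2norm (fun x => g x - f x).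
Proof.
by rewrite !L2norm_sqrt; congr Num.sqrt; apply: eq_Rintegral => x _; rewrite normcB_C.
Qed.

Lemma L2norm0 : L2norm (fun=> 0) = 0.
Proof.
rewrite L2norm_sqrt; under eq_Rintegral do rewrite normc0 expr0n /=.
by rewrite Rintegral_cst// mul0r sqrtr0.
Qed.

Lemma L2norm_dist_trans f g h : L2 f -> L2 g -> L2 h ->
  L2norm (fun x => f x - h x) <=
  L2norm (fun x => f x - g x) + L2norm (fun x => g x - h x).
Proof.
move=> Lf Lg Lh; have := L2normD (L2B Lf Lg) (L2B Lg Lh).
by under eq_fun do rewrite addrA subrK.
Qed.

Lemma eqL2_cintegral f g : cintegrable mu f -> cintegrable mu g -> eqL2 f g ->
  cintegral mu f = cintegral mu g.
Proof.
move=> [/measurable_int f1 /measurable_int f2] [/measurable_int g1 /measurable_int g2] fg.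
apply: complex_ext; rewrite /= /Rintegral; congr fine; apply: ae_eq_integral => //.
  exact: (ae_eq_comp (fun x => (Re x)%:E) fg).
exact: (ae_eq_comp (fun x => (Im x)%:E) fg).
Qed.

Lemma eqL2_inner f f' g g' : L2 f -> L2 f' -> L2 g -> L2 g' ->
  eqL2 f f' -> eqL2 g g' -> inner f g = inner f' g'.
Proof.
move=> Lf Lf' Lg Lg' ff' gg'; apply: eqL2_cintegral; try exact: cintegrable_inner.
apply: filterS2 ff' gg' => x /= h1 h2 _; by rewrite h1// h2.
Qed.

Lemma eqL2_innerl f f' g : L2 f -> L2 f' -> L2 g ->
  eqL2 f f' -> inner f g = inner f' g.
Proof. by move=> Lf Lf' Lg ff'; apply: eqL2_inner => //; exact: ae_eq_refl. Qed.

Lemma eqL2_innerr f g g' : L2 f -> L2 g -> L2 g' ->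
  eqL2 g g' -> inner f g = inner f g'.
Proof. by move=> Lf Lg Lg' gg'; apply: eqL2_inner => //; exact: ae_eq_refl. Qed.

Lemma eqL2_norm f g : L2 f -> L2 g -> eqL2 f g -> L2norm f = L2norm g.
Proof.
move=> Lf Lg fg; apply/eqP; rewrite -(@eqrXn2 _ 2)// ?L2norm_ge0//.
by rewrite -(inj_eq (@complexI R)) -!inner_L2norm (eqL2_inner Lf Lg Lf Lg fg fg).
Qed.

End L2_theory.

(** * Completeness of L^2 and uniform boundedness *)

Section L2_completeness.
Context {d : measure_display} {T : measurableType d} {R : realType}.
Variable mu : {measure set T -> \bar R}.

Local Notation L2 := (L2 mu).
Local Notation L2norm := (L2norm mu).
Local Notation inner := (inner mu).
Local Notation eqL2 := (eqL2 mu).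

Lemma bounded_variation_cvgn (u : R^nat) (b : R) :
  (forall N, \sum_(k < N) `|u k.+1 - u k| <= b) -> cvgn u.
Proof.
move=> ub.
have ncv : cvgn [normed series (telescope u)].
  apply: nondecreasing_is_cvgn.
    apply/nondecreasing_seqP => n; rewrite /normed_series_of /series/= big_nat_recr//=.
    by rewrite lerDl.
  by exists b => _ [n _ <-]; rewrite /normed_series_of /series/= big_mkord; exact: ub.
have cv : cvgn (series (telescope u)) by exact: normed_cvg.
have -> : u = (fun n => u 0%N + series (telescope u) n).
  by apply/funext => n; rewrite telescopeK /=; ring.
by apply: is_cvgD => //; exact: is_cvg_cst.
Qed.

Lemma integral_sqr_normc f : L2 f ->
  (\int[mu]_x (normc (f x) ^+ 2)%:E = (L2norm f ^+ 2)%:E)%E.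
Proof.
move=> /L2P[mf intf]; rewrite sqr_L2norm /Rintegral fineK//.
exact: integrable_fin_num.
Qed.

Lemma L2_normc f : L2 f -> L2 (fun t => (normc (f t))%:C).
Proof.
move=> /L2P[mf intf]; apply/L2P; split; last first.
  by under eq_fun do rewrite normc_RtoC ger0_norm ?normc_ge0//.
split => /=; last exact: measurable_cst.
under eq_fun do rewrite -[normc _]ger0_norm ?normc_ge0// -sqrtr_sqr.
apply: measurableT_comp; last exact: measurable_sqr_normc.
exact: continuous_measurable_fun (@sqrt_continuous R).
Qed.

Lemma L2norm_normc f : L2norm (fun t => (normc (f t))%:C) = L2norm f.
Proof.
rewrite !L2norm_sqrt; congr Num.sqrt; apply: eq_Rintegral => t _.
by rewrite normc_RtoC ger0_norm ?normc_ge0.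
Qed.

Lemma geometric3_sum_le (N : nat) (c : R) : 0 <= c ->
  \sum_(k < N) c * 3^-1 ^+ k <= 3 / 2 * c.
Proof.
move=> c0; rewrite -mulr_sumr mulrC ler_wpM2r//.
suff -> : \sum_(k < N) (3^-1 : R) ^+ k = 3 / 2 * (1 - 3^-1 ^+ N).
  by rewrite -[leRHS]mulr1 ler_wpM2l// ?divr_ge0// gerBl exprn_ge0.
elim: N => [|N ih]; first by rewrite big_ord0 expr0; lra.
by rewrite big_ord_recr /= ih exprS; lra.
Qed.

(* The partial sums of |x_{k+1} - x_k| are bounded in L^2, hence finite almost
   everywhere by monotone convergence; Fatou's lemma then controls the limit. *)
Lemma L2_complete (x : nat -> T -> R[i]) (c : R) : 0 <= c ->
  (forall n, L2 (x n)) ->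
  (forall n, L2norm (fun t => x n.+1 t - x n t) <= c * 3^-1 ^+ n) ->
  exists2 X, L2 X &
    forall n, L2norm (fun t => X t - x n t) <= 3 / 2 * c * 3^-1 ^+ n.
Proof.
move=> c0 Lx dx.
have Ldx n : L2 (fun t => x n.+1 t - x n t) by exact: L2B.
pose G N t := \sum_(k < N) normc (x k.+1 t - x k t).
have LG N : L2 (fun t => (G N t)%:C) /\ L2norm (fun t => (G N t)%:C) <= 3 / 2 * c.
  suff [L1 L2'] : L2 (fun t => (G N t)%:C) /\
      L2norm (fun t => (G N t)%:C) <= \sum_(k < N) c * 3^-1 ^+ k.
    by split=> //; apply: le_trans L2' _; exact: geometric3_sum_le.
  elim: N => [|N [ih1 ih2]].
    under eq_fun do rewrite /G big_ord0.
    by rewrite big_ord0; split; [exact: L20|rewrite (L2norm0 mu)].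
  have E : (fun t => (G N.+1 t)%:C) =
      (fun t => (G N t)%:C + (normc (x N.+1 t - x N t))%:C).
    by apply/funext => t; rewrite /G big_ord_recr /= rmorphD.
  rewrite E big_ord_recr /=; have LN := L2_normc (Ldx N).
  split; first exact: L2D.
  by apply: le_trans (L2normD ih1 LN) _; rewrite lerD// L2norm_normc.
have G0 N t : 0 <= G N t by rewrite /G sumr_ge0// => i _; exact: normc_ge0.
have GS t : nondecreasing_seq (G ^~ t).
  by apply/nondecreasing_seqP => n; rewrite /G big_ord_recr /= lerDl normc_ge0.
have mG N : measurable_fun setT (fun t => ((G N t) ^+ 2)%:E).
  apply/measurable_EFinP; apply: measurable_funX.
  by have [/L2P[[]]] := LG N.
have bd : {ae mu, forall t, exists b, forall N, G N t <= b}.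
  have mono := @monotone_convergence _ _ _ mu setT measurableT _ mG.
  have sqG : forall t : T, setT t -> nondecreasing_seq (fun n => (G n t ^+ 2)%:E).
    by move=> t _ m n mn; rewrite lee_fin ler_pXn2r ?nnegrE ?G0//; exact: GS.
  have intlim : mu.-integrable setT (fun t => limn (fun n => (G n t ^+ 2)%:E)).
    apply/integrableP; split.
      apply: (emeasurable_fun_cvg (fun n t => (G n t ^+ 2)%:E)) => // t _.
      exact: ereal_nondecreasing_is_cvgn (sqG t I).
    under eq_integral => t _.
      rewrite gee0_abs; last first.
        apply: lime_ge; first exact: ereal_nondecreasing_is_cvgn (sqG t I).
        by apply: nearW => n; rewrite lee_fin sqr_ge0.
      over.
    rewrite mono//; last by move=> n t _; rewrite lee_fin sqr_ge0.
    apply: (@le_lt_trans _ _ (((3 / 2 * c) ^+ 2)%:E)); last exact: ltry.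
    apply: lime_le.
      apply: ereal_nondecreasing_is_cvgn => m n mn; apply: ge0_le_integral => //.
        by move=> t _; rewrite lee_fin sqr_ge0.
      by move=> t _; exact: sqG.
    apply: nearW => n; have [L1 L2'] := LG n.
    have := integral_sqr_normc L1.
    under eq_integral do rewrite normc_RtoC real_normK ?num_real//.
    move=> ->; rewrite lee_fin ler_pXn2r ?nnegrE ?L2norm_ge0//.
    by rewrite mulr_ge0// divr_ge0.
  apply: filterS (integrable_ae measurableT intlim) => t /(_ I) fint.
  set L := limn _ in fint; exists (1 + fine L) => N.
  have hN : ((G N t ^+ 2)%:E <= L)%E.
    have := ereal_nondecreasing_is_cvgn (sqG t I) => cv.
    apply: lime_ge => //; near=> n.
    by apply: sqG => //; near: n; exists N.
  rewrite -(fineK fint) lee_fin in hN.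
  (* The bound on the square passes to [G N t] itself through g <= 1 + g^2. *)
  by apply: le_trans (_ : 1 + G N t ^+ 2 <= _); [nra|rewrite lerD2l].
(* The upper limit is total and measurable, and it is the limit wherever the sequence converges,
   that is almost everywhere. *)
pose X t := fine (limn_esup (fun n => (Re (x n t))%:E)) +i*
            fine (limn_esup (fun n => (Im (x n t))%:E)).
have cvX : {ae mu, forall t, (fun n => Re (x n t)) @ \oo --> Re (X t) /\
                             (fun n => Im (x n t)) @ \oo --> Im (X t)}.
  apply: filterS bd => t [b bG].
  have aux (u : R^nat) : cvgn u -> u @ \oo --> fine (limn_esup (EFin \o u)).
    move=> cu; have cE : (EFin \o u) @ \oo --> (limn u)%:E by apply: cvg_EFin; [exact: nearW|exact: cu].
    by rewrite (is_cvg_limn_esupE (cvgP _ cE)) (cvg_lim _ cE).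
  split; apply: aux; apply: (@bounded_variation_cvgn _ b) => N;
    apply: le_trans (bG N); apply: ler_sum => k _.
    by rewrite -ReN -ReD abs_Re_le.
  by rewrite -ImN -ImD abs_Im_le.
have mX : cmeasurable X.
  split => /=.
    apply: (@measurableT_comp _ _ _ _ _ _ fine) => //.
    apply: measurable_fun_limn_esup => n; apply/measurable_EFinP.
    by have /L2P[[]] := Lx n.
  apply: (@measurableT_comp _ _ _ _ _ _ fine) => //.
  apply: measurable_fun_limn_esup => n; apply/measurable_EFinP.
  by have /L2P[[]] := Lx n.
have mono n m : L2norm (fun t => x (n + m)%N t - x n t) <= 3 / 2 * c * 3^-1 ^+ n.
  have : L2norm (fun t => x (n + m)%N t - x n t) <=
      \sum_(k < m) (c * 3^-1 ^+ n) * 3^-1 ^+ k.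
    elim: m => [|m ih].
      rewrite addn0 big_ord0; under eq_fun do rewrite subrr.
      by rewrite (L2norm0 mu).
    rewrite big_ord_recr /= addnS addrC.
    apply: le_trans (L2norm_dist_trans (Lx _) (Lx (n + m)%N) (Lx n)) _.
    rewrite lerD//; apply: le_trans (dx _) _.
    by rewrite exprD mulrA.
  move=> h; apply: le_trans h _; rewrite -mulrA.
  by apply: geometric3_sum_le; rewrite mulr_ge0// exprn_ge0// invr_ge0.
have est n : (\int[mu]_t (normc (X t - x n t) ^+ 2)%:E <=
    ((3 / 2 * c * 3^-1 ^+ n) ^+ 2)%:E)%E.
  have b0 : 0 <= 3 / 2 * c * 3^-1 ^+ n :> R.
    by rewrite !mulr_ge0// exprn_ge0// invr_ge0.
  pose F m t := (normc (x (n + m)%N t - x n t) ^+ 2)%:E.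
  have mF m : measurable_fun setT (F m).
    apply/measurable_EFinP/measurable_sqr_normc.
    by have /L2P[] := L2B (Lx (n + m)%N) (Lx n).
  have -> : (\int[mu]_t (normc (X t - x n t) ^+ 2)%:E =
      \int[mu]_t limn_einf (F ^~ t))%E.
    apply: ae_eq_integral => //.
    - apply/measurable_EFinP/measurable_sqr_normc.
      have := cmeasurable_comb (-1) (proj1 (proj1 (L2P _ _) (Lx n))) mX.
      by under eq_fun do rewrite mulN1r addrC.
    - have -> : (fun t => limn_einf (F ^~ t)) =
          (fun t => - limn_esup (fun m => - F m t))%E.
        apply/funext => t; rewrite -limn_einfN; congr limn_einf.
        by apply/funext => m; rewrite /comp oppeK.
      apply: measurableT_comp => //; apply: measurable_fun_limn_esup => m.
      exact: measurableT_comp.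
    - apply: filterS cvX => t [cr ci] _.
      have sh (u : R^nat) (l : R) : u @ \oo --> l -> (fun m => u (n + m)%N) @ \oo --> l.
        move=> ul; rewrite (_ : (fun m => _) = (fun m => u (m + n)%N)).
          by rewrite (cvg_shiftn n u).
        by apply/funext => m; rewrite addnC.
      have cF : F ^~ t @ \oo --> (normc (X t - x n t) ^+ 2)%:E.
        rewrite /F; apply: cvg_EFin; first exact: nearW.
        rewrite /comp /= sqr_normcE; under eq_fun do rewrite sqr_normcE.
        have hr : (fun m => Re (x (n + m)%N t - x n t)) @ \oo --> Re (X t - x n t).
          rewrite ReD ReN; under eq_fun do rewrite ReD ReN.
          by apply: cvgB; [exact: sh cr|exact: cvg_cst].
        have hi : (fun m => Im (x (n + m)%N t - x n t)) @ \oo --> Im (X t - x n t).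
          rewrite ImD ImN; under eq_fun do rewrite ImD ImN.
          by apply: cvgB; [exact: sh ci|exact: cvg_cst].
        by apply: cvgD; apply: cvgM.
      by have [-> _] := cvg_limn_einf_sup cF.
  apply: le_trans (fatou mu measurableT mF _) _.
    by move=> m t _; rewrite lee_fin sqr_ge0.
  rewrite limn_einf_lim; apply: lime_le; first exact: is_cvg_einfs.
  apply: nearW => m; apply: (@le_trans _ _ (\int[mu]_t F m t)%E).
    by apply: ereal_inf_lbound; exists m => /=.
  rewrite integral_sqr_normc; last exact: L2B.
  by rewrite lee_fin ler_pXn2r ?nnegrE ?L2norm_ge0.
have LXn n : L2 (fun t => X t - x n t).
  apply/L2P; split.
    have := cmeasurable_comb (-1) (proj1 (proj1 (L2P _ _) (Lx n))) mX.
    by under eq_fun do rewrite mulN1r addrC.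
  apply/integrableP; split.
    apply/measurable_EFinP/measurable_sqr_normc.
    have := cmeasurable_comb (-1) (proj1 (proj1 (L2P _ _) (Lx n))) mX.
    by under eq_fun do rewrite mulN1r addrC.
  under eq_integral do rewrite abse_EFin ger0_norm ?sqr_ge0//.
  by apply: le_lt_trans (est n) _; exact: ltry.
exists X.
  have := L2D (LXn 0%N) (Lx 0%N).
  by under eq_fun do rewrite subrK.
move=> n; rewrite -(@ler_pXn2r _ 2)// ?nnegrE ?L2norm_ge0//; last first.
  by rewrite !mulr_ge0// exprn_ge0// invr_ge0.
by have := est n; rewrite integral_sqr_normc// lee_fin.
Unshelve. all: by end_near. Qed.

(** It follows that x + y or x - y has modulus at least |y|, which is what the choice of signs in
    the gliding hump rests on. *)
Lemma normc_triangle_lower (x y : R[i]) : 2 * normc y - normc (x + y) <= normc (x - y).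
Proof.
have := le_normcB (x + y) (x - y).
have -> : x + y - (x - y) = y + y by ring.
have -> : normc (y + y) = 2 * normc y.
  have -> : y + y = 2%:C * y by rewrite rmorphD /=; ring.
  by rewrite normcM normc_RtoC ger0_norm.
lra.
Qed.

(* Uniform boundedness by Sokal's gliding hump: the series of the vectors
   +- 3^-n.+1 w_n / |w_n|, with signs chosen so that <x_{n+1}, w_n> is large,
   converges to a vector whose inner products with the w_n are unbounded. *)
Lemma weakly_bounded_bounded (I : Type) (v : I -> T -> R[i]) :
  (forall i, L2 (v i)) ->
  (forall f, L2 f -> exists C, forall i, normc (inner f (v i)) <= C) ->
  exists M, forall i, L2norm (v i) <= M.
Proof.
move=> Lv wb; apply: contrapT => nb.
have big M : exists i, M < L2norm (v i).
  apply: contrapT => nM; apply: nb; exists M => i.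
  by rewrite leNgt; apply/negP => h; apply: nM; exists i.
(* The norms must outgrow 3^n, because the n-th hump only has norm 3^-(n+1). *)
pose i n := projT1 (cid (big (n%:R * 3 ^+ n))).
pose w n := v (i n).
have wn n : n%:R * 3 ^+ n < L2norm (w n) by exact: projT2 (cid (big _)).
have Lw n : L2 (w n) by exact: Lv.
have w0 n : 0 < L2norm (w n).
  by apply: le_lt_trans (wn n); rewrite mulr_ge0// exprn_ge0.
pose e n : R := 3^-1 ^+ n.+1.
have e0 n : 0 < e n by rewrite exprn_gt0// invr_gt0.
pose h n := fun t => (e n / L2norm (w n))%:C * w n t.
have Lh n : L2 (h n) by exact: L2Z.
have nh n : L2norm (h n) = e n.
  rewrite L2normZ// normc_RtoC ger0_norm ?divfK ?gt_eqF// divr_ge0//; exact: ltW.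
have ih n : normc (inner (h n) (w n)) = e n * L2norm (w n).
  rewrite innerZl// inner_L2norm normcM !normc_RtoC !ger0_norm ?sqr_ge0//.
    by rewrite expr2 mulrA divfK// gt_eqF.
  by rewrite divr_ge0//; exact: ltW.
pose x := fix x n := if n is n'.+1 then
  (if e n' * L2norm (w n') <= normc (inner (fun t => x n' t + h n' t) (w n'))
   then fun t => x n' t + h n' t else fun t => x n' t - h n' t) else fun=> 0.
have Lx n : L2 (x n).
  elim: n => [|n ihn]; first exact: L20.
  by rewrite /=; case: ifP => _; [exact: L2D|exact: L2B].
have dx n : L2norm (fun t => x n.+1 t - x n t) <= 3^-1 * 3^-1 ^+ n.
  rewrite -exprS -/(e n) -nh /=; case: ifP => _.
    by under eq_fun do rewrite addrAC subrr add0r.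
  by under eq_fun do rewrite addrAC subrr add0r; rewrite L2normN.
have lx n : e n * L2norm (w n) <= normc (inner (x n.+1) (w n)).
  have -> : x n.+1 = if e n * L2norm (w n) <=
      normc (inner (fun t => x n t + h n t) (w n))
    then fun t => x n t + h n t else fun t => x n t - h n t by [].
  have iD := innerDl (Lx n) (Lh n) (Lw n); have iB := innerBl (Lx n) (Lh n) (Lw n).
  case: ifPn => //; rewrite -ltNge iD iB => hl.
  have := normc_triangle_lower (inner (x n) (w n)) (inner (h n) (w n)).
  rewrite ih; move: hl; set A := normc (_ + _); set B := normc (_ - _); lra.
have c0 : 0 <= 3^-1 :> R by rewrite invr_ge0.
have [X LX dX] := L2_complete c0 Lx dx.
have [C Cb] := wb X LX.
(* The part of the series beyond [x n.+1] has norm at most [e n / 2], so at least half of the inner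
   product gained at stage n survives; with e n * n * 3^n = n / 3 this gives n / 6. *)
have lb n : n%:R / 6 <= C.
  apply: le_trans (Cb (i n)); rewrite -/(w n).
  have L1 := L2B LX (Lx n.+1).
  have := Cauchy_Schwarz L1 (Lw n); rewrite innerBl// => cs.
  have : L2norm (fun t => X t - x n.+1 t) * L2norm (w n) <= 2^-1 * e n * L2norm (w n).
    rewrite ler_wpM2r ?L2norm_ge0//; apply: le_trans (dX n.+1) _.
    by rewrite -/(e n); have := e0 n; lra.
  have := le_normcD (inner (x n.+1) (w n) - inner X (w n)) (inner X (w n)).
  rewrite subrK normcB_C; have := lx n.
  have : n%:R / 3 <= e n * L2norm (w n).
    have <- : e n * (n%:R * 3 ^+ n) = n%:R / 3.
      rewrite /e exprS exprVn; field.
      by rewrite expf_neq0// pnatr_eq0.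
    by rewrite ler_wpM2l//; exact: ltW.
  move: (inner X (w n)) (inner (x n.+1) (w n)) cs => a b.
  lra.
have C0 : 0 <= C by have := lb 0%N; rewrite mul0r.
have := lb (Num.truncn (6 * C)).+1.
have : 6 * C < (Num.truncn (6 * C)).+1%:R by rewrite truncnS_gt.
lra.
Qed.

End L2_completeness.

(** * The adjoint of the semigroup *)

(** The hypothesis is a vanishing derivative at every point of [0, 1], in the incremental form that
    [inner_sg_flat] provides; the mean value theorem concludes. *)
Lemma flat_unit_interval {R : realType} (psi : R -> R) :
  (forall s : R, 0 <= s <= 1 -> forall eps : R, 0 < eps -> exists2 delta : R, 0 < delta &
    forall h : R, h != 0 -> `|h| < delta -> `|psi (s + h) - psi s| <= eps * `|h|) ->
  psi 0 = psi 1.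
Proof.
move=> flat.
have der (s : R) : 0 <= s <= 1 -> is_derive s 1 psi 0.
  move=> s01.
  have cv : h^-1 *: (psi (h *: 1 + s) - psi s) @[h --> 0^'] --> (0 : R).
    apply/cvgrPdist_le => eps eps0; have [de de0 hde] := flat s s01 _ eps0.
    near=> h; have h0 : h != 0 by near: h; exact: nbhs_dnbhs_neq.
    rewrite sub0r normrN normrM normfV ler_pdivrMl ?normr_gt0//.
    have -> : h *: 1 + s = s + h :> R by rewrite [h *: 1]mulr1 addrC.
    rewrite mulrC; apply: hde => //.
    by near: h; apply: dnbhs0_lt.
  split; first by apply/cvg_ex; exists 0.
  exact: cvg_lim cv.
have [||c _] := @MVT R psi (fun=> 0) 0 1 ltr01.
- by move=> s /[!in_itv]/= /andP[/ltW a /ltW b]; apply: der; rewrite a b.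
- apply: derivable_within_continuous => s; rewrite in_itv /= => s01.
  exact: (@ex_derive _ _ _ _ _ _ _ (der s s01)).
by rewrite mul0r => /eqP; rewrite subr_eq0 => /eqP.
Unshelve. all: by end_near. Qed.

Section semigroup.
Context {d : measure_display} {T : measurableType d} {R : realType}.
Variable mu : {measure set T -> \bar R}.
Variables (A : (T -> R[i]) -> (T -> R[i]) -> Prop)
  (S : R[i] -> (T -> R[i]) -> T -> R[i]).
Hypotheses (sa : self_adjoint mu A) (gS : generates_semigroup mu A S).

Local Notation L2 := (L2 mu).
Local Notation L2norm := (L2norm mu).
Local Notation inner := (inner mu).
Local Notation eqL2 := (eqL2 mu).

Lemma inner_diff_le f f' g g' : L2 f -> L2 f' -> L2 g -> L2 g' ->
  normc (inner f' g' - inner f g) <=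
    L2norm (fun x => f' x - f x) * (L2norm (fun x => g' x - g x) + L2norm g) +
    L2norm f * L2norm (fun x => g' x - g x).
Proof.
move=> Lf Lf' Lg Lg'; have Ldf := L2B Lf' Lf; have Ldg := L2B Lg' Lg.
have -> : inner f' g' - inner f g =
    inner (fun x => f' x - f x) g' + inner f (fun x => g' x - g x).
  by rewrite innerBl// innerBr//; ring.
apply: le_trans (le_normcD _ _) _; rewrite lerD ?Cauchy_Schwarz//.
apply: le_trans (Cauchy_Schwarz Ldf Lg') _; rewrite ler_wpM2l ?L2norm_ge0//.
have := L2normD Ldg Lg; by under eq_fun do rewrite subrK.
Qed.

Lemma sg_L2 (z : R[i]) f : 0 < Re z -> L2 f -> L2 (S z f).
Proof. by move=> z0; exact: (bop_L2 (sg_bounded gS z0)). Qed.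

(** Smoothing effect: by the semigroup law, the complex difference quotient of S at z along small t
    > 0 is the quotient defining the generator at S(z) f. Its limit exists by holomorphy, so S(z) f
    lies in the domain for every f in L^2. *)
Lemma sg_domain (z : R[i]) f : 0 < Re z -> L2 f -> exists g, [/\ L2 g, A (S z f) g &
  forall eps : R, 0 < eps -> exists2 delta : R, 0 < delta &
    forall h : R[i], h != 0 -> normc h < delta ->
      L2norm (fun x => h^-1 * (S (z + h) f x - S z f x) + g x) < eps].
Proof.
move=> z0 Lf; have [g Lg hg] := sg_holomorphic gS z0 Lf.
exists (fun x => - g x); split; [exact: L2N| |]; last exact: hg.
have LSz := sg_L2 z0 Lf.
apply/(sg_generator gS LSz (L2N Lg)); apply/cvgrPdist_lt => eps eps0.
have [de de0 hde] := hg _ eps0; near=> t.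
have t0 : 0 < t by near: t; exact: nbhs_right_gt.
rewrite sub0r normrN ger0_norm ?L2norm_ge0//.
have tt : t%:C != 0 :> R[i] by rewrite (inj_eq (@complexI R)) gt_eqF.
have tde : normc (t%:C : R[i]) < de.
  by rewrite normc_RtoC gtr0_norm//; near: t; exact: nbhs_right_lt.
have zt0 : 0 < Re (z + t%:C) by rewrite ReD addr_gt0.
have := hde _ tt tde; congr (_ < _); apply: eqL2_norm.
- apply: L2B => //; apply: L2Z; apply: L2B => //; exact: sg_L2.
- apply: L2B; last exact/L2N/L2N.
  by apply: L2Z; apply: L2B => //; apply: sg_L2.
have := sg_semigroup gS (t0 : 0 < Re t%:C) z0 Lf.
rewrite addrC; apply: filterS => x /= + _ => ->//.
by rewrite opprK fmorphV.
Unshelve. all: by end_near. Qed.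

Lemma symmetric f g f' g' : A f g -> A f' g' -> inner g f' = inner f g'.
Proof. by case: sa => _ _ sAP Afg /sAP[_ _]; exact. Qed.

(** The derivative in h at 0 is z <A S(a) f, S(b) g> - z <S(a) f, A S(b) g>, which vanishes by
    symmetry of A. The conjugate of z in the second argument becomes z because the inner product is
    conjugate-linear there. *)
Lemma inner_sg_flat (a b z : R[i]) f g : 0 < Re a -> 0 < Re b -> L2 f -> L2 g ->
  forall eps : R, 0 < eps -> exists2 delta : R, 0 < delta &
    forall h : R, h != 0 -> `|h| < delta ->
    normc (inner (S (a - h%:C * z) f) (S (b + h%:C * conjc z) g) -
           inner (S a f) (S b g)) <= eps * `|h|.
Proof.
move=> a0 b0 Lf Lg eps eps0.
have [->|z0] := eqVneq z 0.
  exists 1 => // h _ _; rewrite conjc0 !mulr0 subr0 addr0 subrr normc0.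
  by rewrite mulr_ge0// ltW.
have [GA [LGA AGA dA]] := sg_domain a0 Lf.
have [GB [LGB AGB dB]] := sg_domain b0 Lg.
have LA := sg_L2 a0 Lf; have LB := sg_L2 b0 Lg.
(* A common bound for all norms below, at least 1 so that N <= N^2. *)
pose N := 1 + L2norm GA + L2norm GB + L2norm (S a f) + L2norm (S b g).
have nz : 0 < normc z.
  by rewrite lt_neqAle normc_ge0 andbT eq_sym; apply: contra z0 => /eqP/eq0_normc ->.
have N1 : 1 <= N by rewrite /N -!addrA lerDl !addr_ge0 ?L2norm_ge0.
have N0 : 0 < N by apply: lt_le_trans N1.
have [pA pB] := (L2norm_ge0 mu GA, L2norm_ge0 mu GB).
have [qA qB] := (L2norm_ge0 mu (S a f), L2norm_ge0 mu (S b g)).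
have nGA : L2norm GA <= N by rewrite /N; lra.
have nSa : L2norm (S a f) <= N by rewrite /N; lra.
have nSb : L2norm (S b g) <= N by rewrite /N; lra.
have nGB : 1 + L2norm GB <= N by rewrite /N; lra.
have NN : N <= N ^+ 2 by rewrite expr2 ler_peMl// ltW.
clearbody N.
have K0 : 0 < 4 * N ^+ 2 * normc z by rewrite !mulr_gt0// exprn_gt0.
(* The error found at the end is |h| |z| e (3 N + N^2), at most |h| |z| e * 4 N^2. *)
have [e e0 [e1 ee]] : exists2 e : R, 0 < e & e <= 1 /\ e * (4 * N ^+ 2 * normc z) <= eps.
  exists (Num.min 1 (eps / (4 * N ^+ 2 * normc z))).
    by rewrite lt_min ltr01 divr_gt0.
  by rewrite -ler_pdivlMr// !ge_min !lexx orbT.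
have [d1 d10 hd1] := dA _ e0; have [d2 d20 hd2] := dB _ e0.
(* [d1] and [d2] control the difference quotients, [e] the increment of S(b) g; [Re a] and [Re b]
   keep both shifted arguments in the right half-plane. *)
exists (Num.min (Num.min d1 d2) (Num.min e (Num.min (Re a) (Re b))) / normc z).
  by rewrite divr_gt0// !lt_min d10 d20 e0 a0 b0.
move=> h h0; rewrite ltr_pdivlMr// !lt_min => /and3P[/andP[hh1 hh2] hh3 /andP[hh4 hh5]].
pose k := - (h%:C * z); pose l := h%:C * conjc z.
have hC : h%:C != 0 :> R[i] by rewrite (inj_eq (@complexI R)).
rewrite -/k -/l.
have nk : normc k = `|h| * normc z by rewrite normcN normcM normc_RtoC.
have nl : normc l = `|h| * normc z by rewrite normcM normc_RtoC normc_conj.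
have k0 : k != 0 by rewrite oppr_eq0 mulf_neq0.
have l0 : l != 0 by rewrite mulf_neq0// conjc_eq0.
have lk : conjc l = - k by rewrite conjcM conjcK conjc_real opprK.
clearbody k l.
have a'0 : 0 < Re (a + k).
  rewrite ReD; have := abs_Re_le k; rewrite nk ler_norml => /andP[+ _]; lra.
have b'0 : 0 < Re (b + l).
  rewrite ReD; have := abs_Re_le l; rewrite nl ler_norml => /andP[+ _]; lra.
have LA' := sg_L2 a'0 Lf; have LB' := sg_L2 b'0 Lg.
pose r1 := fun x => k^-1 * (S (a + k) f x - S a f x) + GA x.
pose r2 := fun x => l^-1 * (S (b + l) g x - S b g x) + GB x.
have Lr1 : L2 r1 by apply: L2D => //; apply: L2Z; exact: L2B.
have Lr2 : L2 r2 by apply: L2D => //; apply: L2Z; exact: L2B.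
have nr1 : L2norm r1 < e by apply: hd1 => //; rewrite nk.
have nr2 : L2norm r2 < e by apply: hd2 => //; rewrite nl.
have EA : inner (S (a + k) f) (S (b + l) g) - inner (S a f) (S (b + l) g) =
    k * (inner r1 (S (b + l) g) - inner GA (S (b + l) g)).
  rewrite -!innerBl// -innerZl//; last exact: L2B.
  congr inner; apply/funext => x; rewrite /r1; field; exact: k0.
have EB : inner (S a f) (S (b + l) g) - inner (S a f) (S b g) =
    - k * (inner (S a f) r2 - inner (S a f) GB).
  rewrite -!innerBr// -lk -innerZr//; last exact: L2B.
  congr inner; apply/funext => x; rewrite /r2; field; exact: l0.
have dBl : L2norm (fun x => S (b + l) g x - S b g x) <= e * N.
  have -> : (fun x => S (b + l) g x - S b g x) = (fun x => l * (r2 x - GB x)).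
    by apply/funext => x; rewrite /r2; field; exact: l0.
  rewrite L2normZ; last exact: L2B.
  rewrite nl ler_pM ?L2norm_ge0 ?mulr_ge0 ?normc_ge0//; first exact: ltW.
  by apply: le_trans (L2normB Lr2 LGB) _; lra.
(* The first-order terms <GA, S(b) g> and <S(a) f, GB> are equal by symmetry and cancel; each
   remaining term has a factor of size e. *)
have -> : inner (S (a + k) f) (S (b + l) g) - inner (S a f) (S b g) =
   k * (inner r1 (S (b + l) g) - inner GA (fun x => S (b + l) g x - S b g x)
        - inner (S a f) r2).
  rewrite innerBr// (symmetric AGA AGB).
  by rewrite -(subrK (inner (S a f) (S (b + l) g)) (inner _ _)) -addrA EA EB; ring.
rewrite normcM nk -mulrA mulrC ler_wpM2r//.
have nB' : L2norm (S (b + l) g) <= 2 * N.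
  have := L2normD (L2B LB' LB) LB; under eq_fun do rewrite subrK.
  move=> h1; apply: le_trans h1 _.
  have : e * N <= N by rewrite ger_pMl.
  by lra.
apply: le_trans ee; rewrite mulrC mulrA ler_wpM2r//; first exact: ltW.
apply: le_trans (le_normcB _ _) _.
apply: (@le_trans _ _ (e * (2 * N) + N * (e * N) + N * e)); last first.
  rewrite (_ : _ + N * e = e * (3 * N + N ^+ 2)); last by ring.
  by apply: ler_wpM2l; [exact: ltW|lra].
rewrite lerD//; last first.
  apply: le_trans (Cauchy_Schwarz LA Lr2) _.
  by rewrite ler_pM ?L2norm_ge0// ltW.
apply: le_trans (le_normcB _ _) _; rewrite lerD//.
  apply: le_trans (Cauchy_Schwarz Lr1 LB') _.
  by rewrite ler_pM ?L2norm_ge0// ltW.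
apply: le_trans (Cauchy_Schwarz LGA (L2B LB' LB)) _.
by rewrite ler_pM ?L2norm_ge0.
Qed.

(** Moves z from the left factor to the right one along s in [0, 1], with zero derivative at each s.
    The offset t keeps both arguments inside the open half-plane at the ends of the path. *)
Lemma inner_sg_shift (z : R[i]) (t : R) f g : 0 < t -> 0 < Re z -> L2 f -> L2 g ->
  inner (S (t%:C + z) f) (S t%:C g) = inner (S t%:C f) (S (t%:C + conjc z) g).
Proof.
move=> t0 z0 Lf Lg.
pose phi (s : R) := inner (S (t%:C + (1 - s)%:C * z) f) (S (t%:C + s%:C * conjc z) g).
have flat (s : R) : 0 <= s <= 1 -> forall eps : R, 0 < eps -> exists2 delta : R, 0 < delta &
    forall h : R, h != 0 -> `|h| < delta -> normc (phi (s + h) - phi s) <= eps * `|h|.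
  move=> /andP[s0 s1] eps eps0.
  have a0 : 0 < Re (t%:C + (1 - s)%:C * z).
    by rewrite ReD ReM /= mul0r subr0 ltr_pwDl// mulr_ge0 ?subr_ge0// ltW.
  have b0 : 0 < Re (t%:C + s%:C * conjc z).
    by rewrite ReD ReM ReJ /= mul0r subr0 ltr_pwDl// mulr_ge0// ltW.
  have [de de0 hde] := inner_sg_flat z a0 b0 Lf Lg eps0.
  exists de => // h h0 hlt; rewrite /phi.
  have -> : t%:C + (1 - (s + h))%:C * z = t%:C + (1 - s)%:C * z - h%:C * z.
    by apply: complex_ext; rewrite !(ReD, ImD, ReN, ImN, ReM, ImM) /=; ring.
  have -> : t%:C + (s + h)%:C * conjc z = t%:C + s%:C * conjc z + h%:C * conjc z.
    by apply: complex_ext; rewrite !(ReD, ImD, ReN, ImN, ReM, ImM) /=; ring.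
  exact: hde.
have : phi 0 = phi 1.
  apply: complex_ext; apply: (@flat_unit_interval _ (fun s => _ (phi s))) => s s01 eps eps0;
    have [de de0 hde] := flat s s01 eps eps0; exists de => // h h0 hlt;
    apply: le_trans (hde h h0 hlt).
    by rewrite -ReN -ReD abs_Re_le.
  by rewrite -ImN -ImD abs_Im_le.
by rewrite /phi subr0 subrr !mul1r !mul0r !addr0.
Qed.

(** Let t tend to 0 in [inner_sg_shift]: the semigroup law extracts the factor S(t) on both sides,
    and strong continuity at 0 removes it. *)
Lemma sg_adjoint (z : R[i]) f g : 0 < Re z -> L2 f -> L2 g ->
  inner (S z f) g = inner f (S (conjc z) g).
Proof.
move=> z0 Lf Lg; have z'0 : 0 < Re (conjc z) by rewrite ReJ.
have Lzf := sg_L2 z0 Lf; have Lzg := sg_L2 z'0 Lg.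
have lim u v : L2 u -> L2 v ->
    normc (inner (S t%:C u) (S t%:C v) - inner u v) @[t --> 0^'+] --> (0 : R).
  move=> Lu Lv; have cu := sg_continuous gS Lu; have cv := sg_continuous gS Lv.
  have : L2norm (fun x => S t%:C u x - u x) * (L2norm (fun x => S t%:C v x - v x) + L2norm v) +
     L2norm u * L2norm (fun x => S t%:C v x - v x) @[t --> 0^'+] --> (0 * (0 + L2norm v) + L2norm u * 0 : R).
    apply: cvgD; apply: cvgM => //; last exact: cvg_cst.
    by apply: cvgD => //; exact: cvg_cst.
  rewrite mul0r mulr0 addr0; apply: squeeze_cvgr; last exact: cvg_cst.
  near=> t; have t0 : 0 < Re t%:C by rewrite /=; near: t; exact: nbhs_right_gt.
  rewrite normc_ge0 inner_diff_le//; exact: sg_L2.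
have tri (eps : R) (p q p' : R[i]) : normc (p' - p) < eps / 2 ->
    normc (p' - q) < eps / 2 -> normc (p - q) <= eps.
  have := le_normcB (p' - q) (p' - p).
  by rewrite (_ : p' - q - (p' - p) = p - q); [lra|ring].
have L1 := lim _ _ Lzf Lg; have L2' := lim _ _ Lf Lzg.
apply/eqP; rewrite -subr_eq0; apply/eqP/normc_eq0P.
apply/ler_addgt0Pr => eps eps0; rewrite add0r; have e20 : 0 < eps / 2 by rewrite divr_gt0.
near (0 : R)^'+ => t.
have t0 : 0 < t by near: t; exact: nbhs_right_gt.
have t0' : 0 < Re t%:C by [].
have D1 : normc (inner (S t%:C (S z f)) (S t%:C g) - inner (S z f) g) < eps / 2.
  near: t; move/cvgrPdist_lt: L1 => /(_ _ e20); apply: filterS => t.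
  by rewrite sub0r normrN ger0_norm ?normc_ge0.
have D2 : normc (inner (S t%:C f) (S t%:C (S (conjc z) g)) - inner f (S (conjc z) g)) < eps / 2.
  near: t; move/cvgrPdist_lt: L2' => /(_ _ e20); apply: filterS => t.
  by rewrite sub0r normrN ger0_norm ?normc_ge0.
have := inner_sg_shift t0 z0 Lf Lg.
have tz0 : 0 < Re (t%:C + z) by rewrite ReD addr_gt0.
have tz'0 : 0 < Re (t%:C + conjc z) by rewrite ReD addr_gt0.
rewrite (eqL2_innerl _ _ _ (sg_semigroup gS t0' z0 Lf)); try exact: sg_L2.
rewrite (eqL2_innerr _ _ _ (sg_semigroup gS t0' z'0 Lg)); try exact: sg_L2.
move=> pq; apply: tri D1 _; rewrite pq; exact: D2.
Unshelve. all: by end_near. Qed.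

End semigroup.

(** * Integrals over restricted measures, and averages *)

(** Stated through the values of [m1], so that it serves both for restrictions of Lebesgue measure
    and for [graph_measure]. *)
Lemma ge0_integral_restricted d (T : measurableType d) (R : realType)
    (m1 m2 : {measure set T -> \bar R}) (E : set T) (f : T -> \bar R) :
  measurable E -> (forall A, m1 A = m2 (A `&` E)) ->
  measurable_fun setT f -> (forall x, 0 <= f x)%E ->
  (\int[m1]_x f x = \int[m2]_(x in E) f x)%E.
Proof.
move=> mE m12 mf f0; have N0 : m1 (~` E) = 0%E by rewrite m12 setICl measure0.
have := ge0_negligible_integral (measurableC mE) measurableT mf (fun x _ => f0 x) N0.
move=> ->; rewrite setTD setCK; apply: eq_measure_integral => A mA AE.
by rewrite m12 setIidl.
Qed.

Section integral_lemmas.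
Context {d : measure_display} {T : measurableType d} {R : realType}.
Variable mu : {measure set T -> \bar R}.

Lemma ge0_integral_mrestr (E : set T) (mE : measurable E) (f : T -> \bar R) :
  measurable_fun setT f -> (forall x, 0 <= f x)%E ->
  (\int[mrestr mu mE]_x f x = \int[mu]_(x in E) f x)%E.
Proof.
exact: ge0_integral_restricted.
Qed.

Lemma measurable_normc (f : T -> R[i]) : cmeasurable f ->
  measurable_fun setT (fun x => normc (f x)).
Proof.
move=> mf; under eq_fun do rewrite -[normc _]ger0_norm ?normc_ge0// -sqrtr_sqr.
apply: measurableT_comp; last exact: measurable_sqr_normc.
exact: continuous_measurable_fun (@sqrt_continuous R).
Qed.

Lemma cintegrable_cmeasurable (f : T -> R[i]) : cintegrable mu f -> cmeasurable f.
Proof.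
by move=> [f1 f2]; split; [move/measurable_int/measurable_EFinP : f1|
  move/measurable_int/measurable_EFinP : f2].
Qed.

Lemma integrable_normc (f : T -> R[i]) : cintegrable mu f ->
  mu.-integrable setT (fun x => (normc (f x))%:E).
Proof.
move=> intf; have [f1 f2] := intf.
have := integrableD measurableT (integrable_abse f1) (integrable_abse f2).
apply: le_integrable => //.
  exact/measurable_EFinP/measurable_normc/cintegrable_cmeasurable.
move=> x _; rewrite /= lee_fin ger0_norm ?normc_ge0// ger0_norm ?addr_ge0//.
exact: normc_le_abs.
Qed.

Lemma normc_cintegral_le (f : T -> R[i]) : cintegrable mu f ->
  normc (cintegral mu f) <= \int[mu]_x normc (f x).
Proof.
move=> intf; have [f1 f2] := intf; set c := cintegral mu f.
have intn := integrable_normc intf.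
have [c0|c0] := eqVneq c 0.
  by rewrite c0 normc0 Rintegral_ge0// => x _; exact: normc_ge0.
have nc : 0 < normc c.
  by rewrite lt_neqAle normc_ge0 andbT eq_sym; apply: contra c0 => /eqP/eq0_normc ->.
have i0 : cintegrable mu (fun=> 0 : R[i]) by split; exact: integrable0.
(* Multiplying by conj c rotates the integral onto the positive real axis: |c|^2 is the integral of
   Re (conj c * f), at most |c| times the integral of |f|. *)
have := cintegral_comb (conjc c) (conj f1 f2) i0.
rewrite -/c; under [X in cintegral mu X]eq_fun do rewrite addr0.
have -> : cintegral mu (fun=> 0 : R[i]) = 0.
  by apply: complex_ext; rewrite /= Rintegral_cst// mul0r.
rewrite addr0 mulrC mul_conjc => /(congr1 (@complex.Re R)) E'.
have E : \int[mu]_x Re (conjc c * f x) = normc c ^+ 2 by exact: E'.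
clearbody c; clear E'.
rewrite -(@ler_pM2l _ (normc c))// -expr2 -E -RintegralZl//.
apply: le_Rintegral => //.
- have : mu.-integrable setT ((fun x => (Re c)%:E * (Re (f x))%:E + (Im c)%:E * (Im (f x))%:E)%E).
    by apply: integrableD => //; exact: integrableZl.
  apply: eq_integrable => // x _.
  by rewrite /= ReM ReJ ImJ -!EFinM -EFinD; congr EFin; ring.
- by rewrite /comp; under eq_fun do rewrite EFinM; exact: integrableZl.
move=> x _; apply: le_trans (ler_norm _) _; apply: le_trans (abs_Re_le _) _.
by rewrite normcM normc_conj.
Qed.

(* Averaging against a probability density w concentrated where u is close to c. *)
Lemma normc_average_le (u : T -> R[i]) (w : T -> R) (c : R[i]) (e : R) :
  cintegrable mu (fun x => u x * (w x)%:C) ->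
  mu.-integrable setT (EFin \o w) -> (forall x, 0 <= w x) ->
  \int[mu]_x w x = 1 -> (forall x, w x != 0 -> normc (u x - c) <= e) ->
  normc (cintegral mu (fun x => u x * (w x)%:C) - c) <= e.
Proof.
move=> iuw iw w0 w1 uc.
have iwC : cintegrable mu (fun x => (w x)%:C) by split => //; exact: integrable0.
have wC : cintegral mu (fun x => (w x)%:C) = 1.
  by apply: complex_ext; rewrite /= ?w1// Rintegral_cst// mul0r.
have := cintegral_comb (- c) iwC iuw; rewrite wC mulr1 addrC => <-.
set h := fun x => - c * (w x)%:C + u x * (w x)%:C.
have hE x : h x = (u x - c) * (w x)%:C by rewrite /h; ring.
have ih : cintegrable mu h.
  case: iuw => iuw1 iuw2; split.
    have := integrableD measurableT iuw1 (integrableZl measurableT (- Re c) iw).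
    by apply: eq_integrable => // x _; rewrite /h ReD [in Re (- c * _)]ReM ReN /=
      mulr0 subr0 EFinD addeC EFinM.
  have := integrableD measurableT iuw2 (integrableZl measurableT (- Im c) iw).
  by apply: eq_integrable => // x _; rewrite /h ImD [in Im (- c * _)]ImM ImN /=
    mulr0 add0r EFinD addeC EFinM.
apply: le_trans (normc_cintegral_le ih) _.
rewrite -[leRHS]mulr1 -w1 -RintegralZl//.
apply: le_Rintegral => //.
- have := integrableZl measurableT e iw; apply: le_integrable => //.
    exact/measurable_EFinP/measurable_normc/cintegrable_cmeasurable.
  move=> x _; rewrite /= lee_fin ger0_norm ?normc_ge0// hE normcM normc_RtoC.
  rewrite normrM (ger0_norm (w0 x)); have [->|wx] := eqVneq (w x) 0.
    by rewrite !mulr0.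
  by rewrite ler_wpM2r// (le_trans (uc _ wx))// ler_norm.
- by rewrite /comp; under eq_fun do rewrite EFinM; exact: integrableZl.
move=> x _; rewrite hE normcM normc_RtoC ger0_norm//.
have [->|wx] := eqVneq (w x) 0; first by rewrite !mulr0.
by rewrite ler_wpM2r// uc.
Qed.

Lemma L2_bounded (E : set T) (f : T -> R[i]) (B : R) : measurable E ->
  (mu E < +oo)%E -> cmeasurable f -> 0 <= B ->
  (forall x, normc (f x) <= B * \1_E x) ->
  L2 mu f /\ L2norm mu f ^+ 2 <= B ^+ 2 * fine (mu E).
Proof.
move=> mE Efin mf B0 fB.
have sq x : normc (f x) ^+ 2 <= B ^+ 2 * \1_E x.
  apply: (@le_trans _ _ ((B * \1_E x) ^+ 2)).
    by rewrite ler_pXn2r ?nnegrE ?normc_ge0// mulr_ge0// indicE.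
  by rewrite indicE exprMn; case: (x \in E); rewrite /= ?expr1n ?expr0n.
have iE : mu.-integrable setT (fun x => (B ^+ 2)%:E * (\1_E x)%:E)%E.
  apply: integrableZl => //; apply/integrableP; split.
    by apply/measurable_EFinP; exact: measurable_indic.
  under eq_integral do rewrite abse_EFin ger0_norm ?indicE//.
  have := @integral_indic _ _ _ mu _ measurableT E mE; rewrite setIT.
  by under eq_integral do rewrite indicE; move=> ->.
have Lf : L2 mu f.
  apply/L2P; split => //; apply: le_integrable iE => //.
    exact/measurable_EFinP/measurable_sqr_normc.
  move=> x _; rewrite -EFinM !abse_EFin lee_fin ger0_norm ?sqr_ge0//.
  by rewrite ger0_norm// mulr_ge0 ?sqr_ge0// indicE.
split => //; rewrite sqr_L2norm.
have -> : B ^+ 2 * fine (mu E) = \int[mu]_x (B ^+ 2 * \1_E x).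
  rewrite RintegralZl//.
    rewrite /Rintegral; have := @integral_indic _ _ _ mu _ measurableT E mE.
    by rewrite setIT => ->.
  apply/integrableP; split; first exact/measurable_EFinP/measurable_indic.
  under eq_integral do rewrite abse_EFin ger0_norm ?indicE//.
  have := @integral_indic _ _ _ mu _ measurableT E mE; rewrite setIT.
  by under eq_integral do rewrite indicE; move=> ->.
by apply: le_Rintegral => //; case/L2P: Lf.
Qed.

End integral_lemmas.

(** * Quadratic splines as test functions *)

Section spline.
Context {R : realType}.
Implicit Types (a b t x : R).

Definition pospart t : R := Num.max 0 t.

Lemma pospart_continuous b : continuous (fun t => pospart (t - b)).
Proof.
have E s : pospart (s - b) = ((s - b) + `|s - b|) / 2.
  by rewrite /pospart; have [h|h] := leP 0 (s - b); [rewrite ger0_norm//|rewrite ltr0_norm//]; lra.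
have -> : (fun t => pospart (t - b)) = (fun s => ((s - b) + `|s - b|) / 2).
  by apply/funext => s; exact: E.
move=> t; have c : (fun s : R => s - b) @ t --> t - b by apply: cvgB; [exact: cvg_id|exact: cvg_cst].
apply: cvgM; last exact: cvg_cst.
by apply: cvgD => //; exact: cvg_norm.
Qed.

(** A quadratic Taylor remainder: squaring smooths the kink of the positive part, which makes the
    splines C^1. *)
Lemma sqr_pospart_diff t h :
  `|pospart (t + h) ^+ 2 - pospart t ^+ 2 - 2 * pospart t * h| <= h ^+ 2.
Proof.
rewrite ler_norml /pospart; have [t0|t0] := leP 0 t; have [th|th] := leP 0 (t + h);
  apply/andP; split; nra.
Qed.

Lemma is_derive_sqr_pospart b t :
  is_derive t 1 (fun s : R => pospart (s - b) ^+ 2) (2 * pospart (t - b)).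
Proof.
have cv : h^-1 *: (pospart (h *: 1 + t - b) ^+ 2 - pospart (t - b) ^+ 2)
    @[h --> 0^'] --> (2 * pospart (t - b) : R).
  apply/cvgrPdist_le => eps eps0; near=> h.
  have h0 : h != 0 by near: h; exact: nbhs_dnbhs_neq.
  have -> : h *: 1 + t - b = (t - b) + h :> R by rewrite [h *: 1]mulr1; ring.
  rewrite -(@ler_pM2l _ `|h|) ?normr_gt0// distrC -normrM.
  have -> : h * (h^-1 *: (pospart (t - b + h) ^+ 2 - pospart (t - b) ^+ 2) -
      2 * pospart (t - b)) = pospart (t - b + h) ^+ 2 - pospart (t - b) ^+ 2 -
      2 * pospart (t - b) * h by rewrite /GRing.scale /=; field.
  apply: le_trans (sqr_pospart_diff _ _) _.
  rewrite -[h ^+ 2]ger0_norm ?sqr_ge0// normrX expr2 ler_wpM2l//.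
  by near: h; apply: dnbhs0_le.
split; first by apply/cvg_ex; exists (2 * pospart (t - b)).
exact: cvg_lim cv.
Unshelve. all: by end_near. Qed.

(* A C^1 quadratic spline increasing from 0 to 1 on [a, a + dl]. *)
Definition step a (dl : R) t : R :=
  2 / dl ^+ 2 * (pospart (t - a) ^+ 2 - 2 * pospart (t - (a + dl / 2)) ^+ 2
    + pospart (t - (a + dl)) ^+ 2).

(** The derivative of [step]: for dl > 0, a hat of base [a, a + dl], height 2 / dl and integral
    1. *)
Definition bump a (dl : R) t : R :=
  4 / dl ^+ 2 * (pospart (t - a) - 2 * pospart (t - (a + dl / 2))
    + pospart (t - (a + dl))).

Lemma is_derive_step a (dl : R) t : is_derive t 1 (step a dl) (bump a dl t).
Proof.
have h1 := is_derive_sqr_pospart a t.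
have h2 := is_derive_sqr_pospart (a + dl / 2) t.
have h3 := is_derive_sqr_pospart (a + dl) t.
rewrite /step; apply: is_derive_eq.
rewrite /bump /GRing.scale /=; ring.
Qed.

Lemma bump_continuous a dl : continuous (bump a dl).
Proof.
move=> t; apply: cvgM; first exact: cvg_cst.
apply: cvgD; last exact: pospart_continuous.
apply: cvgB; first exact: pospart_continuous.
by apply: cvgM; [exact: cvg_cst|exact: pospart_continuous].
Qed.

Lemma step_le a (dl : R) t : 0 < dl -> t <= a -> step a dl t = 0.
Proof.
move=> d0 ta; rewrite /step /pospart !max_l; try lra; try ring.
Qed.

Lemma step_ge a (dl : R) t : 0 < dl -> a + dl <= t -> step a dl t = 1.
Proof.
move=> d0 ta; rewrite /step /pospart !max_r; try lra; field.
exact: lt0r_neq0.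
Qed.

Lemma step_itv a (dl : R) t : 0 < dl -> 0 <= step a dl t <= 1.
Proof.
move=> d0; have [ta|ta] := leP t a; first by rewrite step_le// lexx ler01.
have [tb|tb] := leP (a + dl) t; first by rewrite step_ge// lexx ler01.
have k : 2 / dl ^+ 2 * dl ^+ 2 = 2 by rewrite divfK// lt0r_neq0// exprn_gt0.
have k0 : 0 < 2 / dl ^+ 2 by rewrite divr_gt0// exprn_gt0.
rewrite /step; move: (2 / dl ^+ 2) k k0 => c k c0.
rewrite /pospart (max_r (_ : 0 <= t - a)); last lra.
rewrite (max_l (_ : t - (a + dl) <= 0)); last lra.
have [tm|tm] := leP (a + dl / 2) t.
  rewrite max_r; last lra.
  have := mulr_ge0 (ltW c0) (sqr_ge0 (t - (a + dl))).
  have : c * (a + dl - t) ^+ 2 <= c * (dl / 2) ^+ 2.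
    by rewrite ler_pM2l// !expr2; nra.
  by move=> h1 h2; apply/andP; split; nra.
rewrite max_l; last lra.
have := mulr_ge0 (ltW c0) (sqr_ge0 (t - a)).
have : c * (t - a) ^+ 2 <= c * (dl / 2) ^+ 2.
  by rewrite ler_pM2l// !expr2; nra.
by move=> h1 h2; apply/andP; split; nra.
Qed.

Lemma bump_ge0 a (dl : R) t : 0 < dl -> 0 <= bump a dl t.
Proof.
move=> d0; rewrite /bump mulr_ge0//; first by rewrite divr_ge0// exprn_ge0// ltW.
rewrite /pospart; have [h1|h1] := leP 0 (t - a); have [h2|h2] := leP 0 (t - (a + dl / 2));
  have [h3|h3] := leP 0 (t - (a + dl)); lra.
Qed.

Lemma bump_out a (dl : R) t : 0 < dl -> bump a dl t != 0 -> a <= t <= a + dl.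
Proof.
move=> d0; apply: contraR => /nandP[]; rewrite -ltNge => h; apply/eqP.
  rewrite /bump /pospart !max_l; try lra; ring.
rewrite /bump /pospart !max_r; try lra; ring.
Qed.

End spline.

(** * Sobolev estimates on one edge *)

Lemma dist_itv_le {R : realType} (l x y : R) : 0 <= x <= l -> 0 <= y <= l ->
  `|x - y| <= l.
Proof.
by move=> /andP[? ?] /andP[? ?]; rewrite ler_norml; apply/andP; split; lra.
Qed.

(** Applied with r the square root of l, a and b the moduli of u at two points, U and V the norms of
    u and u'. In |a - b| (a + b) the factor r of the Hoelder bound cancels the 1 / r in the
    pointwise bounds, so no negative power of a short length survives. *)
Lemma energy_arith_short {R : realType} (a b U V l r : R) :
  0 <= a -> 0 <= b -> 0 <= U -> 0 <= V -> l <= 1 -> `|a - b| <= r * V ->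
  r * a <= U + l * V -> r * b <= U + l * V ->
  `|a ^+ 2 - b ^+ 2| <= 3 * (U ^+ 2 + V ^+ 2).
Proof.
move=> a0 b0 U0 V0 l1 h pa pb.
rewrite subr_sqr normrM mulrC [`|_ + _|]ger0_norm ?addr_ge0//.
apply: (@le_trans _ _ ((a + b) * (r * V))); first by rewrite ler_wpM2l// addr_ge0.
have -> : (a + b) * (r * V) = V * (r * a + r * b) by ring.
apply: (@le_trans _ _ (V * (2 * U + 2 * V))).
  rewrite ler_wpM2l//; have lV : l * V <= V by rewrite ler_piMl.
  lra.
have s1 := sqr_ge0 (U - V); have s2 := sqr_ge0 U; nra.
Qed.

Lemma energy_arith_long {R : realType} (a b U V : R) :
  0 <= a -> 0 <= b -> 0 <= U -> 0 <= V -> a <= U + V -> b <= U + V ->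
  `|a ^+ 2 - b ^+ 2| <= 3 * (U ^+ 2 + V ^+ 2).
Proof.
move=> a0 b0 U0 V0 ha hb; rewrite ler_norml.
have s1 := sqr_ge0 (U - V); apply/andP; split; nra.
Qed.

Section sobolev_edge.
Context {R : realType}.
Variable l : R.
Hypothesis l0 : 0 < l.

Local Notation nu := (interval_measure l).

Lemma interval_measure_setT : nu setT = l%:E.
Proof.
rewrite /interval_measure /mrestr setTI.
have := @lebesgue_measure_itv R `[0, l] => /= ->.
by rewrite lte_fin l0 sube0.
Qed.

Lemma interval_measure_itv (x y : R) : 0 <= x -> x <= y -> y <= l ->
  nu `[x, y] = (y - x)%:E.
Proof.
move=> x0 xy yl; rewrite /interval_measure /mrestr setIidl.
  have := @lebesgue_measure_itv R `[x, y] => /= ->; rewrite lte_fin.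
  by case: ltgtP xy => // -> _; rewrite subrr.
by move=> t /=; rewrite !in_itv /= => /andP[xt ty]; apply/andP; split; lra.
Qed.

Lemma measurable_bump a (dl : R) : measurable_fun setT (bump a dl).
Proof. by apply: continuous_measurable_fun; exact: bump_continuous. Qed.

Lemma step_continuous a (dl : R) : continuous (step a dl).
Proof.
move=> t; apply: differentiable_continuous; apply/derivable1_diffP.
exact: (@ex_derive _ _ _ _ _ _ _ (is_derive_step a dl t)).
Qed.

Lemma measurable_step a (dl : R) : measurable_fun setT (step a dl).
Proof. by apply: continuous_measurable_fun; exact: step_continuous. Qed.

Lemma bump_integrable a (dl : R) : nu.-integrable setT (EFin \o bump a dl).
Proof.
have mb := measurable_bump a dl.
apply/integrableP; split; first exact/measurable_EFinP.
rewrite ge0_integral_mrestr//; last first.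
  by apply/measurable_EFinP; exact: measurableT_comp.
have := @continuous_compact_integrable R (fun t => `|bump a dl t|) `[0, l]
  (@segment_compact _ _ _).
have cb : {within `[0, l], continuous (fun t => `|bump a dl t|)}.
  apply: continuous_subspaceT => t; apply: cvg_norm; exact: bump_continuous.
move=> /(_ cb) /integrableP[_].
congr (_ < _)%E; apply: eq_integral => t _.
by rewrite /= normr_id.
Qed.

Lemma bump_integral a (dl : R) : 0 <= a -> 0 < dl -> a + dl <= l ->
  \int[nu]_t bump a dl t = 1.
Proof.
move=> a0 d0 adl; rewrite /Rintegral ge0_integral_mrestr//; last first.
- by move=> t; rewrite lee_fin bump_ge0.
- by apply/measurable_EFinP; exact: measurable_bump.
rewrite (@continuous_FTC2 _ _ (step a dl))//.
- by rewrite step_ge// step_le//= subr0.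
- apply: continuous_subspaceT; exact: bump_continuous.
- split.
  + by move=> t _; exact: (@ex_derive _ _ _ _ _ _ _ (is_derive_step a dl t)).
  + exact/cvg_at_right_filter/step_continuous.
  + exact/cvg_at_left_filter/step_continuous.
- by move=> t _; rewrite derive1E; apply: derive_val; exact: is_derive_step.
Qed.

(** A C^1 cutoff supported in [x, y] whose derivative is a unit hat near x minus one near y. Testing
    with it compares an average of u near x with an average near y. *)
Lemma test_function_step (x y dl : R) : 0 < x -> y < l -> 0 < dl -> x + dl <= y ->
  test_function l (fun t => step x dl t - step (y - dl) dl t) /\
  derive1 (fun t => step x dl t - step (y - dl) dl t) =
    (fun t => bump x dl t - bump (y - dl) dl t).
Proof.
move=> x0 yl d0 xy.
have der (t : R) : is_derive t 1 (fun t : R => step x dl t - step (y - dl) dl t)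
    (bump x dl t - bump (y - dl) dl t).
  by have := is_derive_step x dl t; have := is_derive_step (y - dl) dl t;
    move=> ? ?; exact: is_deriveB.
have dE : derive1 (fun t => step x dl t - step (y - dl) dl t) =
    (fun t => bump x dl t - bump (y - dl) dl t).
  by apply/funext => t; rewrite derive1E; apply: derive_val; exact: der.
split=> //; split.
- by move=> t; exact: (@ex_derive _ _ _ _ _ _ _ (der t)).
- by rewrite dE => t; apply: cvgB; exact: bump_continuous.
exists x, y; split => // t; apply: contraR => /nandP[]; rewrite -ltNge => h; apply/eqP.
  by rewrite !step_le ?subrr//; lra.
by rewrite !step_ge ?subrr//; lra.
Qed.

Section hoelder.
Variables u v : R -> R[i].
Hypotheses (uv : sobolev1 l u v)
  (cRe : {within `[0, l], continuous (fun x => Re (u x))})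
  (cIm : {within `[0, l], continuous (fun x => Im (u x))}).

Lemma within_continuous_dist (x e : R) : 0 <= x <= l -> 0 < e ->
  exists2 dl : R, 0 < dl & forall t, 0 <= t <= l -> `|t - x| < dl -> normc (u t - u x) <= e.
Proof.
move=> xl e0; have e20 : 0 < e / 2 by rewrite divr_gt0.
have aux (f : R -> R) : {within `[0, l], continuous f} ->
    exists2 dl : R, 0 < dl & forall t, 0 <= t <= l -> `|t - x| < dl -> `|f t - f x| <= e / 2.
  move=> /subspace_continuousP/(_ x); rewrite /= in_itv /= xl => /(_ isT).
  move=> /cvgrPdist_le/(_ _ e20); rewrite near_withinE => /nbhs_ballP[dl /= dl0 h].
  exists dl => // t tl tx; rewrite distrC; apply: h; last by rewrite /= in_itv.
  by rewrite /ball /= distrC.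
have [d1 d10 h1] := aux _ cRe; have [d2 d20 h2] := aux _ cIm.
exists (Num.min d1 d2); first by rewrite lt_min d10.
move=> t tl; rewrite lt_min => /andP[t1 t2].
apply: le_trans (normc_le_abs _) _; rewrite ReD ReN ImD ImN (splitr e).
by rewrite lerD ?h1 ?h2.
Qed.

Lemma L2_step (x y dl : R) : 0 <= x -> y <= l -> 0 < dl -> x + dl <= y ->
  L2 nu (fun t => (step x dl t - step (y - dl) dl t)%:C) /\
  L2norm nu (fun t => (step x dl t - step (y - dl) dl t)%:C) <= Num.sqrt (y - x).
Proof.
move=> x0 yl d0 xy.
have mf : cmeasurable (fun t => (step x dl t - step (y - dl) dl t)%:C).
  split => /=; last exact: measurable_cst.
  by apply: measurable_funB; exact: measurable_step.
have fE t : normc ((step x dl t - step (y - dl) dl t)%:C : R[i]) <= 1 * \1_(`[x, y]%classic) t.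
  rewrite mul1r normc_RtoC indicE; have [txy|txy] := boolP (t \in _).
    have /andP[s1 s2] := step_itv x t d0; have /andP[s3 s4] := step_itv (y - dl) t d0.
    by rewrite /= ler_norml; apply/andP; split; lra.
  move: txy; rewrite notin_setE /= in_itv /= => /negP/nandP[]; rewrite -ltNge => h.
    by rewrite !step_le ?subrr ?normr0//; lra.
  by rewrite !step_ge ?subrr ?normr0//; lra.
have fin : (nu `[x, y]%classic < +oo)%E by rewrite interval_measure_itv ?ltry//; lra.
have [Lf nf] := @L2_bounded _ _ _ nu _ _ 1 (measurable_itv _) fin mf ler01 fE.
split => //; rewrite -(ler_sqr (L2norm_ge0 _ _)) ?nnegrE ?sqrtr_ge0//.
rewrite sqr_sqrtr ?subr_ge0; last lra.
have E : fine (nu `[x, y]%classic) = y - x by rewrite interval_measure_itv//; lra.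
by apply: le_trans nf _; rewrite expr1n mul1r -E; exact: lexx.
Qed.

Lemma L2_bump a (dl : R) : L2 nu (fun t => (bump a dl t)%:C).
Proof.
apply/L2P; split.
  split => /=; last exact: measurable_cst.
  exact: measurable_bump.
have mb : measurable_fun setT (fun t => bump a dl t ^+ 2).
  by apply: measurable_funX; exact: measurable_bump.
under eq_fun do rewrite normc_RtoC real_normK ?num_real//.
apply/integrableP; split; first exact/measurable_EFinP.
under eq_integral do rewrite abse_EFin ger0_norm ?sqr_ge0//.
rewrite ge0_integral_mrestr//; [|exact/measurable_EFinP|by move=> t; rewrite lee_fin sqr_ge0].
have cb : {within `[0, l], continuous (fun t => bump a dl t ^+ 2)}.
  by apply: continuous_subspaceT => t; apply: cvgM; exact: bump_continuous.
have /integrableP[_] := @continuous_compact_integrable R _ `[0, l]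
  (@segment_compact _ _ _) cb.
congr (_ < _)%E; apply: eq_integral => t _.
by rewrite /= ger0_norm// sqr_ge0.
Qed.

(** The weak form of the fundamental theorem of calculus: as the hats shrink, their averages of u
    tend to u x and u y by continuity, while Cauchy-Schwarz bounds the integral of v against the
    cutoff. Test functions have support inside (0, l), hence interior points. *)
Lemma sobolev_hoelder_interior (x y : R) : 0 < x -> x < y -> y < l ->
  normc (u x - u y) <= Num.sqrt (y - x) * L2norm nu v.
Proof.
move=> x0 xy yl; have [Lu Lv weak] := uv.
apply/ler_addgt0Pr => e e0.
have e20 : 0 < e / 2 by rewrite divr_gt0.
have xl : 0 <= x <= l by apply/andP; split; lra.
have yl' : 0 <= y <= l by apply/andP; split; lra.
have [d1 d10 h1] := within_continuous_dist xl e20.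
have [d2 d20 h2] := within_continuous_dist yl' e20.
have [dl d0 [dd1 dd2 dxy]] : exists2 dl : R, 0 < dl & [/\ dl < d1, dl < d2 & x + dl <= y].
  exists (Num.min (Num.min d1 d2) (y - x) / 2).
    by rewrite divr_gt0// !lt_min d10 d20 subr_gt0 xy.
  have m1 : Num.min (Num.min d1 d2) (y - x) <= d1 by rewrite !ge_min lexx.
  have m2 : Num.min (Num.min d1 d2) (y - x) <= d2 by rewrite !ge_min lexx orbT.
  have m3 : Num.min (Num.min d1 d2) (y - x) <= y - x by rewrite ge_min lexx orbT.
  have m0 : 0 < Num.min (Num.min d1 d2) (y - x) by rewrite !lt_min d10 d20 subr_gt0 xy.
  by split; lra.
have [tf dE] := test_function_step x0 yl d0 dxy.
have [Ls ns] := L2_step (ltW x0) (ltW yl) d0 dxy.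
have := weak _ tf; rewrite dE.
have i1 := cintegrableM Lu (L2_bump x dl).
have i2 := cintegrableM Lu (L2_bump (y - dl) dl).
have -> : cintegral nu (fun t => u t * (bump x dl t - bump (y - dl) dl t)%:C) =
    cintegral nu (fun t => u t * (bump x dl t)%:C) -
    cintegral nu (fun t => u t * (bump (y - dl) dl t)%:C).
  have := cintegral_comb (-1) i2 i1; rewrite mulN1r => E; rewrite [X in _ = X]addrC -E.
  by congr cintegral; apply/funext => t; rewrite rmorphB /=; ring.
have A1 : normc (cintegral nu (fun t => u t * (bump x dl t)%:C) - u x) <= e / 2.
  apply: normc_average_le => //; first exact: bump_integrable.
  - by move=> t; exact: bump_ge0.
  - by apply: bump_integral => //; lra.
  by move=> t /(bump_out d0) /andP[ta tb]; apply: h1; [apply/andP; split; lra|];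
    rewrite ger0_norm; lra.
have A2 : normc (cintegral nu (fun t => u t * (bump (y - dl) dl t)%:C) - u y) <= e / 2.
  apply: normc_average_le => //; first exact: bump_integrable.
  - by move=> t; exact: bump_ge0.
  - by apply: bump_integral => //; lra.
  by move=> t /(bump_out d0) /andP[ta tb]; apply: h2; [apply/andP; split; lra|];
    rewrite ler0_norm; lra.
have A3 : normc (cintegral nu (fun t => v t * (step x dl t - step (y - dl) dl t)%:C)) <=
    Num.sqrt (y - x) * L2norm nu v.
  have -> : cintegral nu (fun t => v t * (step x dl t - step (y - dl) dl t)%:C) =
      inner nu v (fun t => (step x dl t - step (y - dl) dl t)%:C).
    by congr cintegral; apply/funext => t; congr (_ * _); exact/esym/conjc_real.
  apply: le_trans (Cauchy_Schwarz Lv Ls) _.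
  by rewrite mulrC ler_wpM2r// L2norm_ge0.
move: (cintegral nu _) (cintegral nu _) (cintegral nu _) A1 A2 A3 => r q p A1 A2 A3 pq.
have -> : u x - u y = (q - u y) - (p - u x) - r by rewrite -(opprK r) -pq; ring.
apply: le_trans (le_normcB _ _) _; rewrite addrC lerD//.
by apply: le_trans (le_normcB _ _) _; rewrite (splitr e) lerD.
Qed.

Lemma sobolev_hoelder (x y : R) : 0 <= x <= l -> 0 <= y <= l ->
  normc (u x - u y) <= Num.sqrt `|x - y| * L2norm nu v.
Proof.
wlog xy : x y / x <= y.
  move=> h xl yl; have [xy|/ltW yx] := leP x y; first exact: h.
  by rewrite normcB_C distrC; exact: h.
move: xy; rewrite le_eqVlt => /predU1P[->|xy] xl yl.
  by rewrite subrr normc0 mulr_ge0 ?sqrtr_ge0 ?L2norm_ge0.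
rewrite ltr0_norm ?subr_lt0// opprB.
apply/ler_addgt0Pr => e e0.
have e20 : 0 < e / 2 by rewrite divr_gt0.
have [d1 d10 h1] := within_continuous_dist xl e20.
have [d2 d20 h2] := within_continuous_dist yl e20.
pose m := Num.min (Num.min d1 d2) (y - x).
have m1 : m <= d1 by rewrite /m !ge_min lexx.
have m2 : m <= d2 by rewrite /m !ge_min lexx orbT.
have m3 : m <= y - x by rewrite /m ge_min lexx orbT.
have m0 : 0 < m by rewrite /m !lt_min d10 d20 subr_gt0 xy.
clearbody m; move: xl yl => /andP[x0 xl] /andP[y0 yl].
(* Moving the points inwards makes them interior; m / 3 with m <= y - x leaves x' < y' and stays
   within the moduli of continuity. *)
pose x' := x + m / 3; pose y' := y - m / 3.
have x'0 : 0 < x' by rewrite /x'; lra.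
have x'y' : x' < y' by rewrite /x' /y'; lra.
have y'l : y' < l by rewrite /y'; lra.
have H := sobolev_hoelder_interior x'0 x'y' y'l.
have H1 : normc (u x' - u x) <= e / 2.
  apply: h1; first by apply/andP; split; lra.
  by rewrite /x' addrAC subrr add0r gtr0_norm; lra.
have H2 : normc (u y' - u y) <= e / 2.
  apply: h2; first by apply/andP; split; lra.
  by rewrite /y' addrAC subrr add0r normrN gtr0_norm; lra.
have -> : u x - u y = (u x' - u y') + ((u y' - u y) - (u x' - u x)) by ring.
apply: le_trans (le_normcD _ _) _; rewrite lerD//.
  apply: le_trans H _; rewrite ler_wpM2r ?L2norm_ge0// ler_wsqrtr//.
  by rewrite /x' /y'; lra.
by apply: le_trans (le_normcB _ _) _; rewrite (splitr e) lerD.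
Qed.

(** By the Hoelder bound |u| is at least [k] on an interval of length m containing x; if k > 0,
    integrating the square over it gives k^2 m <= |u|^2 in norm. *)
Lemma sobolev_pointwise (x m : R) : 0 <= x <= l -> 0 < m <= 1 -> m <= l ->
  Num.sqrt m * normc (u x) <= L2norm nu u + m * L2norm nu v.
Proof.
move=> /[dup] xl' /andP[x0 xl] /andP[m0 m1] ml; have [Lu Lv _] := uv.
(* The interval starts at x unless it would leave the edge, in which case it is pushed back to end
   at l. *)
have [a [a0 ax xam aml]] : exists a, [/\ 0 <= a, a <= x, x <= a + m & a + m <= l].
  have [h|h] := leP x (l - m); first by exists x; split; lra.
  by exists (l - m); split; lra.
set k := normc (u x) - Num.sqrt m * L2norm nu v.
have sm : Num.sqrt m * Num.sqrt m = m by rewrite -expr2 sqr_sqrtr// ltW.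
suff : k * Num.sqrt m <= L2norm nu u.
  rewrite /k mulrBl mulrAC sm (mulrC (normc _)) lerBlDr.
  by move=> h; apply: le_trans h _.
have [k0|k0] := leP k 0.
  by apply: (@le_trans _ _ 0); rewrite ?L2norm_ge0// mulr_le0_ge0// sqrtr_ge0.
rewrite -(@ler_pXn2r _ 2)// ?nnegrE ?L2norm_ge0//; last first.
  by rewrite mulr_ge0 ?sqrtr_ge0//; exact: ltW.
rewrite exprMn sqr_sqrtr ?(ltW m0)// -lee_fin -integral_sqr_normc//.
have am : a <= a + m by lra.
have -> : (k ^+ 2 * m)%:E = (\int[nu]_(t in `[a, (a + m)%R]) (k ^+ 2)%:E)%E.
  rewrite integral_cst//=; have -> : nu `[a, (a + m)]%classic = m%:E.
    by rewrite interval_measure_itv//; congr EFin; ring.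
  by rewrite EFinM.
have mU : measurable_fun setT (fun t => (normc (u t) ^+ 2)%:E).
  by apply/measurable_EFinP/measurable_sqr_normc; case/L2P : Lu.
apply: (@le_trans _ _ (\int[nu]_(t in `[a, (a + m)%R]) (normc (u t) ^+ 2)%:E)%E).
  apply: ge0_le_integral => //.
  - by move=> t _; rewrite lee_fin sqr_ge0.
  - exact: measurable_funTS.
  move=> t /=; rewrite in_itv /= => /andP[at' ta]; rewrite lee_fin.
  have tl : 0 <= t <= l by apply/andP; split; lra.
  rewrite ler_pXn2r ?nnegrE ?normc_ge0//; last exact: ltW.
  rewrite /k lerBlDr.
  have := le_normcD (u t) (u x - u t); rewrite addrC subrK => h; apply: le_trans h _.
  rewrite lerD2l; apply: le_trans (sobolev_hoelder xl' tl) _.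
  rewrite ler_wpM2r ?L2norm_ge0// ler_wsqrtr// ler_norml.
  by apply/andP; split; lra.
apply: ge0_subset_integral => //.
by move=> t _; rewrite lee_fin sqr_ge0.
Qed.

(** The constant is independent of l: the pointwise bound is used at scale m = l on short edges and
    at scale m = 1 on long ones. *)
Lemma sobolev_energy (x y : R) : 0 <= x <= l -> 0 <= y <= l ->
  `|normc (u x) ^+ 2 - normc (u y) ^+ 2| <=
    3 * (L2norm nu u ^+ 2 + L2norm nu v ^+ 2).
Proof.
move=> xl yl; have h := sobolev_hoelder xl yl.
have [nx ny] := (normc_ge0 (u x), normc_ge0 (u y)).
have [U0 V0] := (L2norm_ge0 nu u, L2norm_ge0 nu v).
have [l1|l1] := leP l 1.
  have l01 : 0 < l <= 1 by rewrite l0.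
  have px := sobolev_pointwise xl l01 (lexx l).
  have py := sobolev_pointwise yl l01 (lexx l).
  have h' : `|normc (u x) - normc (u y)| <= Num.sqrt l * L2norm nu v.
    apply: (@le_trans _ _ (normc (u x - u y))).
      rewrite ler_norml; apply/andP; split.
        rewrite lerNl opprB lerBlDr addrC normcB_C.
        by have := le_normcD (u x) (u y - u x); rewrite [u x + _]addrC subrK.
      rewrite lerBlDr addrC.
      by have := le_normcD (u y) (u x - u y); rewrite [u y + _]addrC subrK.
    apply: le_trans h _; rewrite ler_wpM2r// ler_wsqrtr//.
    exact: dist_itv_le.
  exact: energy_arith_short h' px py.
have px := sobolev_pointwise xl (_ : 0 < 1 <= 1) (ltW l1).
have py := sobolev_pointwise yl (_ : 0 < 1 <= 1) (ltW l1).
move: px py; rewrite ltr01 lexx sqrtr1 !mul1r => /(_ isT) px /(_ isT) py.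
exact: energy_arith_long.
Qed.

End hoelder.
End sobolev_edge.

(** * Walks, loop erasure and the path metric *)

Section walks.
Context {R : realType}.
Variable G : metric_graph R.
Implicit Types (v w : vertex G) (s : seq (edge_space G)) (p q : graph_point G).

(** Walks are lists of edges rather than of vertices because the energies to be summed live on
    edges. *)
Fixpoint walk v s w : Prop := if s is e :: s' then
    (src e = v /\ walk (tgt e) s' w) \/ (tgt e = v /\ walk (src e) s' w)
  else v = w.

Lemma walk_cat v s1 s2 w : walk v (s1 ++ s2) w -> exists a, walk a s2 w.
Proof.
elim: s1 v => [|e s1 ih] v /=; first by exists v.
by case=> -[_ /ih].
Qed.

Lemma sum_elen_ge0 s : 0 <= \sum_(e <- s) elen e.
Proof. by apply: sumr_ge0 => e _; exact/ltW/elen_gt0. Qed.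

(** If the first edge e recurs in the already reduced remainder s1 ++ e :: s2, the part up to that
    occurrence can be cut out. *)
Lemma walk_uniq v s w : walk v s w -> exists s',
  [/\ uniq s', walk v s' w & \sum_(e <- s') elen e <= \sum_(e <- s) elen e].
Proof.
elim: s v => [|e s ih] v; first by exists [::].
move=> /= evs; have [a [ea was]] : exists a,
    ((src e = v /\ a = tgt e) \/ (tgt e = v /\ a = src e)) /\ walk a s w.
  by case: evs => -[ev h]; [exists (tgt e)|exists (src e)]; split => //; [left|right].
have [s' [us' ws' ls']] := ih _ was.
have e0 : 0 <= elen e by exact/ltW/elen_gt0.
have [es'|es'] := boolP (e \in s'); last first.
  exists (e :: s'); split; rewrite /= ?es' ?big_cons ?lerD2l//.
  by case: ea => -[h1 h2]; [left|right]; split => //; rewrite -h2.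
case/splitPr: es' us' ws' ls' => s1 s2 us' /walk_cat[b web] ls'.
move: us'; rewrite cat_uniq => /and3P[_ _ ues2].
have l2 : \sum_(i <- e :: s2) elen i <= \sum_(i <- e :: s) elen i.
  rewrite !big_cons lerD2l; apply: le_trans ls'; rewrite big_cat big_cons /=.
  by have := sum_elen_ge0 s1; lra.
have l3 : \sum_(i <- s2) elen i <= \sum_(i <- e :: s) elen i.
  by apply: le_trans l2; rewrite big_cons lerDr.
have us2 : uniq s2 by case/andP: ues2.
(* Both occurrences of e in the same direction: one is kept. In opposite directions: the walk is
   back at its start, and both are dropped. *)
case: ea web => -[<- _] /= [[_ h]|[_ h]].
- by exists (e :: s2); split => //; left.
- by exists s2.
- by exists s2.
- by exists (e :: s2); split => //; right.
Qed.

(* A path reduces to one staying in an edge, or leaving the first edge at an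
   endpoint, following full edges, and entering the last edge at an endpoint. *)
Definition reduced_path p q (l : R) : Prop :=
  [\/ same_point p q /\ 0 <= l,
      exists e x y, [/\ same_point p (e, x), same_point (e, y) q,
        0 <= x <= elen e, 0 <= y <= elen e & `|x - y| <= l]
    | exists e x x' v s w e' y' y, [/\
        [/\ same_point p (e, x), 0 <= x <= elen e, 0 <= x' <= elen e & at_vertex (e, x') v],
        walk v s w,
        [/\ at_vertex (e', y') w, 0 <= y' <= elen e', 0 <= y <= elen e' & same_point (e', y) q]
      & `|x - x'| + \sum_(i <- s) elen i + `|y' - y| <= l]].

Lemma path_length_ge0 p q (l : R) : path_length p q l -> 0 <= l.
Proof. by elim=> // *; rewrite addr_ge0. Qed.


(** A piece of an edge joining two of its end points either stays put or crosses the whole edge, so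
    a walk can absorb it. *)
Lemma walk_along (e : edge_space G) (x x' : R) v0 v s w : at_vertex (e, x) v0 -> at_vertex (e, x') v ->
  walk v s w -> exists2 s', walk v0 s' w &
    \sum_(i <- s') elen i <= `|x - x'| + \sum_(i <- s) elen i.
Proof.
have e0 : 0 <= elen e by exact/ltW/elen_gt0.
rewrite /at_vertex /= => -[[-> <-]|[-> <-]] [[-> <-]|[-> <-]] ws.
- by exists s => //; rewrite lerDr.
- exists (e :: s); first by left.
  by rewrite big_cons sub0r normrN ger0_norm.
- exists (e :: s); first by right.
  by rewrite big_cons subr0 ger0_norm.
- by exists s => //; rewrite lerDr.
Qed.

(** A prepended piece either lies in the edge of the next piece, and they merge by the triangle
    inequality, or meets it at a vertex; then an old initial piece that ends at a vertex is absorbed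
    by [walk_along]. *)
Lemma path_length_reduced p q (l : R) : path_length p q l -> reduced_path p q l.
Proof.
elim=> [{}p {}q pq|{}p e x y {}q {}l pex xe ye pl ih]; first by constructor 1.
case: ih => [[eyq l0]|[e1 [x1 [y1 [h1 h2 h3 h4 h5]]]]|
    [e1 [x1 [x1' [v [s [w [e' [y' [y1 [[h1 h2 h3 h4] h5 [h6 h7 h8 h9] h10]]]]]]]]]]].
- constructor 2; exists e, x, y; split => //.
  by rewrite lerDl.
- case: h1 => [[ee yx]|[v [h6 h7]]].
    subst e1 x1; constructor 2; exists e, x, y1; split => //.
    by apply: le_trans (ler_distD y _ _) _; rewrite lerD2l.
  constructor 3; exists e, x, y, v, [::], v, e1, x1, y1; split => //.
  by rewrite big_nil addr0 lerD2l.
case: h1 => [[ee yx]|[v0 [h11 h12]]].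
  subst e1 x1; constructor 3; exists e, x, x1', v, s, w, e', y', y1; split => //.
  have := ler_distD y x x1'; move: h10; lra.
have [s' ws' ls'] := walk_along h12 h4 h5.
constructor 3; exists e, x, y, v0, s', w, e', y', y1; split => //.
move: h10 ls'; lra.
Qed.

Section walk_bound.
Variables (D : graph_point G -> graph_point G -> R) (M : edge_space G -> R) (al Mtot : R).
Hypotheses (al0 : 0 <= al)
  (MtotP : forall s, uniq s -> \sum_(e <- s) M e <= Mtot)
  (D0 : forall p q, same_point p q -> D p q = 0)
  (DD : forall p q r, D p r <= D p q + D q r)
  (De : forall (e : edge_space G) x y, 0 <= x <= elen e -> 0 <= y <= elen e ->
     D (e, x) (e, y) <= al * `|x - y| + M e).

(** [D] is kept abstract for two uses: |u p - u q| with al > 0, and the variation of |u|^2 with al =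
    0. [M] is an edge energy whose sums over distinct edges are bounded by [Mtot]. *)
Lemma walk_bound v s w p q : walk v s w -> at_vertex p v -> at_vertex q w ->
  D p q <= \sum_(e <- s) (al * elen e + M e).
Proof.
elim: s v p => [|e s ih] v p /=.
  by move=> -> pw qw; rewrite big_nil D0//; right; exists w.
have e0 : 0 <= elen e by exact/ltW/elen_gt0.
have at0 : at_vertex (e, 0) (src e) by left.
have at1 : at_vertex (e, elen e) (tgt e) by right.
have i0 : 0 <= (0 : R) <= elen e by rewrite lexx.
have i1 : 0 <= elen e <= elen e by rewrite lexx e0.
rewrite big_cons => -[[ev ws]|[ev ws]] pv qw.
  apply: le_trans (DD p (e, 0) q) _; rewrite D0 ?add0r; last first.
    by right; exists v; split => //; rewrite -ev.
  apply: le_trans (DD (e, 0) (e, elen e) q) _; rewrite lerD//.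
    by apply: le_trans (De i0 i1) _; rewrite sub0r normrN ger0_norm.
  exact: ih ws at1 qw.
apply: le_trans (DD p (e, elen e) q) _; rewrite D0 ?add0r; last first.
  by right; exists v; split => //; rewrite -ev.
apply: le_trans (DD (e, elen e) (e, 0) q) _; rewrite lerD//.
  by apply: le_trans (De i1 i0) _; rewrite subr0 ger0_norm.
exact: ih ws at0 qw.
Qed.

(* After loop erasure every edge is used at most three times: inside the walk,
   and as first and as last edge. *)
Lemma path_bound p q (l : R) : path_length p q l -> D p q <= al * l + 3 * Mtot.
Proof.
move=> pl; have l0 := path_length_ge0 pl.
have Me e : M e <= Mtot by have := @MtotP [:: e] isT; rewrite big_seq1.
have Mtot0 : 0 <= Mtot by have := @MtotP [::] isT; rewrite big_nil.
case: (path_length_reduced pl) => [[pq _]|[e [x [y [h1 h2 h3 h4 h5]]]]|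
    [e [x [x' [v [s [w [e' [y' [y [[h1 h2 h3 h4] h5 [h6 h7 h8 h9] h10]]]]]]]]]]].
- by rewrite D0// addr_ge0 ?mulr_ge0.
- apply: le_trans (DD p (e, x) q) _; rewrite D0// add0r.
  apply: le_trans (DD (e, x) (e, y) q) _; rewrite (D0 h2) addr0.
  apply: le_trans (De h3 h4) _; rewrite lerD ?ler_wpM2l//.
  by have := Me e; lra.
have [s' [us' ws' ls']] := walk_uniq h5.
apply: le_trans (DD p (e, x) q) _; rewrite D0// add0r.
apply: le_trans (DD (e, x) (e', y) q) _; rewrite (D0 h9) addr0.
apply: le_trans (DD (e, x) (e, x') (e', y)) _.
apply: (@le_trans _ _ (D (e, x) (e, x') + (D (e, x') (e', y') + D (e', y') (e', y)))).
  by rewrite lerD2l; exact: DD.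
have B1 := De h2 h3; have B2 := De h7 h8; have B3 := walk_bound ws' h4 h6.
rewrite big_split /= -mulr_sumr in B3.
have B4 := MtotP us'; have B5 := Me e; have B6 := Me e'.
have : al * (`|x - x'| + \sum_(i <- s') elen i + `|y' - y|) <= al * l.
  by rewrite ler_wpM2l//; apply: le_trans h10; rewrite lerD2r lerD2l.
rewrite !mulrDr; lra.
Qed.

End walk_bound.

Lemma set2_eqP (T : Type) (a b c d : T) : [set a; b] = [set c; d] ->
  (a = c /\ b = d) \/ (a = d /\ b = c).
Proof.
move=> E; have Ha : [set c; d] a by rewrite -E; left.
have Hb : [set c; d] b by rewrite -E; right.
have Hc : [set a; b] c by rewrite E; left.
have Hd : [set a; b] d by rewrite E; right.
case: Ha => /= Ha; case: Hb => /= Hb; case: Hc => /= Hc; case: Hd => /= Hd; subst; by [left|right].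
Qed.

(** Connectedness makes the infimum defining [path_metric] one over a nonempty set, so it is not a
    default value. *)
Lemma path_length_exists p q : points p -> points q -> exists l, path_length p q l.
Proof.
case: p => e x xe; case: q => e' y ye; rewrite /points /= in xe ye.
have e0 (f : edge_space G) : 0 <= elen f by exact/ltW/elen_gt0.
have [s ps ls] := connected_graph (src e) (src e').
have : forall p, at_vertex p (src e) -> exists l, path_length p (e', y) l.
  elim: s (src e) ps ls => [|w s ih] v /=.
    move=> _ -> p pv; exists (`|0 - y| + 0); apply: (@path_cons _ _ _ e') => //.
    - by right; exists (src e'); split => //; left.
    - by rewrite lexx e0.
    - by apply: path_nil; left.
  move=> /andP[/asboolP[f fvw] ps] ls p pv; have vw := set2_eqP fvw.
  case: vw => -[fv fw].
    have fat : at_vertex ((f : edge_space G), elen f) w by right.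
    have [l pl] := ih w ps ls _ fat.
    exists (`|0 - elen f| + l); apply: (@path_cons _ _ _ f _ _ _ _ _ _ _ pl).
    - by right; exists v; split => //; left.
    - by rewrite lexx e0.
    - by rewrite e0 lexx.
  have fat : at_vertex ((f : edge_space G), 0) w by left.
  have [l pl] := ih w ps ls _ fat.
  exists (`|elen f - 0| + l); apply: (@path_cons _ _ _ f _ _ _ _ _ _ _ pl).
  - by right; exists v; split => //; right.
  - by rewrite e0 lexx.
  - by rewrite lexx e0.
move=> /(_ (e, 0)) []; first by left.
move=> l pl; exists (`|x - 0| + l); apply: (@path_cons _ _ _ e _ _ _ _ _ _ _ pl) => //.
  by left.
by rewrite lexx e0.
Qed.

(** For X > 0 the hypothesis says that (X / C)^2 is a lower bound of all path lengths, hence of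
    their infimum. *)
Lemma le_sqrt_path_metric p q (C X : R) : points p -> points q -> 0 <= C ->
  (forall l, path_length p q l -> X <= C * Num.sqrt l) ->
  X <= C * Num.sqrt (path_metric p q).
Proof.
move=> pp pq C0 h; have [l pl] := path_length_exists pp pq.
have [X0|X0] := leP X 0.
  by apply: le_trans X0 _; rewrite mulr_ge0 ?sqrtr_ge0.
have C1 : 0 < C.
  rewrite lt_neqAle C0 andbT; apply/eqP => E.
  by have := h _ pl; rewrite -E mul0r leNgt X0.
have XC : 0 <= X / C by apply: divr_ge0; exact: ltW.
rewrite mulrC -ler_pdivrMr// -(ger0_norm XC) -sqrtr_sqr; apply: ler_wsqrtr.
have ne : [set l | path_length p q l] !=set0 by exists l.
apply: lb_le_inf => // m /= pm; have m0 := path_length_ge0 pm.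
rewrite -[leRHS]sqr_sqrtr// ler_pXn2r ?nnegrE ?sqrtr_ge0//.
by rewrite ler_pdivrMr// mulrC; exact: h.
Qed.

End walks.

(** * Integration over the graph, edge by edge *)

Section graph_integral.
Context {R : realType}.
Variable G : metric_graph R.

Local Notation mu := (@graph_measure R G).
Local Notation count := (@counting (edge_space G) R).

Lemma counting_set1 (e : edge_space G) : count [set e] = 1%E.
Proof.
have f : finite_set [set e] by exact: finite_set1.
by rewrite /counting asboolT// fset_set1 mathcomp.finmap.finmap.cardfs1.
Qed.

Lemma measurable_edge_space (D : set (edge_space G)) (d : measure_display)
  (T : measurableType d) (f : edge_space G -> T) : measurable_fun D f.
Proof. by move=> _ Y _. Qed.

Lemma integral_counting_set1 (F : edge_space G -> \bar R) (e : edge_space G) :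
  (\int[count]_(x in [set e]) F x = F e)%E.
Proof.
rewrite (eq_integral (cst (F e))); last by move=> x /[!inE] ->.
rewrite integral_cst//.
transitivity (F e * 1)%E; last exact: mule1.
by congr (_ * _)%E; exact: counting_set1.
Qed.

Lemma integral_counting_finite (F : edge_space G -> \bar R) (s : seq (edge_space G)) :
  (forall e, 0 <= F e)%E -> uniq s ->
  (\int[count]_(x in \big[setU/set0]_(e <- s) [set e]) F x = \sum_(e <- s) F e)%E.
Proof.
move=> F0 us; rewrite ge0_integral_bigsetU//.
- by apply: eq_bigr => e _; exact: integral_counting_set1.
- by move=> i j _ _ [x [/= -> ->]].
Qed.

Lemma sum_le_integral_counting (F : edge_space G -> \bar R) (s : seq (edge_space G)) :
  (forall e, 0 <= F e)%E -> uniq s ->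
  (\sum_(e <- s) F e <= \int[count]_e F e)%E.
Proof.
move=> F0 us; rewrite -integral_counting_finite//.
apply: ge0_subset_integral => //; exact: measurable_edge_space.
Qed.

(** Edges are exhausted by their [pickle] codes, each shared by at most one edge; the partial
    integrals are then finite sums, which enter the supremum defining the right-hand side. *)
Lemma integral_counting_le_esum (F : edge_space G -> \bar R) :
  (forall e, 0 <= F e)%E -> (\int[count]_e F e <= \esum_(e in setT) F e)%E.
Proof.
move=> F0; pose A n := [set e : edge_space G | pickle e = n].
have -> : [set: edge_space G] = \bigcup_n A n.
  by apply/seteqP; split => // e _; exists (pickle e).
rewrite ge0_integral_bigcup//; last by move=> i j _ _ [e [<- <-]].
apply: lime_le.
  by apply: is_cvg_nneseries => n _ _; exact: integral_ge0.
apply: nearW => N; rewrite -(@ge0_integral_bigsetU _ _ _ count _ A)//;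
  [|exact: iota_uniq|by move=> i j _ _ [e [<- <-]]].
set B := \big[setU/set0]_(_ <- _) _.
have finB : finite_set B.
  rewrite /B; elim/big_ind : _ => [|X Y fX fY|n _]; first exact: finite_set0.
    by rewrite finite_setU.
  apply: (@sub_finite_set _ _ [set x | unpickle n = Some x]) => [e /= <-|].
    by rewrite pickleK.
  case: (unpickle n) => [x|].
    by apply: (sub_finite_set _ (finite_set1 x)) => y [->].
  by apply: (sub_finite_set _ (@finite_set0 (edge_space G))).
have BE : B = \big[setU/set0]_(e <- mathcomp.finmap.finmap.enum_fset
    (fset_set (B : set (edge_space G)))) [set e].
  by rewrite -bigcup_fset (bigcup_imset1 _ id) image_id fset_setK.
rewrite BE integral_counting_finite//; last exact: mathcomp.finmap.finmap.fset_uniq.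
rewrite -fsbig_finite//; apply: esum_ge; exists B => //.
by split => // e _; exists (pickle e).
Qed.

Lemma graph_integral (g : graph_point G -> \bar R) : measurable_fun setT g ->
  (forall p, 0 <= g p)%E ->
  (\int[mu]_p g p = \int[count]_e \int[interval_measure (elen e)]_t g (e, t))%E.
Proof.
move=> mg g0.
have -> : (\int[mu]_p g p = \int[count \x @lebesgue_measure R]_(p in @points R G) g p)%E.
  rewrite (ge0_integral_restricted (m2 := (count \x @lebesgue_measure R)%E) (@measurable_points R G) _ mg g0)//.
rewrite integral_mkcond fubini_tonelli1; last 2 first.
- by apply/(measurable_restrictT _ (@measurable_points R G)); exact: measurable_funTS.
- by move=> p; rewrite patchE; case: ifP.
apply: eq_integral => e _; rewrite /fubini_F ge0_integral_mrestr//; last first.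
  exact: measurable_fun_pair2.
rewrite [RHS]integral_mkcond; apply: eq_integral => t _; rewrite !patchE.
by congr (if _ then _ else _); apply/idP/idP; rewrite !inE /points /= in_itv.
Qed.

Lemma sum_edges_le (g : graph_point G -> \bar R) (s : seq (edge_space G)) :
  measurable_fun setT g -> (forall p, 0 <= g p)%E -> uniq s ->
  (\sum_(e <- s) \int[interval_measure (elen e)]_t g (e, t) <= \int[mu]_p g p)%E.
Proof.
move=> mg g0 us; rewrite graph_integral//; apply: sum_le_integral_counting => // e.
exact: integral_ge0.
Qed.

Lemma cmeasurable_component (u : graph_point G -> R[i]) (e : edge_space G) :
  cmeasurable u -> cmeasurable (fun t => u (e, t)).
Proof. by move=> [u1 u2]; split;
  [exact: (@measurable_fun_pair2 _ _ _ _ _ _ (fun p => Re (u p)) e u1)|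
   exact: (@measurable_fun_pair2 _ _ _ _ _ _ (fun p => Im (u p)) e u2)].
Qed.

Lemma sum_L2norm_le (u : graph_point G -> R[i]) (s : seq (edge_space G)) :
  L2 mu u -> uniq s ->
  \sum_(e <- s) L2norm (interval_measure (elen e)) (fun t => u (e, t)) ^+ 2 <=
  L2norm mu u ^+ 2.
Proof.
move=> Lu us; have [mu' _] := (L2P mu u).1 Lu.
have mg : measurable_fun setT (fun p => (normc (u p) ^+ 2)%:E).
  by apply/measurable_EFinP; exact: measurable_sqr_normc.
have g0 p : (0 <= (normc (u p) ^+ 2)%:E)%E by rewrite lee_fin sqr_ge0.
have Lc e : L2 (interval_measure (elen e)) (fun t => u (e, t)).
  apply/L2P; split; first exact: cmeasurable_component.
  apply/integrableP; split.
    by apply/measurable_EFinP/measurable_sqr_normc/cmeasurable_component.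
  under eq_integral do rewrite abse_EFin ger0_norm ?sqr_ge0//.
  have := sum_edges_le mg g0 (isT : uniq [:: e]); rewrite big_seq1 => h.
  by apply: le_lt_trans h _; rewrite integral_sqr_normc// ltry.
rewrite -lee_fin -integral_sqr_normc// -sumEFin.
under eq_bigr do rewrite -integral_sqr_normc//.
exact: (sum_edges_le mg g0 us).
Qed.

End graph_integral.

(** * Hoelder continuity and boundedness of H^1 functions *)

Section H1_bounds.
Context {R : realType}.
Variable G : metric_graph R.
Variable u : graph_point G -> R[i].
Hypothesis uH1 : H1 u.

(** Adding up edgewise bounds sqrt d * V would lose with the number of edges. Each is first split
    into lam d + V^2 / lam: along a path of length l these sum to at most lam l + 3 N^2 / lam, and
    lam = N / sqrt l balances the two terms. *)
Lemma H1_hoelder : exists2 C : R, 0 <= C & forall p q l, path_length p q l ->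
  normc (u p - u q) <= C * Num.sqrt l.
Proof.
have [Lu [cu su] [u' Lu' uu']] := uH1.
pose N := L2norm (@graph_measure R G) u' + 1.
have N0 : 0 < N by rewrite ltr_wpDl// L2norm_ge0.
exists (4 * N); first by rewrite mulr_ge0// ltW.
move=> p q l pl; have l0 := path_length_ge0 pl.
(* A path of length 0 would need an infinite [lam]; any m > 0 above l serves instead, and m tends to
   0 afterwards. *)
have bound (m : R) : l <= m -> 0 < m -> normc (u p - u q) <= 4 * N * Num.sqrt m.
  move=> lm m0; pose lam := N / Num.sqrt m.
  have sm : 0 < Num.sqrt m by rewrite sqrtr_gt0.
  have lam0 : 0 < lam by rewrite divr_gt0.
  pose M (e : edge_space G) := L2norm (interval_measure (elen e)) (fun t => u' (e, t)) ^+ 2 / lam.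
  have := @path_bound R G (fun p q => normc (u p - u q)) M lam (N ^+ 2 / lam) (ltW lam0).
  move=> H; apply: le_trans (H _ _ _ _ p q l pl) _.
  - move=> s us; rewrite /M -mulr_suml ler_wpM2r ?invr_ge0 ?(ltW lam0)//.
    apply: le_trans (sum_L2norm_le Lu' us) _.
    by rewrite ler_pXn2r ?nnegrE ?L2norm_ge0 ?(ltW N0)// lerDl.
  - by move=> p' q' /su ->; rewrite subrr normc0.
  - move=> p' q' r; have -> : u p' - u r = (u p' - u q') + (u q' - u r) by ring.
    exact: le_normcD.
  - move=> e x y xe ye.
    have [c1 c2] := cu e.
    apply: le_trans (sobolev_hoelder (elen_gt0 e) (uu' e) c1 c2 xe ye) _.
    rewrite /M; set V := L2norm _ _; set r := Num.sqrt _.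
    have -> : `|x - y| = r ^+ 2 by rewrite sqr_sqrtr.
    have E : lam * (lam * r ^+ 2 + V ^+ 2 / lam) = (lam * r) ^+ 2 + V ^+ 2.
      by field; exact: lt0r_neq0.
    rewrite -(ler_pM2l lam0) E.
    have := sqr_ge0 (lam * r - V); have := sqr_ge0 (lam * r + V).
    rewrite mulrA; set a := lam * r; nra.
  have -> : 4 * N * Num.sqrt m = lam * m + 3 * (N ^+ 2 / lam).
    rewrite /lam; have := sqr_sqrtr (ltW m0); move: (Num.sqrt m) sm => r r0 <-.
    by field; rewrite !lt0r_neq0.
  by rewrite lerD2r ler_wpM2l// ltW.
have [l00|l00] := ltP 0 l; first exact: bound.
have -> : l = 0 by apply/eqP; rewrite eq_le l00.
rewrite sqrtr0 mulr0; apply/ler_addgt0Pr => e e0; rewrite add0r.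
have s0 : 0 < e / (4 * N) by rewrite divr_gt0// mulr_gt0.
apply: le_trans (bound ((e / (4 * N)) ^+ 2) _ _) _.
- by apply: le_trans l00 _; rewrite sqr_ge0.
- by rewrite exprn_gt0.
by rewrite sqrtr_sqr gtr0_norm// mulrC divfK// lt0r_neq0// mulr_gt0.
Qed.

(** With weight al = 0 the length of the path disappears: from the fixed point [q0], |u|^2 changes
    by at most three times the total energy bound 3 N, however far p is. *)
Lemma H1_bounded : exists C : R, forall p, points p -> normc (u p) <= C.
Proof.
have [Lu [cu su] [u' Lu' uu']] := uH1.
have [e0 _] := edge_inhabited G.
pose q0 : graph_point G := (e0, 0).
have q0p : points q0 by rewrite /points /= lexx ltW// elen_gt0.
pose N := L2norm (@graph_measure R G) u ^+ 2 + L2norm (@graph_measure R G) u' ^+ 2.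
have N0 : 0 <= N by rewrite addr_ge0 ?sqr_ge0.
(* The summand 1 comes from t <= 1 + t^2, which turns a bound on |u p|^2 into one on |u p|. *)
exists (1 + normc (u q0) ^+ 2 + 9 * N) => p pp.
have [l pl] := path_length_exists pp q0p.
pose M (e : edge_space G) := 3 * (L2norm (interval_measure (elen e)) (fun t => u (e, t)) ^+ 2 +
  L2norm (interval_measure (elen e)) (fun t => u' (e, t)) ^+ 2).
have H := @path_bound R G (fun p q => `|normc (u p) ^+ 2 - normc (u q) ^+ 2|) M 0 (3 * N) (lexx 0).
have : `|normc (u p) ^+ 2 - normc (u q0) ^+ 2| <= 0 * l + 3 * (3 * N).
  apply: H pl.
  - move=> s us; rewrite /M -mulr_sumr ler_wpM2l// big_split /=.
    by rewrite lerD// sum_L2norm_le.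
  - by move=> p' q' /su ->; rewrite subrr normr0.
  - by move=> p' q' r; exact: ler_distD.
  - move=> e x y xe ye; have [c1 c2] := cu e; rewrite mul0r add0r.
    exact: (sobolev_energy (elen_gt0 e) (uu' e) c1 c2 xe ye).
rewrite ler_norml => /andP[_]; have := normc_ge0 (u p).
have := sqr_ge0 (normc (u p) - 1); nra.
Qed.

End H1_bounds.

(** * Averages over short intervals of an edge *)

Lemma le_geometric3 {R : realType} (a b K : R) :
  (forall n, a <= b + K * 3^-1 ^+ n) -> a <= b.
Proof.
move=> h; have [K0|K0] := leP K 0.
  by apply: le_trans (h 0%N) _; rewrite expr0 mulr1 gerDl.
apply/ler_addgt0Pr => e e0; pose n := (Num.truncn (K / e)).+1.
apply: le_trans (h n) _; rewrite lerD2l exprVn ler_pdivrMr ?exprn_gt0//.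
rewrite mulrC -ler_pdivrMr//; apply: (@le_trans _ _ n%:R).
  by apply/ltW; rewrite truncnS_gt.
by rewrite -natrX ler_nat ltnW// ltn_expl.
Qed.

Section averages.
Context {R : realType}.
Variable G : metric_graph R.
Local Notation mu := (@graph_measure R G).
Implicit Types p q : graph_point G.

Definition avg_len p (dl : R) : R := Num.min dl (elen p.1).

(** The averaging interval has to contain p and remain in its edge: it starts at p, or is shifted
    back when it would pass the end. *)
Definition avg_start p (dl : R) : R := Num.min p.2 (elen p.1 - avg_len p dl).

Definition avg_set p (dl : R) : set (graph_point G) :=
  [set p.1] `*` `[avg_start p dl, avg_start p dl + avg_len p dl]%classic.

Definition avg p (dl : R) q : R := (avg_len p dl)^-1 * \1_(avg_set p dl) q.

Variables (p : graph_point G) (dl : R).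
Hypotheses (pp : points p) (dl0 : 0 < dl).

Lemma avg_len_gt0 : 0 < avg_len p dl.
Proof. by rewrite lt_min dl0 elen_gt0. Qed.

Lemma avg_itv : [/\ 0 <= avg_start p dl, avg_start p dl <= p.2,
  p.2 <= avg_start p dl + avg_len p dl & avg_start p dl + avg_len p dl <= elen p.1].
Proof.
have l0 := avg_len_gt0.
have ll : avg_len p dl <= elen p.1 by rewrite ge_min lexx orbT.
move: pp; rewrite /points /= => /andP[p0 pl].
rewrite /avg_start; move: (avg_len p dl) l0 ll => a a0 al.
by have [h|h] := leP p.2 (elen p.1 - a); split; lra.
Qed.

Lemma avg_set_dist q : avg_set p dl q -> [/\ q.1 = p.1, points q & `|p.2 - q.2| <= dl].
Proof.
have [h1 h2 h3 h4] := avg_itv.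
case: q => e t [/= -> ]; rewrite in_itv /= => /andP[t1 t2].
have ld : avg_len p dl <= dl by rewrite ge_min lexx.
split => //; first by rewrite /points /=; apply/andP; split; lra.
by rewrite ler_norml; apply/andP; split; lra.
Qed.

Lemma measurable_avg_set : measurable (avg_set p dl).
Proof. exact: measurableX. Qed.

Lemma graph_measure_avg_set : mu (avg_set p dl) = (avg_len p dl)%:E.
Proof.
have l0 := avg_len_gt0.
have -> : mu (avg_set p dl) = (@counting (edge_space G) R \x @lebesgue_measure R)%E (avg_set p dl).
  rewrite /graph_measure /mrestr setIidl// => q /avg_set_dist[_ ]//.
rewrite product_measure1E//.
transitivity (1 * (avg_len p dl)%:E)%E; last by rewrite mul1e.
congr (_ * _)%E; first exact: counting_set1.
have := @lebesgue_measure_itv R `[avg_start p dl, avg_start p dl + avg_len p dl] => /= ->.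
by rewrite lte_fin ltrDl l0 -EFinD addrAC subrr add0r.
Qed.

Lemma avg_ge0 q : 0 <= avg p dl q.
Proof. by rewrite mulr_ge0 ?invr_ge0 ?(ltW avg_len_gt0)// indicE. Qed.

Lemma avg_neq0 q : avg p dl q != 0 -> avg_set p dl q.
Proof.
rewrite /avg indicE; have [|] := boolP (q \in _); first by rewrite inE.
by rewrite mulr0 eqxx.
Qed.

Lemma measurable_avg : measurable_fun setT (avg p dl).
Proof.
apply: measurable_funM; first exact: measurable_cst.
by apply: measurable_indic; exact: measurable_avg_set.
Qed.

Lemma avg_integrable : mu.-integrable setT (EFin \o avg p dl).
Proof.
rewrite /avg /comp; under eq_fun do rewrite EFinM; apply: integrableZl => //.
apply/integrableP; split.
  by apply/measurable_EFinP; apply: measurable_indic; exact: measurable_avg_set.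
under eq_integral do rewrite abse_EFin ger0_norm ?indicE//.
have := @integral_indic _ _ _ mu _ measurableT _ measurable_avg_set.
rewrite setIT; under eq_integral do rewrite indicE; move=> ->.
by rewrite [X in (X < _)%E]graph_measure_avg_set ltry.
Qed.

Lemma avg_integral : \int[mu]_q avg p dl q = 1.
Proof.
rewrite RintegralZl//.
  rewrite /Rintegral; have := @integral_indic _ _ _ mu _ measurableT _ measurable_avg_set.
  rewrite setIT => ->; rewrite [X in _ * fine X]graph_measure_avg_set/=.
  by rewrite mulVf// lt0r_neq0// avg_len_gt0.
have := integrableZl measurableT (avg_len p dl) avg_integrable.
apply: eq_integrable => // q _; rewrite /avg /= -EFinM mulrA divff ?mul1r//.
by rewrite lt0r_neq0// avg_len_gt0.
Qed.

Lemma L2_avg : L2 mu (fun q => (avg p dl q)%:C).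
Proof.
have fin : (mu (avg_set p dl) < +oo)%E by rewrite graph_measure_avg_set ltry.
have mf : cmeasurable (fun q => (avg p dl q)%:C).
  by split => /=; [exact: measurable_avg|exact: measurable_cst].
have B0 : 0 <= (avg_len p dl)^-1 by rewrite invr_ge0 ltW// avg_len_gt0.
have hB q : normc ((avg p dl q)%:C : R[i]) <= (avg_len p dl)^-1 * \1_(avg_set p dl) q.
  by rewrite normc_RtoC ger0_norm// avg_ge0.
by have [] := @L2_bounded _ _ _ mu (avg_set p dl) (fun q => (avg p dl q)%:C) _
  measurable_avg_set fin mf B0 hB.
Qed.

Lemma inner_avg_le (u : graph_point G -> R[i]) (C : R) : L2 mu u -> 0 <= C ->
  (forall p q l, path_length p q l -> normc (u p - u q) <= C * Num.sqrt l) ->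
  normc (inner mu u (fun q => (avg p dl q)%:C) - u p) <= C * Num.sqrt dl.
Proof.
move=> Lu C0 uC.
have -> : inner mu u (fun q => (avg p dl q)%:C) = cintegral mu (fun q => u q * (avg p dl q)%:C).
  by congr cintegral; apply/funext => q; congr (_ * _); exact: conjc_real.
apply: normc_average_le.
- exact: cintegrableM Lu L2_avg.
- exact: avg_integrable.
- exact: avg_ge0.
- exact: avg_integral.
move=> q /avg_neq0 /avg_set_dist [qe qp qd].
rewrite normcB_C; apply: (@le_trans _ _ (C * Num.sqrt (`|p.2 - q.2| + 0))).
  apply: uC; apply: (@path_cons _ _ _ p.1).
  - by left; case: (p).
  - exact: pp.
  - by rewrite -qe.
  - by apply: path_nil; left; rewrite -qe; case: (q).
by rewrite addr0 ler_wpM2l// ler_wsqrtr.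
Qed.

End averages.

(** * Vectors representing point evaluation of the semigroup *)

Section evaluation.
Context {R : realType}.
Variable G : metric_graph R.
Variables (A : (graph_point G -> R[i]) -> (graph_point G -> R[i]) -> Prop)
  (S : R[i] -> (graph_point G -> R[i]) -> graph_point G -> R[i]).
Local Notation mu := (@graph_measure R G).
Hypotheses (sa : self_adjoint mu A) (gS : generates_semigroup mu A S)
  (dom : domain_in_H1 A).

Lemma sg_H1 (w : R[i]) f : 0 < Re w -> L2 mu f ->
  exists2 u, eqL2 mu (S w f) u & H1 u.
Proof.
by move=> w0 Lf; have [g [Lg Ag _]] := sg_domain gS w0 Lf; exact: dom Ag.
Qed.

Section kernel_vectors.
Variable w : R[i].
Hypothesis w0 : 0 < Re w.

Let w'0 : 0 < Re (conjc w). Proof. by rewrite ReJ. Qed.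

(** By [sg_adjoint], the inner product of f with [v p dl] is the average of S(w) f over the interval
    at p. *)
Let v p (dl : R) := S (conjc w) (fun q => (avg p dl q)%:C).

Let Lv p dl : points p -> 0 < dl -> L2 mu (v p dl).
Proof. by move=> pp d0; apply: (sg_L2 gS w'0); exact: L2_avg. Qed.

Let inner_v f u p dl : L2 mu f -> eqL2 mu (S w f) u -> H1 u -> points p -> 0 < dl ->
  inner mu f (v p dl) = inner mu u (fun q => (avg p dl q)%:C).
Proof.
move=> Lf fu [Lu _ _] pp d0; have La := L2_avg pp d0.
rewrite /v -(sg_adjoint sa gS w0 Lf La).
by apply: eqL2_innerl => //; exact: (sg_L2 gS w0 Lf).
Qed.

(** For fixed f these averages are bounded by the supremum of an H^1 representative plus its Hoelder
    constant, since dl <= 1; uniform boundedness makes the bound independent of f. *)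
Let v_bounded : exists M : R, forall p dl, points p -> 0 < dl -> dl <= 1 ->
  L2norm mu (v p dl) <= M.
Proof.
pose I := {x : graph_point G * R | points x.1 /\ 0 < x.2 <= 1}.
pose vI (i : I) := v (sval i).1 (sval i).2.
have [|f Lf|M HM] := @weakly_bounded_bounded _ _ _ mu I vI.
- by move=> i; have [pp /andP[d0 _]] := svalP i; exact: Lv.
- have [u fu uH1] := sg_H1 w0 Lf; have [Lu _ _] := uH1.
  have [C1 uC1] := H1_bounded uH1; have [C2 C20 uC2] := H1_hoelder uH1.
  exists (C1 + C2) => i; rewrite /vI.
  move: (svalP i); case: (sval i) => p dl [pp /andP[d0 d1]].
  change (normc (inner mu f (v p dl)) <= C1 + C2).
  rewrite (inner_v Lf fu uH1 pp d0).
  have := inner_avg_le pp d0 Lu C20 uC2.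
  have := le_normcD (inner mu u (fun q => (avg p dl q)%:C) - u p) (u p).
  rewrite subrK => h1 h2; apply: le_trans h1 _; rewrite addrC lerD ?uC1//.
  apply: le_trans h2 _; rewrite ler_piMr// -[leRHS]sqrtr1; exact: ler_wsqrtr.
exists M => p dl pp d0 d1.
exact: (HM (exist _ (p, dl) (conj pp (introT andP (conj d0 d1))))).
Qed.

(** Uniform boundedness for differences divided by their expected size. The case p = q gives a
    Cauchy sequence as dl shrinks, the case dl = dl' Hoelder continuity in p. *)
Let v_hoelder : exists2 M : R, 0 <= M & forall p q dl dl' l, points p -> points q ->
  0 < dl -> 0 < dl' -> path_length p q l ->
  L2norm mu (fun x => v p dl x - v q dl' x) <=
    M * (Num.sqrt l + Num.sqrt dl + Num.sqrt dl').
Proof.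
pose I := {x : graph_point G * graph_point G * R * R * R |
  [/\ points x.1.1.1.1, points x.1.1.1.2, 0 < x.1.1.2, 0 < x.1.2 &
      path_length x.1.1.1.1 x.1.1.1.2 x.2]}.
pose r (l dl dl' : R) := Num.sqrt l + Num.sqrt dl + Num.sqrt dl'.
have r0 l dl dl' : 0 < dl -> 0 < r l dl dl'.
  by move=> d0; rewrite /r ltr_wpDr ?sqrtr_ge0// ltr_wpDl ?sqrtr_ge0// sqrtr_gt0.
pose vI (i : I) : graph_point G -> R[i] :=
  let: (p, q, dl, dl', l) := sval i in
  fun x => ((r l dl dl')^-1)%:C * (v p dl x - v q dl' x).
have [|f Lf|M HM] := @weakly_bounded_bounded _ _ _ mu I vI.
- move=> i; rewrite /vI.
  move: (svalP i); case: (sval i) => [[[[p q] dl] dl'] l] /= [pp qp d0 d'0 _].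
  by apply: L2Z; apply: L2B; exact: Lv.
- have [u fu uH1] := sg_H1 w0 Lf; have [Lu _ _] := uH1.
  have [C C0 uC] := H1_hoelder uH1.
  exists C => i; rewrite /vI.
  move: (svalP i); case: (sval i) => [[[[p q] dl] dl'] l] [pp qp d0 d'0 pl].
  rewrite /= in pp qp d0 d'0 pl.
  change (normc (inner mu f (fun x => ((r l dl dl')^-1)%:C * (v p dl x - v q dl' x))) <= C).
  have L1 := Lv pp d0; have L2' := Lv qp d'0.
  rewrite innerZr//; last exact: L2B.
  rewrite conjc_real normcM normc_RtoC gtr0_norm ?invr_gt0 ?r0// mulrC.
  rewrite ler_pdivrMr ?r0// innerBr// (inner_v Lf fu uH1 pp d0) (inner_v Lf fu uH1 qp d'0).
  have := inner_avg_le pp d0 Lu C0 uC; have := inner_avg_le qp d'0 Lu C0 uC.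
  have := uC _ _ _ pl.
  move: (inner mu u _) (inner mu u _) => a b h1 h2 h3.
  have -> : a - b = ((a - u p) + (u p - u q)) - (b - u q) by ring.
  apply: le_trans (le_normcB _ _) _; rewrite /r !mulrDr lerD//.
  by apply: le_trans (le_normcD _ _) _; rewrite addrC lerD.
have M'0 : 0 <= Num.max M 0 by rewrite le_max lexx orbT.
exists (Num.max M 0) => // p q dl dl' l pp qp d0 d'0 pl.
have L1 := Lv pp d0; have L2' := Lv qp d'0.
have := HM (exist _ (p, q, dl, dl', l) (And5 pp qp d0 d'0 pl)).
rewrite /vI /= L2normZ; last exact: L2B.
rewrite normc_RtoC gtr0_norm ?invr_gt0 ?r0// mulrC ler_pdivrMr ?r0// => h.
apply: le_trans h _; apply: ler_wpM2r; first exact/ltW/r0.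
by rewrite le_max lexx.
Qed.

Lemma evaluation_vectors : exists (k : graph_point G -> graph_point G -> R[i]) (M : R),
  [/\ 0 <= M,
      forall p, L2 mu (k p) /\ L2norm mu (k p) <= M,
      forall p, ~ points p -> k p = fun=> 0,
      forall p q, points p -> points q ->
        L2norm mu (fun x => k p x - k q x) <= M * Num.sqrt (path_metric p q)
    & forall f u, L2 mu f -> eqL2 mu (S w f) u -> H1 u ->
        forall p, points p -> inner mu f (k p) = u p].
Proof.
have [M1 HM1] := v_bounded; have [M2 M20 HM2] := v_hoelder.
(* Widths 9^-n have square roots 3^-n, the rate required by [L2_complete]; consecutive vectors
   differ by at most 4/3 M2 3^-n, whence its constant 2 M2 and the resulting 3 M2. *)
pose dn n : R := (3^-1 ^+ n) ^+ 2.
have t0 n : 0 < 3^-1 ^+ n :> R by rewrite exprn_gt0// invr_gt0.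
have dn0 n : 0 < dn n by rewrite exprn_gt0.
have sdn n : Num.sqrt (dn n) = 3^-1 ^+ n by rewrite sqrtr_sqr gtr0_norm.
have lim p : exists K, points p -> L2 mu K /\
    forall n, L2norm mu (fun t => K t - v p (dn n) t) <= 3 * M2 * 3^-1 ^+ n.
  have [pp|npp] := pselect (points p); last by exists (fun=> 0) => /npp.
  have [||n|K LK HK] := @L2_complete _ _ _ mu (fun n => v p (dn n)) (2 * M2).
  - by rewrite mulr_ge0.
  - by move=> n; exact: Lv.
  - have pl : path_length p p 0 by apply: path_nil; left.
    apply: le_trans (HM2 _ _ _ _ _ pp pp (dn0 n.+1) (dn0 n) pl) _.
    rewrite !sdn sqrtr0 add0r exprS; have := mulr_ge0 M20 (ltW (t0 n)); lra.
  exists K => _; split => // n; apply: le_trans (HK n) _.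
  by rewrite ler_wpM2r ?(ltW (t0 n))//; lra.
(* Pairs that represent no point of the graph get the zero vector, so that the kernel will vanish
   there. *)
pose k p : graph_point G -> R[i] := if pselect (points p) then projT1 (cid (lim p)) else fun=> 0.
have kP p : points p -> L2 mu (k p) /\
    forall n, L2norm mu (fun t => k p t - v p (dn n) t) <= 3 * M2 * 3^-1 ^+ n.
  move=> pp; have -> : k p = projT1 (cid (lim p)) by rewrite /k; case: pselect.
  exact: (projT2 (cid (lim p)) pp).
have kN p : ~ points p -> k p = fun=> 0 by move=> np; rewrite /k; case: pselect.
have L0 : L2norm mu (fun=> 0) = 0 by exact: L2norm0.
exists k, (Num.max M2 (Num.max (3 * M2 + M1) 0)).
split.
- by rewrite !le_max lexx !orbT.
- move=> p; have [pp|np] := pselect (points p); last first.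
    rewrite kN//; split; first exact: L20.
    by rewrite L0 !le_max lexx !orbT.
  have [Lk /(_ 0%N)] := kP p pp; rewrite expr0 mulr1 => hk; split => //.
  have d01 : dn 0%N <= 1 by rewrite /dn expr0 expr1n.
  have := L2normD (L2B Lk (Lv pp (dn0 0%N))) (Lv pp (dn0 0%N)).
  under eq_fun do rewrite subrK; move=> h; apply: le_trans h _.
  by rewrite !le_max; apply/orP; right; apply/orP; left; rewrite lerD// HM1.
- exact: kN.
- move=> p q pp qp; apply: le_sqrt_path_metric => //.
    by rewrite !le_max lexx !orbT.
  move=> l pl; have l0 := sqrtr_ge0 l.
  apply: (@le_trans _ _ (M2 * Num.sqrt l)); last by rewrite ler_wpM2r// le_max lexx.
  (* Replacing [k p] and [k q] by averaged vectors costs 3 M2 3^-n each, and the two widths in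
     [v_hoelder] cost M2 3^-n each. *)
  apply: (@le_geometric3 _ _ _ (8 * M2)) => n.
  have [Lp hp] := kP p pp; have [Lq hq] := kP q qp.
  have Lvp := Lv pp (dn0 n); have Lvq := Lv qp (dn0 n).
  apply: le_trans (L2norm_dist_trans Lp Lvp Lq) _.
  have := L2norm_dist_trans Lvp Lvq Lq.
  have := HM2 _ _ _ _ _ pp qp (dn0 n) (dn0 n) pl.
  rewrite !sdn [X in _ -> _ <= _ + X -> _]L2normBC.
  have := hp n; have := hq n.
  set a := L2norm _ _; set b := L2norm _ _; set c := L2norm _ _; set d := L2norm _ _.
  move: (3^-1 ^+ n) (Num.sqrt l) => t s; rewrite !mulrDr; lra.
move=> f u Lf fu uH1 p pp; have [Lu _ _] := uH1.
have [C C0 uC] := H1_hoelder uH1; have [Lk hk] := kP p pp.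
apply/eqP; rewrite -subr_eq0; apply/eqP/normc_eq0P.
apply: (@le_geometric3 _ _ _ (L2norm mu f * (3 * M2) + C)) => n; rewrite add0r.
have Lvp := Lv pp (dn0 n).
have := inner_avg_le pp (dn0 n) Lu C0 uC.
rewrite -(inner_v Lf fu uH1 pp (dn0 n)) sdn => h.
have -> : inner mu f (k p) - u p = inner mu f (fun t => k p t - v p (dn n) t) +
    (inner mu f (v p (dn n)) - u p) by rewrite innerBr//; ring.
apply: le_trans (le_normcD _ _) _; rewrite mulrDl lerD//.
apply: le_trans (Cauchy_Schwarz Lf (L2B Lk Lvp)) _.
by rewrite -mulrA ler_wpM2l// L2norm_ge0.
Qed.

End kernel_vectors.
End evaluation.

(** * Joint measurability of a Hoelder kernel *)

(** Every preimage is a countable union of fibres, whatever [F] is. *)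
Lemma measurable_fun_countable_fibers d d' (X : measurableType d)
    (Y : measurableType d') (I : countType) (phi : X -> I) (F : I -> Y) :
  (forall i, measurable (phi @^-1` [set i])) -> measurable_fun setT (F \o phi).
Proof.
move=> mphi _ B mB; rewrite setTI.
have -> : (F \o phi) @^-1` B = \bigcup_n (if unpickle n is Some i then
    if `[< B (F i) >] then phi @^-1` [set i] else set0 else set0).
  apply/seteqP; split => x /=.
    by move=> Bx; exists (pickle (phi x)) => //; rewrite pickleK asboolT.
  by case=> n _; case: (unpickle n) => // i; case: asboolP => // Bi /= ->.
apply: bigcupT_measurable => n; case: (unpickle n) => // i.
by case: asboolP.
Qed.

Section discretisation.
Context {R : realType}.
Implicit Types t : R.

Definition grid (n : nat) (k : int) : R := k%:~R / n.+1%:R.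

Definition grid_index (n : nat) t : int := Num.floor (n.+1%:R * t).

Lemma grid_le n t : grid n (grid_index n t) <= t.
Proof.
by rewrite /grid ler_pdivrMr// mulrC; have /andP[] := floor_itv (n.+1%:R * t).
Qed.

Lemma grid_gt n t : t < grid n (grid_index n t) + n.+1%:R^-1.
Proof.
rewrite /grid -[X in _ + X]mul1r -mulrDl ltr_pdivlMr// mulrC.
by have /andP[_] := floor_itv (n.+1%:R * t); rewrite intrD.
Qed.

Lemma grid_ge0 n t : 0 <= t -> 0 <= grid n (grid_index n t).
Proof. by move=> t0; rewrite divr_ge0// ler0z floor_ge0 mulr_ge0. Qed.

Lemma measurable_grid_index n (k : int) : measurable [set t | grid_index n t = k].
Proof.
have -> : [set t | grid_index n t = k] =
    `[k%:~R / n.+1%:R, (k + 1)%:~R / n.+1%:R[%classic.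
  apply/seteqP; split => t /=; rewrite in_itv /= ler_pdivrMr// ltr_pdivlMr// mulrC.
    by move=> <-; exact: floor_itv.
  by move=> /floor_def.
exact: measurable_itv.
Qed.

End discretisation.

Section joint_measurability.
Context {R : realType}.
Variable G : metric_graph R.
Variables (K : graph_point G -> graph_point G -> R[i]) (C : R).
Hypotheses (C0 : 0 <= C)
  (K0 : forall p q, ~ (points p /\ points q) -> K p q = 0)
  (KC : forall x x' y y', points x -> points x' -> points y -> points y' ->
    normc (K x y - K x' y') <=
      C * (Num.sqrt (path_metric x x') + Num.sqrt (path_metric y y'))).

(** Rounding the coordinate down moves a point of the graph by at most 1 / (n + 1) within its edge.
    The rounded kernels depend on countably many grid indices and converge to K by the Hoelder
    bound. *)
Let disc n (p : graph_point G) : graph_point G := (p.1, grid n (grid_index n p.2)).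

Lemma path_metric_le (p q : graph_point G) l : path_length p q l -> path_metric p q <= l.
Proof.
move=> pl; apply: ge_inf => //; exists 0 => m /= pm; exact: path_length_ge0 pm.
Qed.

Let disc_points n p : points p -> points (disc n p).
Proof.
move=> /andP[p0 pl]; apply/andP; split => /=; first exact: grid_ge0.
exact: le_trans (grid_le _ _) pl.
Qed.

Let disc_dist n p : points p -> path_metric p (disc n p) <= n.+1%:R^-1.
Proof.
move=> pp; apply: (@le_trans _ _ (`|p.2 - (disc n p).2| + 0)).
  apply: path_metric_le; apply: (@path_cons _ _ _ p.1).
  - by left; case: (p).
  - exact: pp.
  - exact: (disc_points n pp).
  - by apply: path_nil; left.
have := grid_le n p.2; have := grid_gt n p.2.
rewrite addr0 -[(disc n p).2]/(grid n (grid_index n p.2)).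
by move: (grid n _) (_^-1) => g r h1 h2; rewrite ger0_norm; lra.
Qed.

Let sqrt_inv_cvg : (fun n => C * (Num.sqrt (n.+1%:R^-1 : R) + Num.sqrt (n.+1%:R^-1))) @ \oo --> (0 : R).
Proof.
have h : (fun n => Num.sqrt (n.+1%:R^-1 : R)) @ \oo --> (0 : R).
  have := @cvg_harmonic R; rewrite -[X in _ --> X -> _]/(0 : R) => c.
  by rewrite -[X in _ --> X]sqrtr0; apply: cvg_comp c _; exact: sqrt_continuous.
rewrite -[X in _ --> X](mulr0 C); apply: cvgM; first exact: cvg_cst.
by rewrite -[X in _ --> X](addr0 0); exact: cvgD.
Qed.

Let fiber n (x : graph_point G * graph_point G) :=
  ((x.1.1 : edge_space G, grid_index n x.1.2), (x.2.1 : edge_space G, grid_index n x.2.2)).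

Let measurable_fiber n i : measurable (fiber n @^-1` [set i]).
Proof.
case: i => [[e a] [e' b]].
have -> : fiber n @^-1` [set (e, a, (e', b))] =
    ([set e] `*` [set t | grid_index n t = a]) `*` ([set e'] `*` [set t | grid_index n t = b]).
  apply/seteqP; split => [[[e1 t1] [e2 t2]] /= [-> <- -> <-]//|].
  by case=> [[e1 t1] [e2 t2]] /= [[-> <-] [-> <-]].
by apply: measurableX; apply: measurableX => //; exact: measurable_grid_index.
Qed.

(** [part] stands for [Re] and [Im], which are treated together. *)
Let real_part_measurable (part : R[i] -> R) : (forall x, `|part x| <= normc x) ->
  (forall x y, part (x - y) = part x - part y) -> part 0 = 0 ->
  measurable_fun setT (fun x : graph_point G * graph_point G => part (K x.1 x.2)).
Proof.
move=> part_le partB part0.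
pose D := @points R G `*` @points R G.
have mD : measurable D by apply: measurableX; exact: measurable_points.
(* Rounding down can bring a coordinate beyond the end of the edge back into it; the indicator
   restores the value 0 there. *)
pose h n (x : graph_point G * graph_point G) : R := part (K (disc n x.1) (disc n x.2)) * \1_D x.
have mh n : measurable_fun setT (h n).
  apply: measurable_funM; last exact: measurable_indic.
  pose F (i : (edge_space G * int) * (edge_space G * int)) : R :=
    part (K (i.1.1, grid n i.1.2) (i.2.1, grid n i.2.2)).
  exact: (@measurable_fun_countable_fibers _ _ _ _ _ (fiber n) F (measurable_fiber n)).
apply: (@measurable_fun_cvg _ _ _ setT h) => // -[p q] _.
have [[pp qp]|npq] := pselect (points p /\ points q); last first.
  rewrite /= K0// part0 (_ : h ^~ (p, q) = fun=> 0); first exact: cvg_cst.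
  apply/funext => n; rewrite /h indicE memNset ?mulr0//.
have hE n : h n (p, q) = part (K (disc n p) (disc n q)).
  by rewrite /h indicE mem_set ?mulr1.
apply/cvgrPdist_le => e e0; have := sqrt_inv_cvg => /cvgrPdist_le/(_ _ e0).
apply: filterS => n; rewrite sub0r normrN => hn.
rewrite hE /= -partB; apply: le_trans (part_le _) _.
have := KC pp (disc_points n pp) qp (disc_points n qp) => h1; apply: le_trans h1 _.
apply: le_trans hn; apply: le_trans (ler_norm _).
by rewrite ler_wpM2l// lerD// ler_wsqrtr// disc_dist.
Qed.

Lemma joint_cmeasurable : cmeasurable (fun x : graph_point G * graph_point G => K x.1 x.2).
Proof.
split; apply: real_part_measurable => //.
- exact: abs_Re_le.
- by move=> x y; rewrite ReD ReN.
- exact: abs_Im_le.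
- by move=> x y; rewrite ImD ImN.
Qed.

End joint_measurability.

(** * Bessel's inequality *)

Section orthonormal.
Context {d : measure_display} {T : measurableType d} {R : realType}.
Variable mu : {measure set T -> \bar R}.

(** Subtracting the component of f along [b i] lowers the squared norm by |c|^2 and leaves the other
    coefficients unchanged. *)
Lemma Bessel (I : eqType) (b : I -> T -> R[i]) (s : seq I) (f : T -> R[i]) :
  (forall i, L2 mu (b i)) -> (forall i j, inner mu (b i) (b j) = (i == j)%:R) ->
  uniq s -> L2 mu f ->
  \sum_(i <- s) normc (inner mu f (b i)) ^+ 2 <= L2norm mu f ^+ 2.
Proof.
move=> Lb ob; elim: s f => [|i s ih] f us Lf; first by rewrite big_nil sqr_ge0.
move: us => /= /andP[ins us].
set c := inner mu f (b i).
have Lcb := L2Z c (Lb i); have Lf' := L2B Lf Lcb.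
have E1 : L2norm mu (fun x => f x - c * b i x) ^+ 2 = L2norm mu f ^+ 2 - normc c ^+ 2.
  apply: (@complexI R); rewrite -inner_L2norm innerBl// !innerBr// !innerZl//.
  rewrite !innerZr// ob eqxx (inner_conj Lf (Lb i)) -/c inner_L2norm mulr1.
  have -> (a e : R) : (a - e)%:C = a%:C - e%:C :> R[i] by rewrite rmorphB.
  rewrite -mul_conjc; ring.
have E2 j : j \in s -> inner mu (fun x => f x - c * b i x) (b j) = inner mu f (b j).
  move=> js; rewrite innerBl// innerZl// ob (_ : (i == j) = false) ?mulr0 ?subr0//.
  by apply/eqP => ij; move: ins; rewrite ij js.
have E3 : \sum_(j <- s) normc (inner mu f (b j)) ^+ 2 =
    \sum_(j <- s) normc (inner mu (fun x => f x - c * b i x) (b j)) ^+ 2.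
  by rewrite big_seq [RHS]big_seq; apply: eq_bigr => j js; rewrite E2.
by rewrite big_cons E3 -lerBrDl; have := ih _ us Lf'; rewrite E1.
Qed.

Lemma L2_eqL2 (f g : T -> R[i]) : cmeasurable f -> L2 mu g -> eqL2 mu f g -> L2 mu f.
Proof.
move=> mf /L2P[mg ig] fg; apply/L2P; split => //; apply/integrableP; split.
  exact/measurable_EFinP/measurable_sqr_normc.
have /integrableP[_] := ig; congr (_ < _)%E.
apply: ae_eq_integral => //.
- by apply: measurableT_comp => //; exact/measurable_EFinP/measurable_sqr_normc.
- by apply: measurableT_comp => //; exact/measurable_EFinP/measurable_sqr_normc.
by apply: filterS fg => x /= h _; rewrite h.
Qed.

End orthonormal.

(** * The integral kernel and the trace of the semigroup *)

Section semigroup_kernel.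
Context {R : realType}.
Variable G : metric_graph R.
Variables (A : (graph_point G -> R[i]) -> (graph_point G -> R[i]) -> Prop)
  (S : R[i] -> (graph_point G -> R[i]) -> graph_point G -> R[i]).
Local Notation mu := (@graph_measure R G).
Hypotheses (sa : self_adjoint mu A) (gS : generates_semigroup mu A S)
  (dom : domain_in_H1 A).

Lemma ae_points (P : graph_point G -> Prop) :
  (forall p, points p -> P p) -> {ae mu, forall p, P p}.
Proof.
move=> hP; exists (~` @points R G); split.
- by apply: measurableC; exact: measurable_points.
- by rewrite /graph_measure /mrestr /= setICl measure0.
- by move=> p np /hP.
Qed.

Lemma semigroup_kernel (z : R[i]) : 0 < Re z ->
  exists K : graph_point G -> graph_point G -> R[i],
    [/\ integral_operator mu (S z) K, Linfty_kernel mu K & jointly_hoelder_half K].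
Proof.
move=> z0; pose w : R[i] := (2^-1)%:C * z.
have w0 : 0 < Re w by rewrite ReM /= mul0r subr0 mulr_gt0.
have w'0 : 0 < Re (conjc w) by rewrite ReJ.
have ww : w + w = z.
  by apply: complex_ext; rewrite ?(ReD, ImD, ReM, ImM) /=; field.
have [k [M [M0 kM k0 kC kE]]] := evaluation_vectors sa gS dom w0.
have [k' [M' [M'0 k'M k'0 k'C k'E]]] := evaluation_vectors sa gS dom w'0.
(* (S(z) f)(p) = <S(w) f, k_p> = <f, S(conj w) k_p>, so the kernel is the conjugate of (S(conj w)
   k_p)(q) = <k_p, k'_q>. *)
pose K p q := inner mu (k' q) (k p).
have Lk p := (kM p).1; have Lk' p := (k'M p).1.
have K0 p q : ~ (points p /\ points q) -> K p q = 0.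
  move=> npq; rewrite /K; have [pp|pp] := pselect (points p); last first.
    by rewrite k0// inner0r.
  have [qp|qp] := pselect (points q); first by case: npq.
  by rewrite k'0// inner0l.
have KC x x' y y' : points x -> points x' -> points y -> points y' ->
    normc (K x y - K x' y') <=
      (M * M') * (Num.sqrt (path_metric x x') + Num.sqrt (path_metric y y')).
  move=> xp x'p yp y'p; rewrite /K.
  have -> : inner mu (k' y) (k x) - inner mu (k' y') (k x') =
      inner mu (k' y') (fun t => k x t - k x' t) + inner mu (fun t => k' y t - k' y' t) (k x).
    by rewrite innerBr// innerBl//; ring.
  apply: le_trans (le_normcD _ _) _; rewrite mulrDr lerD//.
    apply: le_trans (Cauchy_Schwarz (Lk' y') (L2B (Lk x) (Lk x'))) _.
    rewrite (mulrC M) -mulrA ler_pM ?L2norm_ge0//; first exact: (k'M y').2.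
    exact: kC.
  apply: le_trans (Cauchy_Schwarz (L2B (Lk' y) (Lk' y')) (Lk x)) _.
  rewrite -mulrA mulrC ler_pM ?L2norm_ge0//; first exact: (kM x).2.
  exact: k'C.
have MM0 : 0 <= M * M' by rewrite mulr_ge0.
have mK := joint_cmeasurable MM0 K0 KC.
exists K; split.
- split; first exact: mK.
  move=> f Lf.
  have Lwf := sg_L2 gS w0 Lf; have Lwwf := sg_L2 gS w0 Lwf.
  have [u wu uH1] := sg_H1 gS dom w0 Lwf.
  have := sg_semigroup gS w0 w0 Lf; rewrite ww => zww.
  apply: filterS3 (zww) (wu) (ae_points (fun p pp => pp)) => p zp up pp.
  have [h wh hH1] := sg_H1 gS dom w'0 (Lk p).
  have [Lh _ _] := hH1.
  (* This places K p in L^2: its conjugate agrees with the H^1 representative of S(conj w) k_p at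
     every point of the graph. *)
  have Kh : eqL2 mu (fun q => conjc (K p q)) h.
    apply: ae_points => q qp _.
    by rewrite /K -inner_conj// (k'E _ _ (Lk p) wh hH1).
  have mKp : cmeasurable (fun q => conjc (K p q)).
    apply: cmeasurable_conj; case: mK => mK1 mK2.
    split; [exact: (@measurable_fun_pair2 _ _ _ _ _ _ (fun x => Re (K x.1 x.2)) p mK1)|
            exact: (@measurable_fun_pair2 _ _ _ _ _ _ (fun x => Im (K x.1 x.2)) p mK2)].
  have LK : L2 mu (fun q => conjc (K p q)) by apply: L2_eqL2 Lh Kh; exact: mKp.
  have Kf : (fun q => K p q * f q) = (fun q => f q * conjc (conjc (K p q))).
    by apply/funext => q; rewrite conjcK mulrC.
  rewrite Kf; split; first exact: cintegrable_inner.
  rewrite (zp I) (up I) -(kE _ _ Lwf wu uH1 p pp).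
  rewrite (sg_adjoint sa gS w0 Lf (Lk p)).
  change (inner mu f (S (conjc w) (k p)) = inner mu f (fun q => conjc (K p q))).
  apply: eqL2_innerr => //; first exact: (sg_L2 gS w'0 (Lk p)).
  by apply: filterS2 wh Kh => q /= h1 h2 _; rewrite h1// h2.
- split; first exact: mK.
  (* The norm of exponent infinity is an essential supremum only for a nonzero measure, and a
     default value otherwise. *)
  rewrite unlock; case: ifPn => _; last by rewrite ltry.
  apply: (@le_lt_trans _ _ (M' * M)%:E); last exact: ltry.
  apply/ess_supP; apply: nearW => -[p q] /=.
  rewrite ger0_norm ?normc_ge0// lee_fin.
  apply: le_trans (Cauchy_Schwarz (Lk' q) (Lk p)) _.
  by rewrite ler_pM ?L2norm_ge0//; [exact: (k'M q).2|exact: (kM p).2].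
(* The constant has to be positive, while M * M' may be 0. *)
exists (M * M' + 1); first by rewrite ltr_wpDl.
move=> x x' y y' xp x'p yp y'p; apply: le_trans (KC _ _ _ _ xp x'p yp y'p) _.
by rewrite ler_wpM2r ?addr_ge0 ?sqrtr_ge0// lerDl.
Qed.

Lemma graph_measure_finite : finite_total_volume G -> (mu setT < +oo)%E.
Proof.
move=> vol; apply: le_lt_trans vol.
have -> : mu setT = (\int[mu]_p (cst 1 p))%E by rewrite integral_cst// mul1e.
rewrite graph_integral//.
apply: le_trans (integral_counting_le_esum _) _.
  by move=> e; exact: integral_ge0.
apply: le_esum => e _; rewrite integral_cst// mul1e.
by have h := interval_measure_setT (elen_gt0 e); rewrite [leLHS]h.
Qed.

(** S(Re z)^2 = S(2 Re z) = S(conj z + z) = S(conj z) S(z), and S(conj z) is the adjoint of S(z).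
    Positivity holds because S(Re z) is the square of the symmetric operator S(Re z / 2). *)
Lemma semigroup_abs (z : R[i]) : 0 < Re z -> abs_operator mu (S z) (S (Re z)%:C).
Proof.
move=> z0; have r0 : 0 < Re (Re z)%:C by [].
have h0 : 0 < Re (Re z / 2)%:C by rewrite /= divr_gt0.
have hh : (Re z / 2)%:C + (Re z / 2)%:C = (Re z)%:C :> R[i].
  by apply: complex_ext; rewrite ?(ReD, ImD) /=; field.
have z'0 : 0 < Re (conjc z) by rewrite ReJ.
split; first exact: (sg_bounded gS r0).
- move=> f Lf; have Lh := sg_L2 gS h0 Lf; have Lhh := sg_L2 gS h0 Lh.
  have Lr := sg_L2 gS r0 Lf.
  have := sg_semigroup gS h0 h0 Lf; rewrite hh => E.
  rewrite (eqL2_innerl Lr Lhh Lf E) (sg_adjoint sa gS h0 Lh Lf) conjc_real.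
  by rewrite inner_L2norm lecR sqr_ge0.
move=> f g Lf Lg; have Lr := sg_L2 gS r0 Lf; have Lrr := sg_L2 gS r0 Lr.
have rr : (Re z)%:C + (Re z)%:C = conjc z + z.
  by apply: complex_ext; rewrite ?(ReD, ImD, ReJ, ImJ) /=; ring.
have zz0 : 0 < Re (conjc z + z) by rewrite ReD addr_gt0.
have Lzz := sg_L2 gS zz0 Lf.
have Lz := sg_L2 gS z0 Lf; have Lz' := sg_L2 gS z'0 Lz.
have := sg_semigroup gS r0 r0 Lf; rewrite rr => E1.
have E2 := sg_semigroup gS z'0 z0 Lf.
rewrite -(eqL2_innerl Lzz Lrr Lg E1) (eqL2_innerl Lzz Lz' Lg E2).
by rewrite (sg_adjoint sa gS z'0 Lz Lg) conjcK.
Qed.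

Lemma semigroup_trace_class (z : R[i]) : 0 < Re z -> finite_total_volume G ->
  trace_class mu (S z).
Proof.
move=> z0 vol; split; first exact: (sg_bounded gS z0).
exists (S (Re z)%:C); first exact: semigroup_abs.
move=> I b [Lb ob _].
have r0 : 0 < Re (Re z)%:C by [].
have h0 : 0 < Re (Re z / 2)%:C by rewrite /= divr_gt0.
have hh : (Re z / 2)%:C + (Re z / 2)%:C = (Re z)%:C :> R[i].
  by apply: complex_ext; rewrite ?(ReD, ImD) /=; field.
have [k [M [M0 kM k0 kC kE]]] := evaluation_vectors sa gS dom h0.
have mfin := graph_measure_finite vol.
apply: (@le_lt_trans _ _ ((M ^+ 2)%:E * mu setT)%E); last first.
  by apply: lte_mul_pinfty => //; rewrite lee_fin sqr_ge0.
(* The sum over the basis is a supremum over finite subsets, so Bessel's inequality for finite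
   families suffices for any index type. *)
apply: ge_ereal_sup => _ [X [finX _] <-].
rewrite fsbig_finite//=; set s := mathcomp.finmap.finmap.enum_fset _.
have us : uniq s by exact: mathcomp.finmap.finmap.fset_uniq.
(* Bessel is applied at each point p of the graph, which requires the continuous representatives:
   there [u i p] is <b_i, k_p>. *)
have rep i : exists u, eqL2 mu (S (Re z / 2)%:C (b i)) u /\ H1 u.
  by have [u h1 h2] := sg_H1 gS dom h0 (Lb i); exists u.
pose u i := projT1 (cid (rep i)).
have ub i : eqL2 mu (S (Re z / 2)%:C (b i)) (u i) by have [] := projT2 (cid (rep i)).
have uH1 i : H1 (u i) by have [] := projT2 (cid (rep i)).
have Lu i : L2 mu (u i) by have [] := uH1 i.
have mnu i : measurable_fun setT (fun p => (normc (u i p) ^+ 2)%:E).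
  by apply/measurable_EFinP/measurable_sqr_normc; have /L2P[] := Lu i.
have term i : (Re (inner mu (S (Re z)%:C (b i)) (b i)))%:E =
    (\int[mu]_p (normc (u i p) ^+ 2)%:E)%E.
  have Lh := sg_L2 gS h0 (Lb i); have Lhh := sg_L2 gS h0 Lh.
  have Lr := sg_L2 gS r0 (Lb i).
  have := sg_semigroup gS h0 h0 (Lb i); rewrite hh => E.
  rewrite (eqL2_innerl Lr Lhh (Lb i) E) (sg_adjoint sa gS h0 Lh (Lb i)) conjc_real.
  rewrite inner_L2norm RRe (eqL2_norm Lh (Lu i) (ub i)).
  by rewrite integral_sqr_normc.
under eq_bigr do rewrite term.
rewrite -ge0_integral_sum//; last by move=> i p _; rewrite lee_fin sqr_ge0.
rewrite -integral_cst//.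
apply: ae_ge0_le_integral => //.
- by move=> p _; apply: sume_ge0 => i _; rewrite lee_fin sqr_ge0.
- exact: emeasurable_sum.
- by move=> p _; rewrite lee_fin sqr_ge0.
apply: ae_points => p pp _; rewrite sumEFin lee_fin.
have [Lkp kpM] := kM p.
apply: (@le_trans _ _ (L2norm mu (k p) ^+ 2)); last first.
  by rewrite ler_pXn2r ?nnegrE ?L2norm_ge0.
apply: le_trans (Bessel Lb ob us Lkp).
rewrite le_eqVlt; apply/orP; left; apply/eqP; apply: eq_bigr => i _.
rewrite -(kE _ _ (Lb i) (ub i) (uH1 i) p pp) (inner_conj Lkp (Lb i)).
by rewrite normc_conj.
Qed.

End semigroup_kernel.

Theorem theorem5p2 (R : realType) (G : metric_graph R)
    (H : (graph_point G -> R[i]) -> (graph_point G -> R[i]) -> Prop)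
    (S : R[i] -> (graph_point G -> R[i]) -> graph_point G -> R[i]) (z : R[i])
    (H_self_adjoint : self_adjoint (@graph_measure R G) H)
    (H_semibounded : lower_semibounded (@graph_measure R G) H)
    (H_extends : extends H (@minimal_laplacian R G))
    (S_semigroup : generates_semigroup (@graph_measure R G) H S)
    (z_gt0 : 0 < complex.Re z) :
  (domain_in_H1 H ->
    exists K : graph_point G -> graph_point G -> R[i],
      [/\ integral_operator (@graph_measure R G) (S z) K,
          Linfty_kernel (@graph_measure R G) K
        & jointly_hoelder_half K]) /\
  (domain_in_H1 H -> finite_total_volume G ->
    trace_class (@graph_measure R G) (S z)).
Proof.
split => [dom|dom vol].
  exact: (semigroup_kernel H_self_adjoint S_semigroup dom z_gt0).
exact: (semigroup_trace_class H_self_adjoint S_semigroup dom z_gt0 vol).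
Qed.
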